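(* Denote an element $a[S_1\circ\eta]+b[T_1]\in\pi_3(S^2\times S^3)$ by $(a,b)$. (1) The homotopy classes $(a,1)$, $(a,-1)$ can be represented by an embedding of $S^3$ for each integer $a$. Such an embedding is homotopic to $f\circ T_1$ for some diffeomorphism $f$ of $S^2\times S^3$. (2) For $b=2$ or $b\ge3$ odd, there exists $a\in\{0,1,\dots,b-1\}$ such that the homotopy classes $(a+kb,b)$, $(a+kb,-b)$ can be represented by an embedding of $S^3$ for each integer $k$. Such an embedding is not homotopic to $f\circ T_1$ for any diffeomorphism $f$ of $S^2\times S^3$.
   Context: Embeddings and diffeomorphisms are smooth. $S_1:S^2\hookrightarrow S^2\times S^3$ and $T_1:S^3\hookrightarrow S^2\times S^3$ are the standard embeddings (of the factors), and $\eta:S^3\to S^2$ is the Hopf map; $\pi_3(S^2\times S^3)$ is free abelian of rank 2 with basis $\{[S_1\circ\eta],[T_1]\}$. Diffeomorphisms are not required to preserve orientation. *)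

(* Defs.v *)
From HB Require Import structures.
From mathcomp Require Import all_boot all_order all_algebra.
From mathcomp Require Import all_classical all_reals all_analysis.

Set Implicit Arguments.
Unset Strict Implicit.
Unset Printing Implicit Defensive.
Import Order.TTheory GRing.Theory Num.Theory.
Import numFieldNormedType.Exports.
Local Open Scope classical_set_scope.
Local Open Scope ring_scope.

(* Manifolds are subsets of normed spaces, and a map A -> B between them is a
   total function on the ambient spaces, of which only the values on A matter.
   The subsets used are S^2 in R^3, S^3 in R^4 and S^2 x S^3 in R^3 x R^4. *)

Section Smooth.
Context {R : realType} {V W : normedModType R}.

(* C^k on an open set U; meant for finite-dimensional V. *)
Fixpoint Ck (k : nat) (U : set V) (F : V -> W) : Prop :=
  match k with
  | 0%N => forall x, U x -> {for x, continuous F}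
  | k'.+1 => (forall x, U x -> differentiable F x) /\
             (forall v : V, Ck k' U ('D_v F))
  end.

Definition local_smooth_extension (A : set V) (f : V -> W) (x : V)
    (F : V -> W) : Prop :=
  exists U : set V, [/\ open U, U x, forall k, Ck k U F &
    forall y, (A `&` U) y -> F y = f y].

Definition smooth (A : set V) (f : V -> W) : Prop :=
  forall x, A x -> exists F, local_smooth_extension A f x F.

Definition homotopic (A : set V) (B : set W) (f g : V -> W) : Prop :=
  exists H : R * V -> W,
    [/\ {within `[0, 1]%classic `*` A, continuous H},
        set_fun (`[0, 1]%classic `*` A) B H,
        forall x, A x -> H (0, x) = f x &
        forall x, A x -> H (1, x) = g x].

Definition homeo_onto_image (A : set V) (f : V -> W) : Prop :=
  {within A, continuous f} /\
  exists g : W -> V,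
    {within f @` A, continuous g} /\ forall x, A x -> g (f x) = x.

End Smooth.

Definition diffeomorphism {R : realType} {V : normedModType R} (M : set V)
    (f : V -> V) : Prop :=
  [/\ set_fun M M f, smooth M f &
      exists g : V -> V, [/\ set_fun M M g, smooth M g,
        forall x, M x -> g (f x) = x & forall x, M x -> f (g x) = x]].

Section Spheres.
Context {R : realType}.

(* The norm of the library on 'rV[R]_n is the sup norm, not the Euclidean one. *)
Definition sphere n : set 'rV[R]_n.+1 :=
  [set x | \sum_i x 0 i ^+ 2 = 1].
Arguments sphere : clear implicits.

Definition tangent_sphere n (x : 'rV[R]_n.+1) : set 'rV[R]_n.+1 :=
  [set v | \sum_i x 0 i * v 0 i = 0].

(* The differential of f on the tangent space does not depend on the local
   extension F. *)
Definition immersion n (W : normedModType R) (f : 'rV[R]_n.+1 -> W) : Prop :=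
  forall x, sphere n x -> exists F : 'rV[R]_n.+1 -> W,
    local_smooth_extension (sphere n) f x F /\
    forall v, tangent_sphere x v -> 'd F x v = 0 -> v = 0.

Definition embedding n (W : normedModType R) (M : set W)
    (f : 'rV[R]_n.+1 -> W) : Prop :=
  [/\ set_fun (sphere n) M f, smooth (sphere n) f, immersion f &
      homeo_onto_image (sphere n) f].

Definition S2xS3 : set ('rV[R]_3 * 'rV[R]_4) := sphere 2 `*` sphere 3.

Definition base2 : 'rV[R]_3 := \row_(j < 3) [:: 0; 0; 1]`_j.
Definition base3 : 'rV[R]_4 := \row_(j < 4) [:: 1; 0; 0; 0]`_j.

(* (z, w) |-> (2 z conj(w), |z|^2 - |w|^2) for z = x0 + i x1, w = x2 + i x3;
   it sends base3 to base2. *)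
Definition hopf (x : 'rV[R]_4) : 'rV[R]_3 :=
  \row_(j < 3) [:: 2 * (x 0 0 * x 0 2 + x 0 1 * x 0 3);
                   2 * (x 0 1 * x 0 2 - x 0 0 * x 0 3);
                   x 0 0 ^+ 2 + x 0 1 ^+ 2 - (x 0 2 ^+ 2 + x 0 3 ^+ 2)]`_j.

Definition S1 (y : 'rV[R]_3) : 'rV[R]_3 * 'rV[R]_4 := (y, base3).
Definition T1 (x : 'rV[R]_4) : 'rV[R]_3 * 'rV[R]_4 := (base2, x).

(* The map x |-> rho (2 x1 x - e1), with rho the rotation e0 |-> e1,
   e1 |-> - e0. It collapses the equator x1 = 0 of S^3 to base3 and maps each
   of the two open hemispheres diffeomorphically, with degree +1, onto
   S^3 \ {base3}: it is the pinch map S^3 -> S^3 \/ S^3 followed by the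
   folding map. *)
Definition pinch (x : 'rV[R]_4) : 'rV[R]_4 :=
  \row_(j < 4) [:: 1 - 2 * x 0 1 ^+ 2; 2 * x 0 0 * x 0 1;
                   2 * x 0 1 * x 0 2; 2 * x 0 1 * x 0 3]`_j.

Definition reflect3 (x : 'rV[R]_4) : 'rV[R]_4 :=
  \row_(j < 4) [:: x 0 0; - x 0 1; x 0 2; x 0 3]`_j.

(* The operations of pi_3 (X, x0), on representatives: maps S^3 -> X sending
   base3 to x0. *)
Section Pi3.
Context {X : Type}.
Implicit Types f g : 'rV[R]_4 -> X.

Definition pi3_zero (x0 : X) : 'rV[R]_4 -> X := fun=> x0.

Definition pi3_add f g : 'rV[R]_4 -> X :=
  fun x => if 0 <= x 0 1 then f (pinch x) else g (pinch x).

Definition pi3_opp f : 'rV[R]_4 -> X := f \o reflect3.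

Definition pi3_mulz (a : int) f : 'rV[R]_4 -> X :=
  match a with
  | Posz n => iter n (pi3_add f) (pi3_zero (f base3))
  | Negz n => pi3_opp (iter n.+1 (pi3_add f) (pi3_zero (f base3)))
  end.

End Pi3.

(* The homotopy class a [S1 o hopf] + b [T1]. As S^2 x S^3 is simply
   connected, an element of pi_3 is the same as a free homotopy class, so the
   members are not required to preserve base points. *)
Definition htpy_class (a b : int) : set ('rV[R]_4 -> 'rV[R]_3 * 'rV[R]_4) :=
  [set g | homotopic (sphere 3) S2xS3
             (pi3_add (pi3_mulz a (S1 \o hopf)) (pi3_mulz b T1)) g].

Definition represented_by_embedding (a b : int) : Prop :=
  exists2 g, embedding S2xS3 g & htpy_class a b g.

Definition htpic_to_diffeo_T1 (g : 'rV[R]_4 -> 'rV[R]_3 * 'rV[R]_4) : Prop :=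
  exists2 f : 'rV[R]_3 * 'rV[R]_4 -> 'rV[R]_3 * 'rV[R]_4,
    diffeomorphism S2xS3 f & homotopic (sphere 3) S2xS3 g (f \o T1).

End Spheres.
Arguments sphere : clear implicits.
Arguments S2xS3 : clear implicits.
Arguments represented_by_embedding : clear implicits.
Arguments htpy_class : clear implicits.

(* Main.v *)
Require Import Defs.
From HB Require Import structures.
From mathcomp Require Import all_boot all_order all_algebra.
From mathcomp Require Import all_classical all_reals all_analysis.
From mathcomp Require Import ring lra zify.
Set Implicit Arguments.
Unset Strict Implicit.
Unset Printing Implicit Defensive.
Import Order.TTheory GRing.Theory Num.Theory.
Import numFieldNormedType.Exports.
Local Open Scope classical_set_scope.
Local Open Scope ring_scope.

(* S^3 is the group of unit quaternions, and conjugation gives a map rot from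
   S^3 to SO(3) whose orbit map is the Hopf map. Splitting S^3 along the pinch
   map (Eckmann-Hilton) shows that the class (a, b) contains
   x |-> (hopf (x^a), x^b).

   (1) For b = 1 or -1 this is f o T1 for the diffeomorphism
   f (y, x) = (rot (x^a) y, x^b).

   (2) Embeddings: for n > 0 the map (z, w) |-> (z, (z^n, w) / |(z^n, w)|) embeds
   S^3 in C x S^3, since z determines |w|; its second component is homotopic to
   the n-th power map and its first one is null-homotopic in S^2. Applying the
   diffeomorphisms of (1) represents the classes (k n, n) and (k n, -n), so that
   a = 0 works for every b.

   (2) Not homotopic to f o T1: if f is a diffeomorphism, put
   (u, v) = f^-1 o T1 and let k be the second component of f. Then the identity
   k (u, v) of S^3 is, up to homotopy, the product of x |-> k (u x, pt) and
   x |-> k (pt, v x). The first one factors through the smooth map k (-, pt) from S^2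
   to S^3, which is not onto, hence is null-homotopic; the second one is
   v(x)^c if f o T1 is in the class (a, c). This is impossible for |c| > 1 by a
   degree argument, where the degree of a map S^3 -> S^3 is counted with Kuhn
   triangulations of the cube, as in Sperner's lemma. *)

(** * Continuity on a subset *)

(** The group structure of S^3 takes the place of homotopy and homology theory. It turns
    concatenation of maps into pointwise products, so that only two facts about degrees remain: the
    identity has degree 1, and a b-th power has degree divisible by b. Neither multiplicativity of
    the degree nor its independence of the triangulation is called for: two maps are compared at one
    common mesh, fine enough for the homotopies at hand and with a number of subdivisions divisible
    by 2 b. Smoothness of f serves to contract k (-, pt): a continuous map from S^2 may cover S^3,
    while a map that misses z is nowhere antipodal to the constant -z and contracts to it along
    great circles. Since smoothness and immersions are expressed by extensions to open sets of the
    ambient space, the embeddings and their left inverses are given by formulas whose denominators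
    stay positive off the spheres too. *)

Record contin {T U : topologicalType} (A : set T) (f : T -> U) : Prop :=
  Contin { contin_cvg : forall x, A x -> f @ within A (nbhs x) --> f x }.

Lemma contin_nbhsP {T U : topologicalType} (A : set T) (f : T -> U) :
  contin A f <-> forall x, A x -> forall S, nbhs (f x) S ->
    nbhs x [set y | A y -> S (f y)].
Proof. by split=> [[]//|cf]; split. Qed.

Section Contin.
Context {T U Z : topologicalType}.
Implicit Types (A B : set T).

(** [contin] keeps the ambient types, and being a record it is not unfolded by unification, so that
    the closure properties below apply directly to a goal. This equivalence leads to and from the
    continuity used in [homotopic]. *)
Lemma continP A (f : T -> U) : {within A, continuous f} <-> contin A f.
Proof.
by split=> [/subspace_continuousP //|[cf]]; exact/subspace_continuousP.
Qed.

Lemma contin_continuous A (f : T -> U) : continuous f -> contin A f.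
Proof. by move=> cf; split=> x _; apply: cvg_within_filter; exact: cf. Qed.

Lemma contin_cst A (c : U) : contin A (fun=> c).
Proof. by split=> x _; exact: cvg_cst. Qed.

Lemma contin_id A : contin A (fun x : T => x).
Proof. by split=> x _; apply: cvg_within_filter; exact: cvg_id. Qed.

Lemma contin_eq A (f g : T -> U) :
  (forall x, A x -> f x = g x) -> contin A f -> contin A g.
Proof.
move=> fg [cf]; split=> x Ax; rewrite -fg//; apply: cvg_trans (cf x Ax).
by apply: fmap_within_eq => y /set_mem Ay; rewrite fg.
Qed.

Lemma contin_comp A (B : set U) (f : T -> U) (g : U -> Z) :
  set_fun A B f -> contin A f -> contin B g -> contin A (fun x => g (f x)).
Proof.
move=> fAB /contin_nbhsP cf /contin_nbhsP cg; apply/contin_nbhsP => x Ax S nS.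
apply: filterS (cf x Ax _ (cg (f x) (fAB x Ax) S nS)) => y h Ay.
by apply: (h Ay); exact: fAB.
Qed.

Lemma contin_pair A (f : T -> U) (g : T -> Z) :
  contin A f -> contin A g -> contin A (fun x => (f x, g x)).
Proof. by move=> [cf] [cg]; split=> x Ax; apply: cvg_pair; [exact: cf|exact: cg]. Qed.

End Contin.

Lemma contin_fst {T U Z : topologicalType} (A : set T) (f : T -> U * Z) :
  contin A f -> contin A (fun x => (f x).1).
Proof.
move=> cf; apply: (@contin_comp _ _ _ A setT f fst) => //.
by split=> x _; apply: cvg_within_filter; exact: cvg_fst.
Qed.

Lemma contin_snd {T U Z : topologicalType} (A : set T) (f : T -> U * Z) :
  contin A f -> contin A (fun x => (f x).2).
Proof.
move=> cf; apply: (@contin_comp _ _ _ A setT f snd) => //.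
by split=> x _; apply: cvg_within_filter; exact: cvg_snd.
Qed.

Section ContinReal.
Context {R : realType} {T : topologicalType}.
Implicit Types (A : set T) (f g : T -> R).

Lemma continD A f g : contin A f -> contin A g -> contin A (fun x => f x + g x).
Proof. by move=> [cf] [cg]; split=> x Ax; apply: cvgD; [exact: cf|exact: cg]. Qed.

Lemma continN A f : contin A f -> contin A (fun x => - f x).
Proof. by move=> [cf]; split=> x Ax; apply: cvgN; exact: cf. Qed.

Lemma continM A f g : contin A f -> contin A g -> contin A (fun x => f x * g x).
Proof. by move=> [cf] [cg]; split=> x Ax; apply: cvgM; [exact: cf|exact: cg]. Qed.

Lemma continX A f n : contin A f -> contin A (fun x => f x ^+ n).
Proof.
move=> cf; elim: n => [|n ih]; first exact: contin_cst.
by apply: contin_eq (continM cf ih) => x _; rewrite exprS.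
Qed.

Lemma continV A f :
  (forall x, A x -> f x != 0) -> contin A f -> contin A (fun x => (f x)^-1).
Proof. by move=> f0 [cf]; split=> x Ax; apply: cvgV; [exact: f0|exact: cf]. Qed.

Lemma contin_sqrt A f : contin A f -> contin A (fun x => Num.sqrt (f x)).
Proof.
move=> cf; apply: (@contin_comp _ _ _ A setT f Num.sqrt) => //.
exact/contin_continuous/sqrt_continuous.
Qed.

Lemma contin_sum A n (f : 'I_n -> T -> R) :
  (forall i, contin A (f i)) -> contin A (fun x => \sum_i f i x).
Proof.
move=> cf; elim: n f cf => [|n ih] f cf.
  by apply: contin_eq (contin_cst A (0 : R)) => x _; rewrite big_ord0.
have cs : contin A (fun x => f ord0 x + \sum_i f (lift ord0 i) x).
  by apply: continD => //; apply: ih.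
by apply: contin_eq cs => x _; rewrite big_ord_recl.
Qed.

Lemma cvg_row {S : Type} (F : set_system S) (FF : Filter F) n
    (f : S -> 'rV[R]_n) (l : 'rV[R]_n) :
  (forall i, f s 0 i @[s --> F] --> l 0 i) -> f @ F --> l.
Proof.
move=> cf; apply/cvgrPdist_lt => e e0.
have : \forall s \near F, forall i, `|l 0 i - f s 0 i| < e.
  by apply: filter_forall => i; move/cvgrPdist_lt: (cf i); exact.
apply: filterS => s fs.
rewrite [ltLHS]/Num.Def.normr/= mx_normrE.
apply/bigmax_ltP; split=> // -[i j] _ /=.
by rewrite !mxE/= !ord1; exact: fs.
Qed.

Lemma contin_row A n (f : T -> 'rV[R]_n) :
  (forall i, contin A (fun x => f x 0 i)) -> contin A f.
Proof. by move=> cf; split=> x Ax; apply: cvg_row => i; case: (cf i); exact. Qed.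

Lemma contin_coord A n (f : T -> 'rV[R]_n) i :
  contin A f -> contin A (fun x => f x 0 i).
Proof.
move=> cf; apply: (@contin_comp _ _ _ A setT f (fun y => y 0 i)) => //.
exact/contin_continuous/coord_continuous.
Qed.

(** The pasting lemma for two relatively closed pieces; only at points with h = 0 do both pieces
    have to supply a neighbourhood. *)
Lemma contin_glue (U : topologicalType) A (h : T -> R) (f g : T -> U) :
  contin A h ->
  contin (A `&` [set x | 0 <= h x]) f ->
  contin (A `&` [set x | h x <= 0]) g ->
  (forall x, A x -> h x = 0 -> f x = g x) ->
  contin A (fun x => if 0 <= h x then f x else g x).
Proof.
move=> [ch] /contin_nbhsP cf /contin_nbhsP cg fg.
apply/contin_nbhsP => x Ax S /= nS.
have [h0|h0|h0] := ltgtP 0 (h x).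
- rewrite ltW// in nS; have nf := cf x (conj Ax (ltW h0)) S nS.
  have hp : nbhs x [set y | A y -> 0 < h y].
    exact: (cvgr_gt _ (ch x Ax) _ h0).
  apply: filterS2 nf hp => y Sy hy Ay; have {}hy := ltW (hy Ay).
  by rewrite hy; apply: Sy.
- rewrite leNgt h0/= in nS; have ng := cg x (conj Ax (ltW h0)) S nS.
  have hp : nbhs x [set y | A y -> h y < 0].
    exact: (cvgr_lt _ (ch x Ax) _ h0).
  apply: filterS2 ng hp => y Sy hy Ay; have {}hy := hy Ay.
  by rewrite leNgt hy/=; apply: Sy; split => //; exact: ltW.
- rewrite -h0 lexx in nS.
  have nf : nbhs x [set y | (A `&` [set x | 0 <= h x]) y -> S (f y)].
    by apply: cf nS; split => //=; rewrite -h0.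
  have ng : nbhs x [set y | (A `&` [set x | h x <= 0]) y -> S (g y)].
    by apply: cg; [split => //=; rewrite -h0|rewrite -fg].
  apply: filterS2 nf ng => y Sf Sg Ay.
  by case: (lerP 0 (h y)) => hy; [exact: Sf|apply: Sg; split => //; exact: ltW].
Qed.

End ContinReal.

(** * Homotopies and spheres *)

Section Homotopy.
Context {R : realType}.

Lemma contin_pair_const {V W : topologicalType} (A : set V) (t : W) :
  contin A (fun x => (t, x)).
Proof. by apply: contin_pair; [exact: contin_cst|exact: contin_id]. Qed.

Lemma homotopicP {V W : normedModType R} (A : set V) (B : set W) (f g : V -> W)
    (H : R * V -> W) :
  contin (`[(0 : R), 1]%classic `*` A) H ->
  (forall t x, 0 <= t -> t <= 1 -> A x -> B (H (t, x))) ->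
  (forall x, A x -> H (0, x) = f x) -> (forall x, A x -> H (1, x) = g x) ->
  homotopic A B f g.
Proof.
move=> cH HB H0 H1; exists H; split=> //; first exact/continP.
by case=> t x [/= /[!in_itv]/= /andP[t0 t1] Ax]; exact: HB.
Qed.

Section General.
Context {V W : normedModType R}.
Implicit Types (A : set V) (B : set W) (f g h : V -> W).

Lemma homotopic_contin A B f g : homotopic A B f g -> contin A f.
Proof.
move=> [H [/continP cH _ H0 _]].
apply: contin_eq (contin_comp _ (contin_pair_const A (0 : R)) cH) => // x Ax.
by split => //=; rewrite in_itv/= lexx ler01.
Qed.

Lemma homotopic_fun A B f g : homotopic A B f g -> set_fun A B f.
Proof.
move=> [H [_ HB H0 _]] x Ax; rewrite -H0//; apply: HB; split => //=.
by rewrite in_itv/= lexx ler01.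
Qed.

Lemma homotopic_eq A B f g :
  contin A f -> set_fun A B f -> (forall x, A x -> f x = g x) ->
  homotopic A B f g.
Proof.
move=> cf fB fg; apply: (@homotopicP _ _ _ _ _ _ (fun p => f p.2)) => //.
- apply: (contin_comp (B := A)) cf; first by move=> x [].
  exact/contin_snd/contin_id.
- by move=> t x _ _; exact: fB.
Qed.

Lemma homotopic_refl A B f : contin A f -> set_fun A B f -> homotopic A B f f.
Proof. by move=> cf fB; exact: homotopic_eq. Qed.

Lemma homotopic_sym A B f g : homotopic A B f g -> homotopic A B g f.
Proof.
move=> [H [/continP cH HB H0 H1]].
apply: (@homotopicP _ _ _ _ _ _ (fun p => H (1 - p.1, p.2))).
- apply: contin_comp cH.
    move=> [t x] [/= /[!in_itv]/= /andP[t0 t1] Ax]; split => //=.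
    by lra.
  apply: contin_pair; last exact/contin_snd/contin_id.
  apply: continD; first exact: contin_cst.
  exact/continN/contin_fst/contin_id.
- by move=> t x t0 t1 Ax; apply: HB; split => //=; rewrite in_itv/=; lra.
- by move=> x Ax /=; rewrite subr0 H1.
- by move=> x Ax /=; rewrite subrr H0.
Qed.

Lemma homotopic_trans A B f g h :
  homotopic A B f g -> homotopic A B g h -> homotopic A B f h.
Proof.
move=> [H [/continP cH HB H0 H1]] [K [/continP cK KB K0 K1]].
apply: (@homotopicP _ _ _ _ _ _ (fun p : R * V => if 0 <= 1 - 2 * p.1
  then H (2 * p.1, p.2) else K (2 * p.1 - 1, p.2))).
- have c1 (C : set (R * V)) : contin C (fun p : R * V => 2 * p.1).
    by apply: continM; [exact: contin_cst|exact/contin_fst/contin_id].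
  have c2 (C : set (R * V)) : contin C (fun p : R * V => p.2).
    exact/contin_snd/contin_id.
  apply: contin_glue.
  + by apply: continD; [exact: contin_cst|exact/continN].
  + apply: contin_comp cH; last exact: contin_pair.
    move=> [t x] [[/= /[!in_itv]/= /andP[t0 t1] Ax] h0]; split => //=.
    by lra.
  + apply: contin_comp cK; last first.
      by apply: contin_pair => //; apply: continD => //; exact: contin_cst.
    move=> [t x] [[/= /[!in_itv]/= /andP[t0 t1] Ax] h0]; split => //=.
    by lra.
  + move=> [t x] [_ /= Ax] h0; have -> : 2 * t = 1 by lra.
    by rewrite H1// subrr K0.
- move=> t x t0 t1 Ax /=; case: ifPn => h0.
    by apply: HB; split => //=; rewrite in_itv/=; lra.
  by apply: KB; split => //=; rewrite in_itv/=; lra.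
- by move=> x Ax /=; rewrite mulr0 subr0 ler01 H0.
- move=> x Ax /=; rewrite mulr1 ifN; last by rewrite -ltNge; lra.
  by rewrite (_ : 2 - 1 = 1) ?K1//; lra.
Qed.

Lemma homotopic_contin_r A B f g : homotopic A B f g -> contin A g.
Proof. by move/homotopic_sym/homotopic_contin. Qed.

Lemma homotopic_fun_r A B f g : homotopic A B f g -> set_fun A B g.
Proof. by move/homotopic_sym/homotopic_fun. Qed.

End General.

Lemma homotopic_comp {U V W : normedModType R} (A : set U) (B : set V)
    (C : set W) (f f' : U -> V) (g g' : V -> W) :
  homotopic A B f f' -> homotopic B C g g' ->
  homotopic A C (fun x => g (f x)) (fun x => g' (f' x)).
Proof.
move=> [H [/continP cH HB H0 H1]] [K [/continP cK KC K0 K1]].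
have HB' t x : 0 <= t -> t <= 1 -> A x -> B (H (t, x)).
  by move=> t0 t1 Ax; apply: HB; split => //=; rewrite in_itv/= t0 t1.
apply: (@homotopicP _ _ _ _ _ _ (fun p => K (p.1, H p))).
- apply: contin_comp cK.
    by move=> [t x] /[dup] tx [/= tI Ax]; split => //=; exact: HB.
  by apply: contin_pair => //; exact/contin_fst/contin_id.
- move=> t x t0 t1 Ax; apply: KC; split => /=; first by rewrite in_itv/= t0 t1.
  exact: HB'.
- by move=> x Ax /=; rewrite K0; [rewrite H0|apply: HB'].
- by move=> x Ax /=; rewrite K1; [rewrite H1|apply: HB'].
Qed.

Lemma homotopic_compl {U V W : normedModType R} (A : set U) (B : set V)
    (C : set W) (f f' : U -> V) (g : V -> W) :
  contin B g -> set_fun B C g -> homotopic A B f f' ->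
  homotopic A C (fun x => g (f x)) (fun x => g (f' x)).
Proof. by move=> cg gC ff; apply: homotopic_comp ff _; exact: homotopic_refl. Qed.

Lemma homotopic_pair {U V W : normedModType R} (A : set U) (B : set V)
    (C : set W) (f f' : U -> V) (g g' : U -> W) :
  homotopic A B f f' -> homotopic A C g g' ->
  homotopic A (B `*` C) (fun x => (f x, g x)) (fun x => (f' x, g' x)).
Proof.
move=> [H [/continP cH HB H0 H1]] [K [/continP cK KC K0 K1]].
apply: (@homotopicP _ _ _ _ _ _ (fun p => (H p, K p))).
- exact: contin_pair.
- move=> t x t0 t1 Ax; have tx : (`[(0 : R), 1]%classic `*` A) (t, x).
    by split => //=; rewrite in_itv/= t0 t1.
  by split => /=; [exact: HB|exact: KC].
- by move=> x Ax; rewrite H0 ?K0.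
- by move=> x Ax; rewrite H1 ?K1.
Qed.

End Homotopy.

(** * Maps into spheres and normalized segments *)

Section Spheres.
Context {R : realType}.

Definition sqnorm n (x : 'rV[R]_n) : R := \sum_i x 0 i ^+ 2.

Definition nrm n (x : 'rV[R]_n) : 'rV[R]_n := (Num.sqrt (sqnorm x))^-1 *: x.

Lemma sqnorm_ge0 n (x : 'rV[R]_n) : 0 <= sqnorm x.
Proof. by apply: sumr_ge0 => i _; exact: sqr_ge0. Qed.

Lemma sqnorm_eq0 n (x : 'rV[R]_n) : (sqnorm x == 0) = (x == 0).
Proof.
apply/eqP/eqP => [/eqP|->].
  rewrite psumr_eq0 => [/allP h|i _]; last exact: sqr_ge0.
  apply/rowP => i; rewrite mxE; apply/eqP.
  by have := h i (mem_index_enum _); rewrite sqrf_eq0.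
by rewrite /sqnorm big1// => i _; rewrite mxE expr0n.
Qed.

Lemma sqnorm_gt0 n (x : 'rV[R]_n) : (0 < sqnorm x) = (x != 0).
Proof. by rewrite lt_neqAle sqnorm_ge0 andbT eq_sym sqnorm_eq0. Qed.

Lemma sqnormZ n a (x : 'rV[R]_n) : sqnorm (a *: x) = a ^+ 2 * sqnorm x.
Proof. by rewrite /sqnorm mulr_sumr; apply: eq_bigr => i _; rewrite mxE exprMn. Qed.

Lemma sqnormN n (x : 'rV[R]_n) : sqnorm (- x) = sqnorm x.
Proof. by apply: eq_bigr => i _; rewrite mxE sqrrN. Qed.

Lemma sphereE n (x : 'rV[R]_n.+1) : sphere R n x <-> sqnorm x = 1.
Proof. by []. Qed.

Lemma sphere_neq0 n (x : 'rV[R]_n.+1) : sphere R n x -> x != 0.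
Proof. by rewrite sphereE -sqnorm_eq0 => ->; exact: oner_neq0. Qed.

Lemma sphereN n (x : 'rV[R]_n.+1) : sphere R n x -> sphere R n (- x).
Proof. by rewrite !sphereE sqnormN. Qed.

Lemma sphere_nrm n (x : 'rV[R]_n.+1) : x != 0 -> sphere R n (nrm x).
Proof.
move=> x0; rewrite sphereE sqnormZ exprVn sqr_sqrtr ?sqnorm_ge0//.
by rewrite mulVf// sqnorm_eq0.
Qed.

Lemma nrm_sphere n (x : 'rV[R]_n.+1) : sphere R n x -> nrm x = x.
Proof. by rewrite sphereE /nrm => ->; rewrite sqrtr1 invr1 scale1r. Qed.

Lemma contin_scale {T : topologicalType} n (A : set T) (a : T -> R)
    (f : T -> 'rV[R]_n) :
  contin A a -> contin A f -> contin A (fun x => a x *: f x).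
Proof.
move=> ca cf; apply: contin_row => i.
have h : contin A (fun x => a x * f x 0 i).
  by apply: continM => //; exact: contin_coord.
by apply: contin_eq h => x _; rewrite mxE.
Qed.

Lemma contin_addv {T : topologicalType} n (A : set T) (f g : T -> 'rV[R]_n) :
  contin A f -> contin A g -> contin A (fun x => f x + g x).
Proof.
move=> cf cg; apply: contin_row => i.
have h : contin A (fun x => f x 0 i + g x 0 i).
  by apply: continD; exact: contin_coord.
by apply: contin_eq h => x _; rewrite mxE.
Qed.

Lemma contin_nrm {T : topologicalType} n (A : set T) (f : T -> 'rV[R]_n) :
  (forall x, A x -> f x != 0) -> contin A f -> contin A (fun x => nrm (f x)).
Proof.
move=> f0 cf; apply: contin_scale => //; apply: continV => [x Ax|].
  by rewrite sqrtr_eq0 -ltNge sqnorm_gt0 f0.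
apply: contin_sqrt; apply: contin_sum => i.
by apply: continX; exact: contin_coord.
Qed.

Lemma homotopic_nrm {V : normedModType R} n (A : set V)
    (H : R * V -> 'rV[R]_n.+1) :
  contin (`[(0 : R), 1]%classic `*` A) H ->
  (forall t x, 0 <= t -> t <= 1 -> A x -> H (t, x) != 0) ->
  homotopic A (sphere R n) (fun x => nrm (H (0, x))) (fun x => nrm (H (1, x))).
Proof.
move=> cH H0; apply: (@homotopicP _ _ _ _ _ _ _ (fun p => nrm (H p))) => //.
- apply: contin_nrm => // -[t x] [/= /[!in_itv]/= /andP[t0 t1] Ax].
  exact: H0.
- by move=> t x t0 t1 Ax; apply: sphere_nrm; exact: H0.
Qed.

Lemma homotopic_line {V : normedModType R} n (A : set V)
    (f g : V -> 'rV[R]_n.+1) :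
  contin A f -> contin A g ->
  (forall t x, 0 <= t -> t <= 1 -> A x -> (1 - t) *: f x + t *: g x != 0) ->
  homotopic A (sphere R n) (fun x => nrm (f x)) (fun x => nrm (g x)).
Proof.
move=> cf cg fg0.
have cA (h : V -> 'rV[R]_n.+1) : contin A h ->
    contin (`[(0 : R), 1]%classic `*` A) (fun p : R * V => h p.2).
  move=> ch; apply: (contin_comp (B := A)) ch; first by move=> x [].
  exact/contin_snd/contin_id.
have ct : contin (`[(0 : R), 1]%classic `*` A) (fun p : R * V => p.1).
  exact/contin_fst/contin_id.
have -> : (fun x => nrm (f x)) = (fun x => nrm ((1 - 0) *: f x + 0 *: g x)).
  by apply/funext => x; rewrite subr0 scale1r scale0r addr0.
have -> : (fun x => nrm (g x)) = (fun x => nrm ((1 - 1) *: f x + 1 *: g x)).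
  by apply/funext => x; rewrite subrr scale0r scale1r add0r.
apply: (@homotopic_nrm V n A (fun p => (1 - p.1) *: f p.2 + p.1 *: g p.2));
  last exact: fg0.
apply: contin_addv; apply: contin_scale; try exact: cA; last exact: ct.
by apply: continD; [exact: contin_cst|exact: continN].
Qed.

(** If the sum vanishes, its two terms have equal norms; this forces t = 1 - t, and then a = - b. *)
Lemma line_neq0 n (a b : 'rV[R]_n.+1) t : sphere R n a -> sphere R n b ->
  a <> - b -> 0 <= t -> t <= 1 -> (1 - t) *: a + t *: b != 0.
Proof.
move=> Sa Sb ab t0 t1; apply/eqP => /eqP; rewrite addr_eq0 => /eqP h.
have : sqnorm ((1 - t) *: a) = sqnorm (- (t *: b)) by rewrite h.
rewrite sqnormN !sqnormZ !(sphereE _).1// !mulr1 => /eqP.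
rewrite eqf_sqr => /orP[/eqP t2|/eqP]; last by lra.
apply: ab; have := h; rewrite t2 -scalerN => /scalerI; apply.
by apply/eqP => t3; lra.
Qed.

Lemma homotopic_sphere {V : normedModType R} n (A : set V)
    (f g : V -> 'rV[R]_n.+1) :
  contin A f -> contin A g ->
  set_fun A (sphere R n) f -> set_fun A (sphere R n) g ->
  (forall x, A x -> f x <> - g x) -> homotopic A (sphere R n) f g.
Proof.
move=> cf cg fS gS fg.
have nrmE (h : V -> 'rV[R]_n.+1) : contin A h -> set_fun A (sphere R n) h ->
    homotopic A (sphere R n) h (fun x => nrm (h x)).
  by move=> ch hS; apply: homotopic_eq => // x Ax; rewrite nrm_sphere//; exact: hS.
apply: homotopic_trans (nrmE _ cf fS) _.
apply: homotopic_trans (homotopic_sym (nrmE _ cg gS)).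
apply: homotopic_line => // t x t0 t1 Ax; apply: line_neq0 => //.
- exact: fS.
- exact: gS.
- exact: fg.
Qed.

Lemma homotopic_sphere_cst {V : normedModType R} n (A : set V)
    (a b : 'rV[R]_n.+2) :
  sphere R n.+1 a -> sphere R n.+1 b ->
  homotopic A (sphere R n.+1) (fun=> a) (fun=> b).
Proof.
move=> Sa Sb.
have line c d : sphere R n.+1 c -> sphere R n.+1 d -> c <> - d ->
    homotopic A (sphere R n.+1) (fun=> c) (fun=> d).
  by move=> Sc Sd cd; apply: homotopic_sphere => //; exact: contin_cst.
have [ab|ab] := pselect (a = - b); last exact: line.
pose e i : 'rV[R]_n.+2 := delta_mx 0 i.
have Se i : sphere R n.+1 (e i).
  rewrite sphereE /sqnorm (bigD1 i)//= big1 => [|j ji].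
    by rewrite mxE !eqxx expr1n addr0.
  by rewrite mxE (negbTE ji) andbF expr0n.
(* Antipodal points are joined through a basis vector different from both; as there are at least two
   coordinates, e 0 or the last one will do. *)
have [i [ei1 ei2]] : exists i, a <> - e i /\ e i <> - b.
  rewrite ab; have [bi|bi] := pselect (b = e ord0 \/ b = - e ord0).
    exists ord_max; split => [/oppr_inj|] be.
      case: bi; rewrite be => /rowP/(_ ord_max); rewrite !mxE !eqxx/=;
      by rewrite ?oppr0 => /eqP; rewrite oner_eq0.
    move: (congr1 -%R be); rewrite opprK => {}be.
    case: bi; rewrite -be => /rowP/(_ ord_max); rewrite !mxE !eqxx/=;
    by rewrite ?oppr0 => /eqP; rewrite ?oppr_eq0 oner_eq0.
  exists ord0; split => [/oppr_inj be|be]; apply: bi; first by left.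
  by right; rewrite be opprK.
by apply: homotopic_trans (line _ _ Sa (Se i) ei1) (line _ _ (Se i) Sb ei2).
Qed.

End Spheres.

(** * Quaternions and the Hopf map *)

Section Coordinates.
Context {R : realType}.

Definition mk3 (a b c : R) : 'rV[R]_3 := \row_(j < 3) [:: a; b; c]`_j.

Definition mk4 (a b c d : R) : 'rV[R]_4 := \row_(j < 4) [:: a; b; c; d]`_j.

Lemma ord4_ind (P : 'I_4 -> Prop) : P 0 -> P 1 -> P 2 -> P 3 -> forall i, P i.
Proof.
move=> P0 P1 P2 P3 [[|[|[|[|//]]]] lt4].
- by have -> : Ordinal lt4 = 0 by exact: val_inj.
- by have -> : Ordinal lt4 = 1 by exact: val_inj.
- by have -> : Ordinal lt4 = 2 by exact: val_inj.
- by have -> : Ordinal lt4 = 3 by exact: val_inj.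
Qed.

Lemma ord3_ind (P : 'I_3 -> Prop) : P 0 -> P 1 -> P 2 -> forall i, P i.
Proof.
move=> P0 P1 P2 [[|[|[|//]]] lt3].
- by have -> : Ordinal lt3 = 0 by exact: val_inj.
- by have -> : Ordinal lt3 = 1 by exact: val_inj.
- by have -> : Ordinal lt3 = 2 by exact: val_inj.
Qed.

Lemma sum4E (F : 'I_4 -> R) : \sum_i F i = F 0 + F 1 + F 2 + F 3.
Proof.
rewrite !big_ord_recl big_ord0 addr0 !addrA.
by congr (F _ + F _ + F _ + F _); exact: val_inj.
Qed.

Lemma sum3E (F : 'I_3 -> R) : \sum_i F i = F 0 + F 1 + F 2.
Proof.
rewrite !big_ord_recl big_ord0 addr0 !addrA.
by congr (F _ + F _ + F _); exact: val_inj.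
Qed.

Lemma mk40 a b c d : mk4 a b c d 0 0 = a. Proof. by rewrite mxE. Qed.
Lemma mk41 a b c d : mk4 a b c d 0 1 = b. Proof. by rewrite mxE. Qed.
Lemma mk42 a b c d : mk4 a b c d 0 2 = c. Proof. by rewrite mxE. Qed.
Lemma mk43 a b c d : mk4 a b c d 0 3 = d. Proof. by rewrite mxE. Qed.
Lemma mk30 a b c : mk3 a b c 0 0 = a. Proof. by rewrite mxE. Qed.
Lemma mk31 a b c : mk3 a b c 0 1 = b. Proof. by rewrite mxE. Qed.
Lemma mk32 a b c : mk3 a b c 0 2 = c. Proof. by rewrite mxE. Qed.
Definition mkE := (mk40, mk41, mk42, mk43, mk30, mk31, mk32).

Lemma mk4_eta (x : 'rV[R]_4) : x = mk4 (x 0 0) (x 0 1) (x 0 2) (x 0 3).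
Proof. by apply/rowP; apply: ord4_ind; rewrite mkE. Qed.

Lemma mk3_eta (x : 'rV[R]_3) : x = mk3 (x 0 0) (x 0 1) (x 0 2).
Proof. by apply/rowP; apply: ord3_ind; rewrite mkE. Qed.

Lemma sqnorm4 (x : 'rV[R]_4) :
  sqnorm x = x 0 0 ^+ 2 + x 0 1 ^+ 2 + x 0 2 ^+ 2 + x 0 3 ^+ 2.
Proof. exact: sum4E. Qed.

Lemma sqnorm3 (x : 'rV[R]_3) : sqnorm x = x 0 0 ^+ 2 + x 0 1 ^+ 2 + x 0 2 ^+ 2.
Proof. exact: sum3E. Qed.

Lemma contin_mk4 {T : topologicalType} (A : set T) (a b c d : T -> R) :
  contin A a -> contin A b -> contin A c -> contin A d ->
  contin A (fun x => mk4 (a x) (b x) (c x) (d x)).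
Proof.
move=> ca cb cc cd; apply: contin_row; apply: ord4_ind.
- by apply: contin_eq ca => x _; rewrite mkE.
- by apply: contin_eq cb => x _; rewrite mkE.
- by apply: contin_eq cc => x _; rewrite mkE.
- by apply: contin_eq cd => x _; rewrite mkE.
Qed.

Lemma contin_mk3 {T : topologicalType} (A : set T) (a b c : T -> R) :
  contin A a -> contin A b -> contin A c ->
  contin A (fun x => mk3 (a x) (b x) (c x)).
Proof.
move=> ca cb cc; apply: contin_row; apply: ord3_ind.
- by apply: contin_eq ca => x _; rewrite mkE.
- by apply: contin_eq cb => x _; rewrite mkE.
- by apply: contin_eq cc => x _; rewrite mkE.
Qed.

End Coordinates.

Ltac contin_arith := repeat first
  [ assumption | exact: contin_id | exact: contin_cst | apply: contin_coord
  | apply: contin_mk4 | apply: contin_mk3 | apply: continD | apply: continN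
  | apply: continM | apply: continX ].

Section Quaternions.
Context {R : realType}.
Implicit Types x y z : 'rV[R]_4.

Definition qmul x y : 'rV[R]_4 := mk4
  (x 0 0 * y 0 0 - x 0 1 * y 0 1 - x 0 2 * y 0 2 - x 0 3 * y 0 3)
  (x 0 0 * y 0 1 + x 0 1 * y 0 0 + x 0 2 * y 0 3 - x 0 3 * y 0 2)
  (x 0 0 * y 0 2 - x 0 1 * y 0 3 + x 0 2 * y 0 0 + x 0 3 * y 0 1)
  (x 0 0 * y 0 3 + x 0 1 * y 0 2 - x 0 2 * y 0 1 + x 0 3 * y 0 0).

Definition qconj x : 'rV[R]_4 := mk4 (x 0 0) (- x 0 1) (- x 0 2) (- x 0 3).

Definition qexp n x : 'rV[R]_4 := iter n (qmul x) base3.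

(** Conjugation is inversion on S^3; used in place of the inverse it keeps negative powers
    polynomial, hence smooth on all of R^4. *)
Definition qpow (a : int) x : 'rV[R]_4 :=
  match a with Posz n => qexp n x | Negz n => qexp n.+1 (qconj x) end.

Lemma base3E : base3 = mk4 1 0 0 0 :> 'rV[R]_4.
Proof. by []. Qed.

Lemma base2E : base2 = mk3 0 0 1 :> 'rV[R]_3.
Proof. by []. Qed.

Lemma qmulA x y z : qmul x (qmul y z) = qmul (qmul x y) z.
Proof. by apply/rowP; apply: ord4_ind; rewrite /qmul !mkE; ring. Qed.

Lemma qmul1 x : qmul x base3 = x.
Proof. by apply/rowP; apply: ord4_ind; rewrite base3E /qmul !mkE; ring. Qed.

Lemma q1mul x : qmul base3 x = x.
Proof. by apply/rowP; apply: ord4_ind; rewrite base3E /qmul !mkE; ring. Qed.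

Lemma qconjM x y : qconj (qmul x y) = qmul (qconj y) (qconj x).
Proof. by apply/rowP; apply: ord4_ind; rewrite /qconj /qmul !mkE; ring. Qed.

Lemma qconjK : involutive qconj.
Proof. by move=> x; apply/rowP; apply: ord4_ind; rewrite /qconj !mkE ?opprK. Qed.

Lemma qconj1 : qconj base3 = base3.
Proof. by apply/rowP; apply: ord4_ind; rewrite base3E /qconj !mkE ?oppr0. Qed.

Lemma qmulZl a x y : qmul (a *: x) y = a *: qmul x y.
Proof. by apply/rowP; apply: ord4_ind; rewrite /qmul !mxE/=; ring. Qed.

Lemma qmulZr a x y : qmul x (a *: y) = a *: qmul x y.
Proof. by apply/rowP; apply: ord4_ind; rewrite /qmul !mxE/=; ring. Qed.

Lemma qmul_conjr x : qmul x (qconj x) = sqnorm x *: base3.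
Proof.
by apply/rowP; apply: ord4_ind; rewrite base3E sqnorm4 /qconj /qmul !mxE/=; ring.
Qed.

Lemma qmul_conjl x : qmul (qconj x) x = sqnorm x *: base3.
Proof.
by apply/rowP; apply: ord4_ind; rewrite base3E sqnorm4 /qconj /qmul !mxE/=; ring.
Qed.

Lemma sqnorm_qmul x y : sqnorm (qmul x y) = sqnorm x * sqnorm y.
Proof. by rewrite !sqnorm4 /qmul !mkE; ring. Qed.

Lemma sqnorm_qconj x : sqnorm (qconj x) = sqnorm x.
Proof. by rewrite !sqnorm4 /qconj !mkE; ring. Qed.

Lemma sqnorm_base3 : sqnorm base3 = 1 :> R.
Proof. by rewrite sqnorm4 base3E !mkE; ring. Qed.

Lemma sqnorm_base2 : sqnorm base2 = 1 :> R.
Proof. by rewrite sqnorm3 base2E !mkE; ring. Qed.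

Lemma sphere_base3 : sphere R 3 base3.
Proof. exact/sphereE/sqnorm_base3. Qed.

Lemma sphere_base2 : sphere R 2 base2.
Proof. exact/sphereE/sqnorm_base2. Qed.

Lemma sphere_qmul x y : sphere R 3 x -> sphere R 3 y -> sphere R 3 (qmul x y).
Proof. by rewrite !sphereE sqnorm_qmul => -> ->; rewrite mulr1. Qed.

Lemma sphere_qconj x : sphere R 3 x -> sphere R 3 (qconj x).
Proof. by rewrite !sphereE sqnorm_qconj. Qed.

Lemma qmulVq x : sphere R 3 x -> qmul (qconj x) x = base3.
Proof. by rewrite qmul_conjl => /sphereE ->; rewrite scale1r. Qed.

Lemma qmulqV x : sphere R 3 x -> qmul x (qconj x) = base3.
Proof. by rewrite qmul_conjr => /sphereE ->; rewrite scale1r. Qed.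

Lemma qexpS n x : qexp n.+1 x = qmul x (qexp n x).
Proof. by []. Qed.

Lemma qexpD m n x : qexp (m + n) x = qmul (qexp m x) (qexp n x).
Proof.
by elim: m => [|m ih]; rewrite ?q1mul// addSn !qexpS ih qmulA.
Qed.

Lemma qexpSr n x : qexp n.+1 x = qmul (qexp n x) x.
Proof. by rewrite -[X in qexp X](addn1 n) qexpD {2}/qexp/= qmul1. Qed.

Lemma qexpM m n x : qexp (m * n) x = qexp m (qexp n x).
Proof. by elim: m => [//|m ih]; rewrite mulSn qexpD ih. Qed.

Lemma qconj_qexp n x : qconj (qexp n x) = qexp n (qconj x).
Proof. by elim: n => [|n ih]; rewrite ?qconj1// qexpSr qconjM ih -qexpS. Qed.

Lemma qexp1n n : qexp n base3 = base3.
Proof. by elim: n => // n ih; rewrite qexpS ih q1mul. Qed.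

Lemma sphere_qexp n x : sphere R 3 x -> sphere R 3 (qexp n x).
Proof.
move=> Sx; elim: n => [|n ih]; first exact: sphere_base3.
exact: sphere_qmul.
Qed.

Lemma qpow_negz n x : qpow (- n%:Z) x = qexp n (qconj x).
Proof. by case: n => [|n]. Qed.

Lemma qpowN a x : qpow (- a) x = qpow a (qconj x).
Proof.
case: (intP a) => [//|n|n]; first by rewrite qpow_negz.
by rewrite qpow_negz qconjK opprK.
Qed.

Lemma qpowM a b x : qpow (a * b) x = qpow a (qpow b x).
Proof.
have pos (m n : nat) y : qpow (m%:Z * n%:Z) y = qexp m (qexp n y).
  by rewrite -PoszM -qexpM.
have [m am] : exists m : nat, a = m%:Z \/ a = - m%:Z.
  by case: a => m; [exists m; left|exists m.+1; right].
have [n bn] : exists n : nat, b = n%:Z \/ b = - n%:Z.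
  by case: b => n; [exists n; left|exists n.+1; right].
case: am bn => -> [] ->.
- exact: pos.
- by rewrite mulrN !qpowN pos.
- by rewrite mulNr !qpowN pos /= qconj_qexp.
- by rewrite mulrNN pos !qpowN /= qconj_qexp qconjK.
Qed.

Lemma sphere_qpow a x : sphere R 3 x -> sphere R 3 (qpow a x).
Proof.
by case: a => n Sx; apply: sphere_qexp => //; exact: sphere_qconj.
Qed.

Section ContinQ.
Context {T : topologicalType} (A : set T).

Lemma contin_qmul (f g : T -> 'rV[R]_4) :
  contin A f -> contin A g -> contin A (fun t => qmul (f t) (g t)).
Proof. by move=> cf cg; contin_arith. Qed.

Lemma contin_qconj (f : T -> 'rV[R]_4) :
  contin A f -> contin A (fun t => qconj (f t)).
Proof. by move=> cf; contin_arith. Qed.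

Lemma contin_qexp n (f : T -> 'rV[R]_4) :
  contin A f -> contin A (fun t => qexp n (f t)).
Proof.
move=> cf; elim: n => [|n ih]; first exact: contin_cst.
exact: contin_qmul.
Qed.

Lemma contin_qpow a (f : T -> 'rV[R]_4) :
  contin A f -> contin A (fun t => qpow a (f t)).
Proof.
case: a => n cf; first exact: contin_qexp.
by apply: contin_qexp; exact: contin_qconj.
Qed.

Lemma contin_hopf (f : T -> 'rV[R]_4) :
  contin A f -> contin A (fun t => hopf (f t)).
Proof.
move=> cf; rewrite /hopf.
by apply: (@contin_mk3 R T A _ _ _);
  contin_arith.
Qed.

End ContinQ.

Lemma homotopic_qmul {V : normedModType R} (A : set V)
    (f f' g g' : V -> 'rV[R]_4) :
  homotopic A (sphere R 3) f f' -> homotopic A (sphere R 3) g g' ->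
  homotopic A (sphere R 3) (fun v => qmul (f v) (g v))
    (fun v => qmul (f' v) (g' v)).
Proof.
move=> ff gg; apply: (homotopic_compl (B := sphere R 3 `*` sphere R 3)
  (g := fun p => qmul p.1 p.2)) (homotopic_pair ff gg).
- by apply: contin_qmul; [exact/contin_fst/contin_id|exact/contin_snd/contin_id].
- by move=> [p q] []; exact: sphere_qmul.
Qed.

Lemma homotopic_qexp {V : normedModType R} (A : set V) n
    (f f' : V -> 'rV[R]_4) :
  homotopic A (sphere R 3) f f' ->
  homotopic A (sphere R 3) (fun v => qexp n (f v)) (fun v => qexp n (f' v)).
Proof.
move=> ff; apply: (homotopic_compl (B := sphere R 3) (g := qexp n)) ff.
  exact/contin_qexp/contin_id.
by move=> x; exact: sphere_qexp.
Qed.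

End Quaternions.

(** * The rotation action on S^2 and the Hopf map *)

Section Rotations.
Context {R : realType}.
Implicit Types (x : 'rV[R]_4) (y : 'rV[R]_3).

(* The imaginary quaternion y2 i + y1 j + y0 k; with this identification of R^3
   the orbit map of i under conjugation is the Hopf map. *)
Definition imq y : 'rV[R]_4 := mk4 0 (y 0 2) (y 0 1) (y 0 0).

Definition unimq x : 'rV[R]_3 := mk3 (x 0 3) (x 0 2) (x 0 1).

Definition rot x y : 'rV[R]_3 := unimq (qmul (qmul (qconj x) (imq y)) x).

Lemma imqK : cancel imq unimq.
Proof. by move=> y; rewrite [RHS]mk3_eta /unimq /imq !mkE. Qed.

Lemma unimqK x : x 0 0 = 0 -> imq (unimq x) = x.
Proof. by move=> x0; rewrite [RHS]mk4_eta x0 /unimq /imq !mkE. Qed.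

Lemma imq_rot x y : imq (rot x y) = qmul (qmul (qconj x) (imq y)) x.
Proof. by apply: unimqK; rewrite /imq /qmul /qconj !mkE; ring. Qed.

Lemma sqnorm_imq y : sqnorm (imq y) = sqnorm y.
Proof. by rewrite sqnorm4 sqnorm3 !mkE; ring. Qed.

Lemma imqZ a y : imq (a *: y) = a *: imq y.
Proof. by apply/rowP; apply: ord4_ind; rewrite /imq !mxE/= ?mulr0. Qed.

Lemma hopfE x : hopf x = mk3
  (2 * (x 0 0 * x 0 2 + x 0 1 * x 0 3)) (2 * (x 0 1 * x 0 2 - x 0 0 * x 0 3))
  (x 0 0 ^+ 2 + x 0 1 ^+ 2 - (x 0 2 ^+ 2 + x 0 3 ^+ 2)).
Proof. by []. Qed.

Lemma rot_base2 x : rot x base2 = hopf x.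
Proof.
rewrite hopfE base2E /rot /unimq /imq.
by apply/rowP; apply: ord3_ind; rewrite /qmul /qconj !mkE; ring.
Qed.

(** The scale factor is kept for x off the sphere, because the left inverse of an embedding is
    needed on an open set. *)
Lemma rot_conjK x y : rot (qconj x) (rot x y) = sqnorm x ^+ 2 *: y.
Proof.
apply: (can_inj imqK); rewrite !imq_rot qconjK imqZ -!qmulA qmul_conjr !qmulA.
by rewrite qmul_conjr qmulZr qmul1 qmulZl q1mul scalerA.
Qed.

Lemma sqnorm_rot x y : sqnorm (rot x y) = sqnorm x ^+ 2 * sqnorm y.
Proof. by rewrite -!sqnorm_imq imq_rot !sqnorm_qmul sqnorm_qconj; ring. Qed.

Lemma sphere_rot x y : sphere R 3 x -> sphere R 2 y -> sphere R 2 (rot x y).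
Proof. by rewrite !sphereE sqnorm_rot => -> ->; rewrite expr1n mul1r. Qed.

Lemma rotK x y : sphere R 3 x -> rot (qconj x) (rot x y) = y.
Proof. by rewrite rot_conjK => /sphereE ->; rewrite expr1n scale1r. Qed.

Lemma sphere_hopf x : sphere R 3 x -> sphere R 2 (hopf x).
Proof. by rewrite -rot_base2 => Sx; apply: sphere_rot => //; exact: sphere_base2. Qed.

Lemma hopf_base3 : hopf base3 = base2 :> 'rV[R]_3.
Proof.
rewrite hopfE base2E base3E.
by apply/rowP; apply: ord3_ind; rewrite !mkE; ring.
Qed.

Lemma contin_rot {T : topologicalType} (A : set T) (f : T -> 'rV[R]_4)
    (g : T -> 'rV[R]_3) :
  contin A f -> contin A g -> contin A (fun t => rot (f t) (g t)).
Proof.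
move=> cf cg; rewrite /rot.
have c : contin A (fun t => imq (g t)).
  by contin_arith.
have h := contin_qmul (contin_qmul (contin_qconj cf) c) cf.
by apply: contin_mk3; exact: contin_coord.
Qed.

End Rotations.

(** * The homotopy class (a, b) *)

Section Pinch.
Context {R : realType}.
Implicit Types x : 'rV[R]_4.

(** The two halves of the pinch map, each extended by the base point. At every x one of [pinchl x]
    and [pinchr x] is [base3], and each of the two maps is homotopic to the identity: this is the
    Eckmann-Hilton argument in usable form. *)
Definition pinchl x : 'rV[R]_4 := if 0 <= x 0 1 then pinch x else base3.

Definition pinchr x : 'rV[R]_4 := if 0 <= x 0 1 then base3 else pinch x.

Lemma pinchE x : pinch x = mk4 (1 - 2 * x 0 1 ^+ 2) (2 * x 0 0 * x 0 1)
  (2 * x 0 1 * x 0 2) (2 * x 0 1 * x 0 3).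
Proof. by []. Qed.

Lemma sphere4E x : sphere R 3 x <->
  x 0 0 ^+ 2 + x 0 1 ^+ 2 + x 0 2 ^+ 2 + x 0 3 ^+ 2 = 1.
Proof. by rewrite sphereE sqnorm4. Qed.

Lemma sphere_pinch x : sphere R 3 x -> sphere R 3 (pinch x).
Proof.
rewrite !sphere4E pinchE !mkE => x1.
transitivity (1 + 4 * x 0 1 ^+ 2 * (x 0 0 ^+ 2 + x 0 1 ^+ 2 + x 0 2 ^+ 2
  + x 0 3 ^+ 2 - 1)); first by ring.
by rewrite x1; ring.
Qed.

Lemma pinch_equator x : x 0 1 = 0 -> pinch x = base3.
Proof.
by move=> x1; rewrite pinchE x1 base3E; congr mk4; ring.
Qed.

Lemma contin_pinch (A : set 'rV[R]_4) : contin A (@pinch R).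
Proof.
have h : contin A (fun x => mk4 (1 - 2 * x 0 1 ^+ 2) (2 * x 0 0 * x 0 1)
    (2 * x 0 1 * x 0 2) (2 * x 0 1 * x 0 3)) by contin_arith.
by apply: contin_eq h => x _; rewrite pinchE.
Qed.

Lemma contin_pinchl (A : set 'rV[R]_4) : contin A pinchl.
Proof.
apply: contin_glue; [|exact: contin_pinch|exact: contin_cst|].
  by contin_arith.
by move=> x _ /pinch_equator.
Qed.

Lemma contin_pinchr (A : set 'rV[R]_4) : contin A pinchr.
Proof.
apply: contin_glue; [|exact: contin_cst|exact: contin_pinch|].
  by contin_arith.
by move=> x _ /pinch_equator.
Qed.

Lemma sphere_pinchl x : sphere R 3 x -> sphere R 3 (pinchl x).
Proof.
by rewrite /pinchl; case: ifP => _ Sx; [exact: sphere_pinch|exact: sphere_base3].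
Qed.

Lemma sphere_pinchr x : sphere R 3 x -> sphere R 3 (pinchr x).
Proof.
by rewrite /pinchr; case: ifP => _ Sx; [exact: sphere_base3|exact: sphere_pinch].
Qed.

Lemma mk4_inj (a b c d a' b' c' d' : R) : mk4 a b c d = mk4 a' b' c' d' ->
  [/\ a = a', b = b', c = c' & d = d'].
Proof.
move=> /rowP h; split.
- by have := h 0; rewrite !mkE.
- by have := h 1; rewrite !mkE.
- by have := h 2; rewrite !mkE.
- by have := h 3; rewrite !mkE.
Qed.

Lemma mk4N (a b c d : R) : - mk4 a b c d = mk4 (- a) (- b) (- c) (- d).
Proof. by apply/rowP; apply: ord4_ind; rewrite mxE !mkE. Qed.

Lemma mk4_eq0 (a b c d : R) : mk4 a b c d = 0 -> [/\ a = 0, b = 0, c = 0 & d = 0].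
Proof.
suff -> : 0 = mk4 0 0 0 0 :> 'rV[R]_4 by exact: mk4_inj.
by apply/rowP; apply: ord4_ind; rewrite mkE mxE.
Qed.

Lemma mk4_line (s t a b c d a' b' c' d' : R) :
  s *: mk4 a b c d + t *: mk4 a' b' c' d' =
  mk4 (s * a + t * a') (s * b + t * b') (s * c + t * c') (s * d + t * d').
Proof.
by apply/rowP; apply: ord4_ind; rewrite !mkE mxE [X in X + _]mxE [X in _ + X]mxE !mkE.
Qed.

(* Each step compares two maps that are nowhere antipodal; the intermediate
   maps are rotations. *)
Lemma homotopic_pinchl : homotopic (sphere R 3) (sphere R 3) pinchl id.
Proof.
pose rho x := mk4 (- x 0 1) (x 0 0) (x 0 2) (x 0 3).
have crho : contin (sphere R 3) rho by contin_arith.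
have Srho x : sphere R 3 x -> sphere R 3 (rho x).
  by rewrite !sphere4E !mkE => <-; ring.
apply: (@homotopic_trans _ _ _ _ _ _ rho); apply: homotopic_sphere => //.
- exact: contin_pinchl.
- by move=> x; exact: sphere_pinchl.
- move=> x /sphere4E x1; rewrite /pinchl pinchE base3E mk4N.
  case: lerP => x0 /mk4_inj[e0 e1 e2 e3]; last by lra.
  have p : 2 * x 0 1 + 1 != 0 by rewrite gt_eqF//; lra.
  have z0 : x 0 0 = 0 by apply: (mulfI p); rewrite mulr0; lra.
  have z2 : x 0 2 = 0 by apply: (mulfI p); rewrite mulr0; lra.
  have z3 : x 0 3 = 0 by apply: (mulfI p); rewrite mulr0; lra.
  by move: x1; rewrite z0 z2 z3; nra.
- exact: contin_id.
- move=> x /sphere4E x1; rewrite [in RHS](mk4_eta x) mk4N => /mk4_inj[e0 e1 e2 e3].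
  have z0 : x 0 0 = 0 by lra.
  have z1 : x 0 1 = 0 by lra.
  have z2 : x 0 2 = 0 by lra.
  have z3 : x 0 3 = 0 by lra.
  by move: x1; rewrite z0 z1 z2 z3; lra.
Qed.

(** Here [rho] is antipodal to the identity on the circle x0 = x1 = 0. Hence the detour through
    [kap], which makes a quarter turn in the plane (x2, x3) where [rho] makes a half turn. *)
Lemma homotopic_pinchr : homotopic (sphere R 3) (sphere R 3) pinchr id.
Proof.
pose rho x := mk4 (x 0 1) (- x 0 0) (- x 0 2) (- x 0 3).
pose kap x := mk4 (x 0 1) (- x 0 0) (x 0 3) (- x 0 2).
have crho : contin (sphere R 3) rho by contin_arith.
have ckap : contin (sphere R 3) kap by contin_arith.
have Srho x : sphere R 3 x -> sphere R 3 (rho x).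
  by rewrite !sphere4E !mkE => <-; ring.
have Skap x : sphere R 3 x -> sphere R 3 (kap x).
  by rewrite !sphere4E !mkE => <-; ring.
apply: (@homotopic_trans _ _ _ _ _ _ rho).
  apply: homotopic_sphere => //.
  - exact: contin_pinchr.
  - by move=> x; exact: sphere_pinchr.
  - move=> x /sphere4E x1; rewrite /pinchr pinchE base3E mk4N.
    case: lerP => x0 /mk4_inj[e0 e1 e2 e3]; first by lra.
    have p : 2 * x 0 1 - 1 != 0 by rewrite lt_eqF//; lra.
    have z0 : x 0 0 = 0 by apply: (mulfI p); rewrite mulr0; lra.
    have z2 : x 0 2 = 0 by apply: (mulfI p); rewrite mulr0; lra.
    have z3 : x 0 3 = 0 by apply: (mulfI p); rewrite mulr0; lra.
    by move: x1; rewrite z0 z2 z3; nra.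
have coord0 x : sphere R 3 x -> x 0 0 = 0 -> x 0 1 = 0 -> x 0 2 = 0 ->
    x 0 3 = 0 -> False.
  by move=> /sphere4E x1 z0 z1 z2 z3; move: x1; rewrite z0 z1 z2 z3; lra.
apply: (@homotopic_trans _ _ _ _ _ _ kap); apply: homotopic_sphere => //.
- by move=> x Sx; rewrite mk4N => /mk4_inj[e0 e1 e2 e3]; apply: (coord0 x) => //; lra.
- exact: contin_id.
- move=> x Sx; rewrite [in RHS](mk4_eta x) mk4N => /mk4_inj[e0 e1 e2 e3].
  by apply: (coord0 x) => //; lra.
Qed.

Lemma reflect3E x : reflect3 x = mk4 (x 0 0) (- x 0 1) (x 0 2) (x 0 3).
Proof. by []. Qed.

(** The two reflections differ by the half turn of the plane (x2, x3); [kap] stops at the quarter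
    turn, so that no two consecutive maps are antipodal anywhere. *)
Lemma homotopic_reflect3 : homotopic (sphere R 3) (sphere R 3) reflect3 qconj.
Proof.
pose kap x := mk4 (x 0 0) (- x 0 1) (- x 0 3) (x 0 2).
have ckap : contin (sphere R 3) kap by contin_arith.
have Skap x : sphere R 3 x -> sphere R 3 (kap x).
  by rewrite !sphere4E !mkE => <-; ring.
have cref : contin (sphere R 3) reflect3.
  have h : contin (sphere R 3)
    (fun x => mk4 (x 0 0) (- x 0 1) (x 0 2) (x 0 3)) by contin_arith.
  by apply: contin_eq h => x _; rewrite reflect3E.
have Sref x : sphere R 3 x -> sphere R 3 (reflect3 x).
  by rewrite reflect3E !sphere4E !mkE => <-; ring.
have coord0 x : sphere R 3 x -> x 0 0 = 0 -> x 0 1 = 0 -> x 0 2 = 0 ->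
    x 0 3 = 0 -> False.
  by move=> /sphere4E x1 z0 z1 z2 z3; move: x1; rewrite z0 z1 z2 z3; lra.
apply: (@homotopic_trans _ _ _ _ _ _ kap); apply: homotopic_sphere => //.
- move=> x Sx; rewrite reflect3E mk4N => /mk4_inj[e0 e1 e2 e3].
  by apply: (coord0 x) => //; lra.
- exact/contin_qconj/contin_id.
- by move=> x; exact: sphere_qconj.
- move=> x Sx; rewrite /qconj mk4N => /mk4_inj[e0 e1 e2 e3].
  by apply: (coord0 x) => //; lra.
Qed.

End Pinch.

Section ClassRepresentative.
Context {R : realType}.
Implicit Types x : 'rV[R]_4.

Lemma pi3_mulz_comp X (h : 'rV[R]_4 -> X) a x :
  pi3_mulz a h x = h (pi3_mulz a id x).
Proof.
have iterE n : iter n (pi3_add h) (pi3_zero (h base3)) =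
    h \o iter n (pi3_add id) (pi3_zero base3).
  elim: n => [//|n ih]; apply/funext => y; rewrite !iterS ih /pi3_add/=.
  by case: ifP.
by case: a => n; rewrite /pi3_mulz /pi3_opp ?iterE /= ?iterE.
Qed.

Lemma iter_pi3_add_base3 n :
  iter n (pi3_add id) (pi3_zero base3) base3 = base3 :> 'rV[R]_4.
Proof.
by elim: n => // n ih; rewrite iterS /pi3_add mkE lexx pinch_equator ?mkE.
Qed.

Lemma pi3_mulz_id_base3 (a : int) : pi3_mulz a id base3 = base3 :> 'rV[R]_4.
Proof.
case: a => n; first exact: iter_pi3_add_base3.
rewrite /pi3_mulz /pi3_opp /comp reflect3E base3E !mkE oppr0 -base3E.
exact: iter_pi3_add_base3.
Qed.

Lemma homotopic_mulz_id (a : int) :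
  homotopic (sphere R 3) (sphere R 3) (pi3_mulz a id) (qpow a).
Proof.
pose m n := iter n (pi3_add id) (pi3_zero base3) : 'rV[R]_4 -> 'rV[R]_4.
(* On either half one factor is the unit, so that concatenation is literally a pointwise product. *)
have mS n : m n.+1 = fun x => qmul (pinchl x) (m n (pinchr x)).
  apply/funext => x; rewrite /m iterS /pi3_add /pinchl /pinchr.
  by case: ifP => _; rewrite ?iter_pi3_add_base3 ?qmul1 ?q1mul.
have hm n : homotopic (sphere R 3) (sphere R 3) (m n) (qexp n).
  elim: n => [|n ih].
    apply: homotopic_refl; first exact: contin_cst.
    by move=> x _; exact: sphere_base3.
  rewrite mS; apply: homotopic_qmul; first exact: homotopic_pinchl.
  exact: (homotopic_comp homotopic_pinchr ih).
case: a => n; first exact: hm.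
exact: (homotopic_comp homotopic_reflect3 (hm n.+1)).
Qed.

(** On one half of S^3 only the S^2 component of the sum moves, on the other half only the S^3
    component. Hence the two components depend on [pinchl x] and [pinchr x] respectively, and both
    can be deformed to x independently. *)
Lemma htpy_classP a b (g : 'rV[R]_4 -> 'rV[R]_3 * 'rV[R]_4) :
  htpy_class R a b g <->
  homotopic (sphere R 3) (S2xS3 R) (fun x => (hopf (qpow a x), qpow b x)) g.
Proof.
rewrite /htpy_class /mkset; set r := pi3_add _ _.
have rE x : r x = (hopf (pi3_mulz a id (pinchl x)), pi3_mulz b id (pinchr x)).
  rewrite /r /pi3_add (pi3_mulz_comp (S1 \o hopf)) (pi3_mulz_comp T1).
  rewrite /pinchl /pinchr.
  by case: ifP => _; rewrite /S1 /T1/= pi3_mulz_id_base3 ?hopf_base3.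
have rh : homotopic (sphere R 3) (S2xS3 R) r
    (fun x => (hopf (qpow a x), qpow b x)).
  rewrite (funext rE); apply: homotopic_pair.
    apply: (homotopic_compl (B := sphere R 3) (g := @hopf R)).
    - exact/contin_hopf/contin_id.
    - by move=> x; exact: sphere_hopf.
    - exact: (homotopic_comp homotopic_pinchl (homotopic_mulz_id a)).
  exact: (homotopic_comp homotopic_pinchr (homotopic_mulz_id b)).
by split; apply: homotopic_trans => //; exact: homotopic_sym.
Qed.

End ClassRepresentative.

(** * The maps (z, w) |-> (z^n, w) *)

Section ComplexPower.
Context {R : realType}.
Implicit Types x : 'rV[R]_4.

(* The point x = (z, w) of C^2 is the quaternion z + w j. *)
Definition zpart x : 'rV[R]_4 := mk4 (x 0 0) (x 0 1) 0 0.

Definition zpow n x : 'rV[R]_4 :=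
  mk4 (qexp n (zpart x) 0 0) (qexp n (zpart x) 0 1) (x 0 2) (x 0 3).

Lemma qexp_zpart n x : [/\ qexp n (zpart x) 0 2 = 0, qexp n (zpart x) 0 3 = 0,
  qexp n.+1 (zpart x) 0 0 =
    qexp n (zpart x) 0 0 * x 0 0 - qexp n (zpart x) 0 1 * x 0 1 &
  qexp n.+1 (zpart x) 0 1 =
    qexp n (zpart x) 0 0 * x 0 1 + qexp n (zpart x) 0 1 * x 0 0].
Proof.
elim: n => [|n [ih2 ih3 _ _]].
  by split; rewrite /qexp/= /qmul ?base3E !mkE; ring.
have z2 : qexp n.+1 (zpart x) 0 2 = 0.
  by rewrite qexpS /qmul !mkE ih2 ih3; ring.
have z3 : qexp n.+1 (zpart x) 0 3 = 0.
  by rewrite qexpS /qmul !mkE ih2 ih3; ring.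
by split=> //; rewrite [qexp n.+2 _]qexpS; move: (qexp n.+1 _) => y;
  rewrite /qmul !mkE; ring.
Qed.

Lemma sqnorm_qexp n x : sqnorm (qexp n x) = sqnorm x ^+ n.
Proof.
elim: n => [|n ih]; first by rewrite sqnorm_base3.
by rewrite qexpS sqnorm_qmul ih exprS.
Qed.

Lemma sqnorm_zpow n x : sqnorm (zpow n x) =
  (x 0 0 ^+ 2 + x 0 1 ^+ 2) ^+ n + (x 0 2 ^+ 2 + x 0 3 ^+ 2).
Proof.
have := sqnorm_qexp n (zpart x); rewrite !sqnorm4.
have [-> -> _ _] := qexp_zpart n x; rewrite !mkE expr0n/= !addr0 => <-.
by rewrite addrA.
Qed.

Lemma zpow_neq0 n x : x != 0 -> zpow n x != 0.
Proof.
rewrite -!sqnorm_gt0 sqnorm_zpow sqnorm4 => x0.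
have [z0|z0] := ltP 0 (x 0 0 ^+ 2 + x 0 1 ^+ 2).
  apply: ltr_wpDr; last exact: exprn_gt0.
  by apply: addr_ge0; exact: sqr_ge0.
apply: ltr_wpDl; last by lra.
by apply: exprn_ge0; apply: addr_ge0; exact: sqr_ge0.
Qed.

Lemma zpow1 x : zpow 1 x = x.
Proof.
rewrite [RHS]mk4_eta /zpow; have [_ _ -> ->] := qexp_zpart 0 x.
by rewrite /qexp/= base3E !mkE; congr mk4; ring.
Qed.

Lemma contin_zpow n (A : set 'rV[R]_4) : contin A (zpow n).
Proof.
have c : contin A (fun x => qexp n (zpart x)).
  by apply: contin_qexp; contin_arith.
by contin_arith.
Qed.

Lemma de_moivre n (a : R) :
  qexp n (mk4 (cos a) (sin a) 0 0) = mk4 (cos (n%:R * a)) (sin (n%:R * a)) 0 0.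
Proof.
elim: n => [|n ih]; first by rewrite mul0r cos0 sin0 -base3E.
rewrite qexpS ih -natr1 mulrDl mul1r cosD sinD /qmul !mkE.
by congr mk4; ring.
Qed.

Lemma qexpZ n a x : qexp n (a *: x) = a ^+ n *: qexp n x.
Proof.
elim: n => [|n ih]; first by rewrite expr0 scale1r.
by rewrite !qexpS ih qmulZl qmulZr scalerA exprS.
Qed.

(* With x = z + w j, the product zpow n x * x is
   z^(n+1) - |w|^2 + (z^n + conj z) w j. On the segment from it to
   z^(n+1) + e w j a zero forces z = r d with r >= 0 and z^(n+1) > 0, where
   d = - conj e; this is excluded by the choice d^(n+1) = -1. *)
Lemma homotopic_zpowS n : homotopic (sphere R 3) (sphere R 3)
  (fun x => nrm (qmul (zpow n.+1 x) x)) (fun x => nrm (zpow n.+2 x)).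
Proof.
pose al : R := pi / n.+2%:R.
pose e := - cos al; pose f := sin al.
have ef : e ^+ 2 + f ^+ 2 = 1 by rewrite sqrrN cos2Dsin2.
have dn : qexp n.+2 (mk4 (- e) f 0 0) = - base3.
  rewrite /e opprK de_moivre /al mulrC divfK ?pnatr_eq0// cospi sinpi base3E.
  by rewrite mk4N !oppr0.
(* Needed for the second leg, where the factor of w moves from e + i f to 1 along a segment that
   must avoid 0. *)
have e1 : e != -1.
  apply/eqP => e1; have f0 : f = 0.
    by apply/eqP; rewrite -sqrf_eq0; move: ef; rewrite e1; lra.
  move: dn; rewrite e1 f0 opprK -base3E qexp1n => /rowP/(_ 0).
  by rewrite base3E !mxE/=; lra.
pose g x := mk4 (zpow n.+2 x 0 0) (zpow n.+2 x 0 1)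
  (e * x 0 2 - f * x 0 3) (e * x 0 3 + f * x 0 2).
have cz : contin (sphere R 3) (@zpow n.+2) by exact: contin_zpow.
have cg : contin (sphere R 3) g.
  have c0 i : contin (sphere R 3) (fun x => zpow n.+2 x 0 i).
    exact: contin_coord.
  by apply: contin_mk4; contin_arith; try exact: c0.
apply: (@homotopic_trans _ _ _ _ _ _ (fun x => nrm (g x))).
  apply: homotopic_line => //.
    by apply: contin_qmul; [exact: contin_zpow|exact: contin_id].
  move=> t x t0 t1 /sphere4E x1; apply/eqP.
  have [_ _ zS0 zS1] := qexp_zpart n.+1 x.
  have gE : g x = mk4 (qexp n.+2 (zpart x) 0 0) (qexp n.+2 (zpart x) 0 1)
    (e * x 0 2 - f * x 0 3) (e * x 0 3 + f * x 0 2) by rewrite /g /zpow !mkE.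
  rewrite gE zS0 zS1 /zpow.
  set a := qexp n.+1 _ 0 0 in zS0 zS1 *; set b := qexp n.+1 _ 0 1 in zS0 zS1 *.
  set z0 := x 0 0 in x1 zS0 zS1 *; set z1 := x 0 1 in x1 zS0 zS1 *.
  set w0 := x 0 2 in x1 *; set w1 := x 0 3 in x1 *.
  have -> : qmul (mk4 a b w0 w1) x = mk4 (a * z0 - b * z1 - w0 * w0 - w1 * w1)
      (a * z1 + b * z0 + w0 * w1 - w1 * w0)
      (a * w0 - b * w1 + w0 * z0 + w1 * z1)
      (a * w1 + b * w0 - w0 * z1 + w1 * z0).
    by rewrite /qmul !mkE.
  rewrite mk4_line => /mk4_eq0[h0 h1 h2 h3].
  pose p := (1 - t) * (a + z0) + t * e; pose q := (1 - t) * (b - z1) + t * f.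
  have E2 : p * w0 - q * w1 = 0 by rewrite /p /q -[RHS]h2; ring.
  have E3 : p * w1 + q * w0 = 0 by rewrite /p /q -[RHS]h3; ring.
  have E0 : a * z0 - b * z1 = (1 - t) * (w0 ^+ 2 + w1 ^+ 2).
    by apply/eqP; rewrite -subr_eq0 -[X in _ == X]h0; apply/eqP; ring.
  have E1 : a * z1 + b * z0 = 0 by rewrite -[RHS]h1; ring.
  (* If w = 0 then |z| = 1, whereas E0 and E1 say that a power of z vanishes. *)
  have [w00|w00] := eqVneq (w0 ^+ 2 + w1 ^+ 2) 0.
    have := sqnorm_qexp n.+2 (zpart x).
    rewrite !sqnorm4 zS0 zS1; have [-> -> _ _] := qexp_zpart n.+2 x.
    rewrite E0 E1 w00 !mkE -/z0 -/z1 (_ : z0 ^+ 2 + z1 ^+ 2 = 1); last by lra.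
    by rewrite !expr0n/= !addr0 expr1n mulr0 expr0n/=; lra.
  have : (p ^+ 2 + q ^+ 2) * (w0 ^+ 2 + w1 ^+ 2) = 0.
    transitivity ((p * w0 - q * w1) ^+ 2 + (p * w1 + q * w0) ^+ 2).
      by ring.
    by rewrite E2 E3; ring.
  move/eqP; rewrite mulf_eq0 (negbTE w00) orbF paddr_eq0 ?sqr_ge0// !sqrf_eq0.
  move=> /andP[/eqP p0 /eqP q0].
  (* Multiplying p + i q = 0 by z turns conj z into |z|^2 and the power of z into the real number
     given by E0 and E1. What remains is t (e + i f) z = - r. *)
  pose r := (1 - t) * ((1 - t) * (w0 ^+ 2 + w1 ^+ 2) + (z0 ^+ 2 + z1 ^+ 2)).
  have F0 : t * (e * z0 - f * z1) = - r.
    transitivity (p * z0 - q * z1 - r + (1 - t) *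
      ((1 - t) * (w0 ^+ 2 + w1 ^+ 2) - (a * z0 - b * z1))).
      by rewrite /p /q /r; ring.
    by rewrite p0 q0 E0; ring.
  have F1 : t * (e * z1 + f * z0) = 0.
    transitivity (p * z1 + q * z0 - (1 - t) * (a * z1 + b * z0)).
      by rewrite /p /q; ring.
    by rewrite p0 q0 E1; ring.
  have wpos : 0 < w0 ^+ 2 + w1 ^+ 2.
    by rewrite lt_neqAle eq_sym w00/= addr_ge0// sqr_ge0.
  have zpos : 0 <= z0 ^+ 2 + z1 ^+ 2 by rewrite addr_ge0// sqr_ge0.
  have t_gt0 : 0 < t.
    rewrite lt_neqAle t0 andbT; apply/eqP => tE; move: F0.
    by rewrite /r -tE; lra.
  have t_lt1 : t < 1.
    rewrite lt_neqAle t1 andbT; apply/eqP => tE.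
    move: p0 q0; rewrite /p /q tE subrr !mul0r !add0r !mul1r => e0 f0.
    by move: ef; rewrite e0 f0; lra.
  have r0 : 0 <= r.
    rewrite /r; apply: mulr_ge0; first by lra.
    by apply: addr_ge0 => //; apply: mulr_ge0; [lra|exact: ltW].
  have zE : zpart x = (r / t) *: mk4 (- e) f 0 0.
    have tn : t != 0 by rewrite gt_eqF.
    have G0 : e * z0 - f * z1 = - (r / t).
      by apply: (mulfI tn); rewrite F0; field.
    have G1 : e * z1 + f * z0 = 0 by apply: (mulfI tn); rewrite F1 mulr0.
    apply/rowP; apply: ord4_ind; rewrite !mxE/= ?mulr0// -/z0 -/z1.
      transitivity ((e ^+ 2 + f ^+ 2) * z0); first by rewrite ef mul1r.
      transitivity (e * (e * z0 - f * z1) + f * (e * z1 + f * z0)); first by ring.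
      by rewrite G0 G1; ring.
    transitivity ((e ^+ 2 + f ^+ 2) * z1); first by rewrite ef mul1r.
    transitivity (- f * (e * z0 - f * z1) + e * (e * z1 + f * z0)); first by ring.
    by rewrite G0 G1; ring.
  have := congr1 (fun y => qexp n.+2 y 0 0) zE.
  rewrite qexpZ dn zS0 E0 base3E !mxE/= => k.
  have : 0 < (1 - t) * (w0 ^+ 2 + w1 ^+ 2) by apply: mulr_gt0 => //; lra.
  rewrite k mulrN1 oppr_gt0 ltNge => /negP; apply.
  by apply: exprn_ge0; apply: divr_ge0 => //; exact: ltW.
apply: homotopic_line => // t x t0 t1 Sx.
apply/eqP; have := zpow_neq0 n.+2 (sphere_neq0 Sx); rewrite -sqnorm_gt0 sqnorm4.
have gE : g x = mk4 (qexp n.+2 (zpart x) 0 0) (qexp n.+2 (zpart x) 0 1)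
  (e * x 0 2 - f * x 0 3) (e * x 0 3 + f * x 0 2) by rewrite /g /zpow !mkE.
rewrite gE /zpow; move: (qexp n.+2 (zpart x)) => y.
set a := y 0 0; set b := y 0 1; set w0 := x 0 2; set w1 := x 0 3.
rewrite !mkE => pos; rewrite mk4_line => /mk4_eq0[h0 h1 h2 h3].
have a0 : a = 0 by rewrite -[RHS]h0; ring.
have b0 : b = 0 by rewrite -[RHS]h1; ring.
pose p := (1 - t) * e + t; pose q := (1 - t) * f.
have E2 : p * w0 - q * w1 = 0 by rewrite /p /q -[RHS]h2; ring.
have E3 : p * w1 + q * w0 = 0 by rewrite /p /q -[RHS]h3; ring.
have : (p ^+ 2 + q ^+ 2) * (w0 ^+ 2 + w1 ^+ 2) = 0.
  transitivity ((p * w0 - q * w1) ^+ 2 + (p * w1 + q * w0) ^+ 2); first by ring.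
  by rewrite E2 E3; ring.
move/eqP; rewrite mulf_eq0 => /orP[|/eqP]; last by move: pos; rewrite a0 b0; lra.
rewrite paddr_eq0 ?sqr_ge0// !sqrf_eq0 => /andP[/eqP p0].
rewrite mulf_eq0 => /orP[/eqP tE|/eqP f0].
  by move: p0; rewrite /p tE; lra.
have : (e - 1) * (e + 1) = 0 by rewrite f0 in ef; nra.
move/eqP; rewrite mulf_eq0 subr_eq0 addr_eq0 (negbTE e1) orbF => /eqP e_eq1.
by move: p0; rewrite /p e_eq1; lra.
Qed.

Lemma homotopic_zpow n : homotopic (sphere R 3) (sphere R 3)
  (fun x => nrm (zpow n.+1 x)) (qexp n.+1).
Proof.
elim: n => [|n ih].
  apply: homotopic_eq.
  - apply: contin_nrm; last exact: contin_zpow.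
    by move=> x Sx; apply: zpow_neq0; exact: sphere_neq0.
  - by move=> x Sx; apply/sphere_nrm/zpow_neq0/sphere_neq0.
  - by move=> x Sx; rewrite zpow1 nrm_sphere// /qexp/= qmul1.
apply: homotopic_trans (homotopic_sym (homotopic_zpowS n)) _.
have hid : homotopic (sphere R 3) (sphere R 3) id id.
  by apply: homotopic_refl => //; exact: contin_id.
have h := homotopic_qmul ih hid.
have E : (fun x => qmul (qexp n.+1 x) (id x)) = qexp n.+2.
  by apply/funext => x; rewrite [RHS]qexpSr.
rewrite -E; apply: homotopic_trans h.
apply: homotopic_eq.
- apply: contin_nrm => [x Sx|].
    rewrite -sqnorm_gt0 sqnorm_qmul ((sphereE x).1 Sx) mulr1 sqnorm_gt0.
    exact/zpow_neq0/sphere_neq0.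
  by apply: contin_qmul; [exact: contin_zpow|exact: contin_id].
- move=> x Sx; apply: sphere_nrm.
  rewrite -sqnorm_gt0 sqnorm_qmul ((sphereE x).1 Sx) mulr1 sqnorm_gt0.
  exact/zpow_neq0/sphere_neq0.
- by move=> x Sx; rewrite /nrm sqnorm_qmul ((sphereE x).1 Sx) mulr1 qmulZl.
Qed.

End ComplexPower.

(** * Smooth maps *)

Section Ck.
Context {R : realType} {V : normedModType R}.
Implicit Types U : set V.

(** Serves to show that differentiability is local: two maps that agree near x differ by such a
    map. *)
Lemma near0_differentiable {W : normedModType R} (f : V -> W) x :
  (\forall y \near x, f y = 0) -> differentiable f x.
Proof.
move=> f0; have fx : f x = 0 by exact: nbhs_singleton f0.
have fE : f \o shift x = cst (f x) + \0 +o_ 0 id.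
  apply/eqaddoE; rewrite fx; apply/eqaddoP => _/posnumP[e].
  have : \forall y \near (0 : V), f (y + x) = 0.
    by move: f0; rewrite (near_shift 0) subr0.
  apply: filterS => y /= fy; rewrite !fctE/= fy addr0 subr0 normr0.
  by rewrite mulr_ge0.
have c0 : continuous (\0 : V -> W) by move=> ?; exact: cst_continuous.
by apply/diff_locallyP; rewrite (diff_unique c0 fE).
Qed.

Lemma eq_differentiable {W : normedModType R} U (f g : V -> W) x :
  open U -> U x -> (forall y, U y -> f y = g y) ->
  differentiable f x -> differentiable g x.
Proof.
move=> oU Ux fg df; have -> : g = f + (g - f) by rewrite addrC subrK.
apply: differentiableD => //; apply: near0_differentiable.
by apply: filterS (open_nbhs_nbhs (conj oU Ux)) => y Uy; rewrite !fctE fg// subrr.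
Qed.

Lemma eq_derive {W : normedModType R} U (f g : V -> W) x v :
  open U -> U x -> (forall y, U y -> f y = g y) -> 'D_v f x = 'D_v g x.
Proof.
move=> oU Ux fg; apply: near_eq_derive.
exact: filterS (open_nbhs_nbhs (conj oU Ux)).
Qed.

(** The rules of differentiation below identify ['D_v] only at points of U, so the induction on k
    must ignore values off U. *)
Lemma eq_Ck {W : normedModType R} k U (f g : V -> W) :
  open U -> (forall y, U y -> f y = g y) -> Ck k U f -> Ck k U g.
Proof.
move=> oU; elim: k f g => [|k ih] f g fg /= => [cf x Ux|[df Df]].
  have cg : g @ x --> f x.
    apply: cvg_trans (cf x Ux); apply: near_eq_cvg.
    exact: filterS (open_nbhs_nbhs (conj oU Ux)).
  by rewrite (fg x Ux) in cg.
split=> [x Ux|v]; first exact: (eq_differentiable oU Ux fg (df x Ux)).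
by apply: ih (Df v) => y Uy; exact: (eq_derive _ oU Uy).
Qed.

Lemma Ck_pred {W : normedModType R} k U (f : V -> W) : Ck k.+1 U f -> Ck k U f.
Proof.
elim: k f => [|k ih] f [df Df]; first by move=> x /df /differentiable_continuous.
by split=> // v; exact: ih.
Qed.

Lemma Ck_cst {W : normedModType R} k U (c : W) : Ck k U (fun=> c).
Proof.
elim: k c => [|k ih] c; first by move=> x _; exact: cst_continuous.
split=> [x _|v]; first exact: differentiable_cst.
by rewrite (_ : 'D_v _ = fun=> 0)//; apply/funext => x; rewrite derive_cst.
Qed.

Lemma Ck_linear {W : normedModType R} k U (f : {linear V -> W}) :
  continuous f -> Ck k U f.
Proof.
move=> cf; case: k => [|k]; first by move=> x _; exact: cf.
split=> [x _|v]; first exact: linear_differentiable.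
rewrite (_ : 'D_v _ = fun=> f v); first exact: Ck_cst.
apply/funext => x; rewrite deriveE; last exact: linear_differentiable.
by rewrite diff_lin.
Qed.

Lemma Ck_add {W : normedModType R} k U (f g : V -> W) : open U ->
  Ck k U f -> Ck k U g -> Ck k U (fun x => f x + g x).
Proof.
move=> oU; elim: k f g => [|k ih] f g.
  by move=> cf cg x Ux; apply: continuousD; [exact: cf|exact: cg].
move=> [df Df] [dg Dg]; split=> [x Ux|v].
  by apply: differentiableD; [exact: df|exact: dg].
apply: eq_Ck (ih _ _ (Df v) (Dg v)) => // x Ux.
by rewrite deriveD//; apply: diff_derivable; [exact: df|exact: dg].
Qed.

Lemma Ck_mul k U (f g : V -> R) : open U ->
  Ck k U f -> Ck k U g -> Ck k U (fun x => f x * g x).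
Proof.
move=> oU; elim: k f g => [|k ih] f g.
  by move=> cf cg x Ux; apply: continuousM; [exact: cf|exact: cg].
move=> /[dup] /Ck_pred Cf [df Df] /[dup] /Ck_pred Cg [dg Dg]; split=> [x Ux|v].
  by apply: differentiableM; [exact: df|exact: dg].
apply: eq_Ck (Ck_add oU (ih _ _ Cf (Dg v)) (ih _ _ Cg (Df v))) => // x Ux.
by rewrite deriveM//; apply: diff_derivable; [exact: df|exact: dg].
Qed.

(** The derivative - f^-2 Df involves f^-1 only to order k, which the induction hypothesis covers;
    [Ck_sqrt] follows the same scheme. *)
Lemma Ck_inv k U (f : V -> R) : open U -> (forall x, U x -> f x != 0) ->
  Ck k U f -> Ck k U (fun x => (f x)^-1).
Proof.
move=> oU f0; elim: k => [|k ih].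
  by move=> cf x Ux; apply: continuousV; [exact: f0|exact: cf].
move=> /[dup] /Ck_pred Cf [df Df]; split=> [x Ux|v].
  by apply: differentiableV; [exact: df|exact: f0].
have C2 := Ck_mul oU (ih Cf) (ih Cf).
have := Ck_mul oU (Ck_cst k U (-1 : R)) (Ck_mul oU C2 (Df v)).
apply: eq_Ck => // x Ux.
rewrite deriveV ?f0//; last by apply: diff_derivable; exact: df.
by rewrite mulN1r -exprVn expr2 scaleNr.
Qed.

Lemma Ck_sqrt k U (f : V -> R) : open U -> (forall x, U x -> 0 < f x) ->
  Ck k U f -> Ck k U (fun x => Num.sqrt (f x)).
Proof.
move=> oU f0; have ds x : U x -> differentiable (Num.sqrt : R -> R) (f x).
  move=> Ux; apply/derivable1_diffP.
  by have [] := is_derive1_sqrt (f0 x Ux).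
elim: k => [|k ih].
  move=> cf x Ux; apply: continuous_comp; first exact: cf.
  exact: sqrt_continuous.
move=> /[dup] /Ck_pred Cf [df Df]; split=> [x Ux|v].
  by apply: differentiable_comp; [exact: df|exact: ds].
have n0 x : U x -> 2 * Num.sqrt (f x) != 0.
  by move=> Ux; rewrite mulf_neq0// gt_eqF// sqrtr_gt0 f0.
have C2 := Ck_inv oU n0 (Ck_mul oU (Ck_cst k U (2 : R)) (ih Cf)).
apply: eq_Ck (Ck_mul oU C2 (Df v)) => // x Ux.
rewrite [RHS]deriveE; last by apply: differentiable_comp; [exact: df|exact: ds].
rewrite diff_comp; [|exact: df|exact: ds] => /=.
rewrite -[X in 'd _ _ X]deriveE; last exact: df.
rewrite deriv1E; last by have [] := is_derive1_sqrt (f0 x Ux).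
by rewrite derive1E derive_sqrt ?f0// mulrC.
Qed.

Lemma Ck_row k U n (f : V -> 'rV[R]_n) : open U ->
  (forall i, Ck k U (fun x => f x 0 i)) -> Ck k U f.
Proof.
move=> oU; elim: k f => [|k ih] f cf.
  by move=> x Ux; apply: cvg_row => i; exact: cf.
have df x : U x -> differentiable f x.
  move=> Ux; have -> : f = \sum_i (fun y => f y 0 i *: delta_mx 0 i).
    by apply/funext => y; rewrite fct_sumE [LHS]row_sum_delta.
  apply: differentiable_sum => i; apply: differentiableZl.
  by have [dfi _] := cf i; exact: dfi.
split=> // v; apply: ih => i; have [_ Df] := cf i.
apply: eq_Ck (Df v) => // x Ux.
by rewrite derive_mx ?mxE//; apply: diff_derivable; exact: df.
Qed.

Lemma Ck_pair {W W' : normedModType R} k U (f : V -> W) (g : V -> W') : open U ->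
  Ck k U f -> Ck k U g -> Ck k U (fun x => (f x, g x)).
Proof.
move=> oU; elim: k f g => [|k ih] f g.
  by move=> cf cg x Ux; apply: cvg_pair; [exact: cf|exact: cg].
move=> [df Df] [dg Dg].
have dfg x : U x -> differentiable (fun x => (f x, g x)) x.
  by move=> Ux; apply: differentiable_pair; [exact: df|exact: dg].
split=> // v; apply: eq_Ck (ih _ _ (Df v) (Dg v)) => // x Ux.
rewrite (deriveE v (dfg x Ux)).
rewrite (diff_pair (df x Ux) (dg x Ux)) /=.
by rewrite (deriveE v (df x Ux)) (deriveE v (dg x Ux)).
Qed.

End Ck.

Lemma Ck_linear_comp {R : realType} {V W W' : normedModType R} k (U : set V)
    (L : {linear W -> W'}) (f : V -> W) :
  open U -> continuous L -> Ck k U f -> Ck k U (fun x => L (f x)).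
Proof.
move=> oU cL; elim: k f => [|k ih] f.
  by move=> cf x Ux; apply: continuous_comp; [exact: cf|exact: cL].
have dL y : differentiable L y by exact: linear_differentiable.
move=> [df Df]; split=> [x Ux|v].
  by apply: differentiable_comp; [exact: df|exact: dL].
apply: eq_Ck (ih _ (Df v)) => // x Ux.
rewrite (deriveE v (differentiable_comp (df x Ux) (dL (f x)))).
by rewrite (diff_comp (df x Ux) (dL (f x))) /= diff_lin// (deriveE v (df x Ux)).
Qed.

Record Cinf {R : realType} {V W : normedModType R} (U : set V) (f : V -> W) :
  Prop := MkCinf { Cinf_open : open U; Cinf_Ck : forall k, Ck k U f }.

Section Cinf.
Context {R : realType} {V : normedModType R} (U : set V).

Lemma Cinf_coord n (f : V -> 'rV[R]_n) i :
  Cinf U f -> Cinf U (fun x => f x 0 i).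
Proof.
move=> [oU Cf]; split=> // k.
have lin : linear (fun M : 'rV[R]_n => M 0 i : R).
  by move=> a M N; rewrite !mxE.
pose L : {linear 'rV[R]_n -> R} :=
  HB.pack (fun M : 'rV[R]_n => M 0 i : R) (GRing.isLinear.Build _ _ _ _ _ lin).
by apply: (@Ck_linear_comp _ _ _ _ _ _ L) (Cf k) => //; exact: coord_continuous.
Qed.

Lemma Cinf_fst {W W' : normedModType R} (f : V -> W * W') :
  Cinf U f -> Cinf U (fun x => (f x).1).
Proof.
move=> [oU Cf]; split=> // k.
by apply: (@Ck_linear_comp _ _ _ _ _ _ fst) (Cf k) => // x; exact: cvg_fst.
Qed.

Lemma Cinf_snd {W W' : normedModType R} (f : V -> W * W') :
  Cinf U f -> Cinf U (fun x => (f x).2).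
Proof.
move=> [oU Cf]; split=> // k.
by apply: (@Ck_linear_comp _ _ _ _ _ _ snd) (Cf k) => // x; exact: cvg_snd.
Qed.

Lemma Cinf_id : open U -> Cinf U (fun x : V => x).
Proof.
by split=> // k; apply: (@Ck_linear _ _ _ _ _ idfun) => x; exact: cvg_id.
Qed.

Lemma Cinf_cst {W : normedModType R} (c : W) : open U -> Cinf U (fun=> c).
Proof. by split=> // k; exact: Ck_cst. Qed.

Lemma Cinf_add (f g : V -> R) :
  Cinf U f -> Cinf U g -> Cinf U (fun x => f x + g x).
Proof. by move=> [oU Cf] [_ Cg]; split=> // k; exact: Ck_add. Qed.

Lemma Cinf_mul (f g : V -> R) :
  Cinf U f -> Cinf U g -> Cinf U (fun x => f x * g x).
Proof. by move=> [oU Cf] [_ Cg]; split=> // k; exact: Ck_mul. Qed.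

Lemma eq_Cinf {W : normedModType R} (f g : V -> W) :
  (forall y, U y -> f y = g y) -> Cinf U f -> Cinf U g.
Proof. by move=> fg [oU Cf]; split=> // k; exact: eq_Ck (Cf k). Qed.

Lemma Cinf_opp (f : V -> R) : Cinf U f -> Cinf U (fun x => - f x).
Proof.
move=> Cf; have C1 := Cinf_cst (-1 : R) (Cinf_open Cf).
by apply: eq_Cinf (Cinf_mul C1 Cf) => x _; rewrite mulN1r.
Qed.

Lemma Cinf_exp (f : V -> R) n : Cinf U f -> Cinf U (fun x => f x ^+ n).
Proof.
move=> Cf; elim: n => [|n ih].
  by apply: Cinf_cst (1 : R) (Cinf_open Cf).
by apply: eq_Cinf (Cinf_mul Cf ih) => x _; rewrite exprS.
Qed.

Lemma Cinf_inv (f : V -> R) : (forall x, U x -> f x != 0) ->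
  Cinf U f -> Cinf U (fun x => (f x)^-1).
Proof. by move=> f0 [oU Cf]; split=> // k; exact: Ck_inv. Qed.

Lemma Cinf_sqrt (f : V -> R) : (forall x, U x -> 0 < f x) ->
  Cinf U f -> Cinf U (fun x => Num.sqrt (f x)).
Proof. by move=> f0 [oU Cf]; split=> // k; exact: Ck_sqrt. Qed.

Lemma Cinf_row n (f : V -> 'rV[R]_n.+1) :
  (forall i, Cinf U (fun x => f x 0 i)) -> Cinf U f.
Proof.
move=> Cf; have [oU _] := Cf ord0; split=> // k.
by apply: Ck_row => // i; have [_] := Cf i; exact.
Qed.

Lemma Cinf_pair {W W' : normedModType R} (f : V -> W) (g : V -> W') :
  Cinf U f -> Cinf U g -> Cinf U (fun x => (f x, g x)).
Proof. by move=> [oU Cf] [_ Cg]; split=> // k; exact: Ck_pair. Qed.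

Lemma Cinf_contin {W : normedModType R} (A : set V) (f : V -> W) :
  A `<=` U -> Cinf U f -> contin A f.
Proof.
move=> AU [oU Cf]; split=> x Ax; apply: cvg_within_filter.
exact: (Cf 0%N x (AU x Ax)).
Qed.

Lemma Cinf_smooth {W : normedModType R} (A : set V) (f : V -> W) :
  A `<=` U -> Cinf U f -> smooth A f.
Proof.
by move=> AU [oU Cf] x Ax; exists f, U; split=> //; exact: AU.
Qed.

End Cinf.

(* The left inverse makes the differential injective, and the inverse of the
   restriction of [F] continuous. *)
Lemma embedding_left_inverse {R : realType} n {W : normedModType R} (M : set W)
    (U : set 'rV[R]_n.+1) (O : set W) (F : 'rV[R]_n.+1 -> W)
    (G : W -> 'rV[R]_n.+1) :
  sphere R n `<=` U -> Cinf U F -> Cinf O G -> set_fun U O F ->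
  (forall x, U x -> G (F x) = x) -> set_fun (sphere R n) M F -> embedding M F.
Proof.
move=> SU CF CG FO GF FM; split=> //.
- exact: Cinf_smooth CF.
- move=> x Sx; have Ux := SU x Sx; exists F; split.
    by exists U; case: CF.
  move=> v _ dF0; have [oU /(_ 1%N)[dF _]] := CF; have [_ /(_ 1%N)[dG _]] := CG.
  have dFx := dF x Ux; have dGx := dG _ (FO x Ux).
  have <- : 'D_v (G \o F) x = v.
    by rewrite (eq_derive (g := id) v oU Ux GF) derive_id.
  rewrite (deriveE v (differentiable_comp dFx dGx)) (diff_comp dFx dGx) /=.
  by rewrite dF0 linear0.
- split; first by apply/continP; exact: Cinf_contin CF.
  exists G; split; last by move=> x Sx; apply: GF; exact: SU.
  apply/continP; apply: Cinf_contin CG => _ [x Sx <-]; apply: FO; exact: SU.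
Qed.

Section SmoothQuaternions.
Context {R : realType} {V : normedModType R} (U : set V).

Lemma Cinf_mk4 (a b c d : V -> R) : Cinf U a -> Cinf U b -> Cinf U c ->
  Cinf U d -> Cinf U (fun v => mk4 (a v) (b v) (c v) (d v)).
Proof.
move=> Ca Cb Cc Cd; apply: Cinf_row; apply: ord4_ind.
- by apply: eq_Cinf Ca => v _; rewrite mkE.
- by apply: eq_Cinf Cb => v _; rewrite mkE.
- by apply: eq_Cinf Cc => v _; rewrite mkE.
- by apply: eq_Cinf Cd => v _; rewrite mkE.
Qed.

Lemma Cinf_mk3 (a b c : V -> R) : Cinf U a -> Cinf U b -> Cinf U c ->
  Cinf U (fun v => mk3 (a v) (b v) (c v)).
Proof.
move=> Ca Cb Cc; apply: Cinf_row; apply: ord3_ind.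
- by apply: eq_Cinf Ca => v _; rewrite mkE.
- by apply: eq_Cinf Cb => v _; rewrite mkE.
- by apply: eq_Cinf Cc => v _; rewrite mkE.
Qed.

Ltac smooth_arith := repeat first
  [ assumption | apply: Cinf_coord | apply: Cinf_mk4 | apply: Cinf_mk3
  | apply: Cinf_add | apply: Cinf_opp | apply: Cinf_mul | apply: Cinf_exp ].

Lemma Cinf_qmul (f g : V -> 'rV[R]_4) :
  Cinf U f -> Cinf U g -> Cinf U (fun v => qmul (f v) (g v)).
Proof. by move=> Cf Cg; smooth_arith. Qed.

Lemma Cinf_qconj (f : V -> 'rV[R]_4) :
  Cinf U f -> Cinf U (fun v => qconj (f v)).
Proof. by move=> Cf; smooth_arith. Qed.

Lemma Cinf_qexp n (f : V -> 'rV[R]_4) :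
  Cinf U f -> Cinf U (fun v => qexp n (f v)).
Proof.
move=> Cf; elim: n => [|n ih]; last exact: Cinf_qmul.
by apply: Cinf_cst; case: Cf.
Qed.

Lemma Cinf_qpow a (f : V -> 'rV[R]_4) :
  Cinf U f -> Cinf U (fun v => qpow a (f v)).
Proof.
case: a => n Cf; first exact: Cinf_qexp.
by apply: Cinf_qexp; exact: Cinf_qconj.
Qed.

Lemma Cinf_rot (f : V -> 'rV[R]_4) (g : V -> 'rV[R]_3) :
  Cinf U f -> Cinf U g -> Cinf U (fun v => rot (f v) (g v)).
Proof.
move=> Cf Cg; have oU := Cinf_open Cf.
have C0 := Cinf_cst (0 : R) oU.
have Ci : Cinf U (fun v => imq (g v)) by smooth_arith.
have h := Cinf_qmul (Cinf_qmul (Cinf_qconj Cf) Ci) Cf.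
by apply: Cinf_mk3; exact: Cinf_coord.
Qed.

Lemma Cinf_sqnorm4 (f : V -> 'rV[R]_4) : Cinf U f ->
  Cinf U (fun v => sqnorm (f v)).
Proof.
move=> Cf; apply: (@eq_Cinf _ _ _ _ (fun v => f v 0 0 ^+ 2 + f v 0 1 ^+ 2 +
  f v 0 2 ^+ 2 + f v 0 3 ^+ 2)); first by move=> v _; rewrite sqnorm4.
by smooth_arith.
Qed.

Lemma Cinf_zpow n (f : V -> 'rV[R]_4) : Cinf U f ->
  Cinf U (fun v => zpow n (f v)).
Proof.
move=> Cf; have C0 := Cinf_cst (0 : R) (Cinf_open Cf).
have Cz : Cinf U (fun v => qexp n (zpart (f v))).
  by apply: Cinf_qexp; smooth_arith.
by apply: Cinf_mk4; smooth_arith.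
Qed.

End SmoothQuaternions.

(** * Embeddings and diffeomorphisms *)

Section Embeddings.
Context {R : realType}.
Implicit Types (x q : 'rV[R]_4) (y : 'rV[R]_3).

Lemma qpow1 x : qpow 1 x = x.
Proof. exact: qmul1. Qed.

Lemma qpow_neq0 (a : int) x : x != 0 -> qpow a x != 0.
Proof.
have h n (z : 'rV[R]_4) : z != 0 -> qexp n z != 0.
  by rewrite -!sqnorm_gt0 sqnorm_qexp; exact: exprn_gt0.
case: a => n x0; apply: h => //.
by rewrite -sqnorm_gt0 sqnorm_qconj sqnorm_gt0.
Qed.

(** Inverse stereographic projection of z = x0 + i x1 from (0, 0, -1). It embeds the plane of z in
    S^2 and omits - [base2], which makes it null-homotopic. *)
Definition stereo x : 'rV[R]_3 :=
  let c := x 0 0 ^+ 2 + x 0 1 ^+ 2 in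
  mk3 (2 * x 0 0 / (1 + c)) (2 * x 0 1 / (1 + c)) ((1 - c) / (1 + c)).

Lemma addr1_sqr_gt0 (a b : R) : 0 < 1 + (a ^+ 2 + b ^+ 2).
Proof. by apply: ltr_pwDl => //; apply: addr_ge0; exact: sqr_ge0. Qed.

Lemma sphere_stereo x : sphere R 2 (stereo x).
Proof.
rewrite sphereE sqnorm3 /stereo !mkE.
have := addr1_sqr_gt0 (x 0 0) (x 0 1); set c := _ + _ ^+ 2 => c0.
rewrite !exprMn exprVn.
transitivity (((1 + c) ^+ 2) / ((1 + c) ^+ 2)).
  rewrite -!mulrDl; congr (_ / _); rewrite /c; ring.
by rewrite divff// expf_neq0// gt_eqF.
Qed.

Lemma Cinf_stereo : Cinf setT stereo.
Proof.
have oT : open (setT : set 'rV[R]_4) by exact: openT.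
have Cx := Cinf_id oT; have C1 := Cinf_cst (1 : R) oT.
have C2 := Cinf_cst (2 : R) oT.
have Cc : Cinf setT (fun x => x 0 0 ^+ 2 + x 0 1 ^+ 2).
  by apply: Cinf_add; apply: Cinf_exp; exact: Cinf_coord.
have Ci : Cinf setT (fun x => (1 + (x 0 0 ^+ 2 + x 0 1 ^+ 2))^-1).
  apply: Cinf_inv; last exact: Cinf_add.
  by move=> x _; rewrite gt_eqF// addr1_sqr_gt0.
apply: Cinf_mk3; apply: Cinf_mul => //.
- by apply: Cinf_mul => //; exact: Cinf_coord.
- by apply: Cinf_mul => //; exact: Cinf_coord.
- by apply: Cinf_add => //; exact: Cinf_opp.
Qed.

(* On the sphere [radial n] is the squared norm of [zpow n x], written as a
   function of z alone. *)
Definition radial n (a b : R) : R :=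
  (a ^+ 2 + b ^+ 2) ^+ n + (1 - (a ^+ 2 + b ^+ 2)).

(** For c = a^2 + b^2 at least 1 the positive exponent gives c <= c^(n+1); with exponent 0 the value
    would be negative for c > 2. *)
Lemma radial_gt0 n a b : 0 < radial n.+1 a b.
Proof.
rewrite /radial; have c0 : 0 <= a ^+ 2 + b ^+ 2 by rewrite addr_ge0// sqr_ge0.
set c := a ^+ 2 + b ^+ 2 in c0 *; have [c1|c1] := ltP c 1.
  by apply: ltr_wpDl; [exact: exprn_ge0|lra].
have : c ^+ 1 <= c ^+ n.+1 by exact: ler_weXn2l.
by rewrite expr1; lra.
Qed.

(** The normalization of [zpow n x], with the norm replaced by a function of z alone. For n > 0 the
    formula is smooth on all of R^4, and once z is known the scale factor can be undone to recover
    w. *)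
Definition degree_map (s : int) n x : 'rV[R]_4 :=
  qpow s ((Num.sqrt (radial n (x 0 0) (x 0 1)))^-1 *: zpow n x).

Lemma degree_mapE s n x : sphere R 3 x ->
  degree_map s n x = qpow s (nrm (zpow n x)).
Proof.
move=> /sphere4E x1; rewrite /degree_map /nrm sqnorm_zpow /radial.
have -> // : 1 - (x 0 0 ^+ 2 + x 0 1 ^+ 2) = x 0 2 ^+ 2 + x 0 3 ^+ 2 by lra.
Qed.

Lemma Cinf_radial {V : normedModType R} (U : set V) n (f g : V -> R) :
  Cinf U f -> Cinf U g -> Cinf U (fun v => Num.sqrt (radial n.+1 (f v) (g v))).
Proof.
move=> Cf Cg; apply: Cinf_sqrt; first by move=> v _; exact: radial_gt0.
have Cc : Cinf U (fun v => f v ^+ 2 + g v ^+ 2).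
  by apply: Cinf_add; exact: Cinf_exp.
apply: Cinf_add; first exact: Cinf_exp.
by apply: Cinf_add; [apply: Cinf_cst; case: Cf|exact: Cinf_opp].
Qed.

Lemma Cinf_scale {V : normedModType R} (U : set V) n (a : V -> R)
    (f : V -> 'rV[R]_n.+1) :
  Cinf U a -> Cinf U f -> Cinf U (fun v => a v *: f v).
Proof.
move=> Ca Cf; apply: Cinf_row => i.
by apply: eq_Cinf (Cinf_mul Ca (Cinf_coord i Cf)) => v _; rewrite mxE.
Qed.

Lemma Cinf_sub {V W : normedModType R} (U U' : set V) (f : V -> W) :
  open U' -> U' `<=` U -> Cinf U f -> Cinf U' f.
Proof.
move=> oU' UU' [oU Cf]; split=> // k; move: (Cf k); elim: k f {Cf} => [|k ih] f.
  by move=> cf x Ux; apply: cf; exact: UU'.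
move=> [df Df]; split=> [x Ux|v]; first by apply: df; exact: UU'.
exact/ih/Df.
Qed.

Lemma Cinf_degree_map s n : Cinf setT (degree_map s n.+1).
Proof.
have oT : open (setT : set 'rV[R]_4) by exact: openT.
have Cx := Cinf_id oT; apply: Cinf_qpow.
apply: Cinf_scale; last exact: Cinf_zpow.
apply: Cinf_inv; last by apply: Cinf_radial; exact: Cinf_coord.
by move=> x _; rewrite gt_eqF// sqrtr_gt0 radial_gt0.
Qed.

(** The embedding x |-> ([stereo x], [degree_map s n x]) followed by the twist of the S^2 factor by
    the j-th power of the S^3 component. *)
Definition emb_map (j s : int) n x : 'rV[R]_3 * 'rV[R]_4 :=
  (rot (qpow j (degree_map s n x)) (stereo x), degree_map s n x).

(** The denominator 1 + y_2 of stereographic projection at the untwisted point y, multiplied by the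
    scale factor of [rot_conjK]. The set where it is positive is the domain of the left inverse. *)
Definition emb_den (j : int) (p : 'rV[R]_3 * 'rV[R]_4) : R :=
  sqnorm (qpow j p.2) ^+ 2 + rot (qconj (qpow j p.2)) p.1 0 2.

(** Untwist the S^2 component, read off z = a + i b by stereographic projection, then rescale the
    last two coordinates of the S^3 component to find w. *)
Definition emb_inv (j s : int) n (p : 'rV[R]_3 * 'rV[R]_4) : 'rV[R]_4 :=
  let y := rot (qconj (qpow j p.2)) p.1 in
  let a := y 0 0 / emb_den j p in let b := y 0 1 / emb_den j p in
  let r := Num.sqrt (radial n a b) in let q := qpow s p.2 in
  mk4 a b (q 0 2 * r) (q 0 3 * r).

Lemma Cinf_emb_map j s n : Cinf setT (emb_map j s n.+1).
Proof.
apply: Cinf_pair; last exact: Cinf_degree_map.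
apply: Cinf_rot; last exact: Cinf_stereo.
by apply: Cinf_qpow; exact: Cinf_degree_map.
Qed.

Lemma Cinf_emb_den j : Cinf setT (emb_den j).
Proof.
have Cp := Cinf_id (openT : open [set: 'rV[R]_3 * 'rV[R]_4]).
have Cj := Cinf_qpow j (Cinf_snd Cp).
apply: Cinf_add; first by apply: Cinf_exp; exact: Cinf_sqnorm4.
by apply: Cinf_coord; apply: Cinf_rot; [exact: Cinf_qconj|exact: Cinf_fst].
Qed.

Lemma open_gt0 {V : normedModType R} (f : V -> R) :
  Cinf setT f -> open [set v | 0 < f v].
Proof.
move=> [_ /(_ 0%N) cf]; apply: (@open_comp _ _ f [set r | 0 < r]).
  by move=> v _; exact: cf.
exact: open_gt.
Qed.

Lemma Cinf_emb_inv j s n : Cinf [set p | 0 < emb_den j p] (emb_inv j s n.+1).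
Proof.
set O := [set p | _]; have oO : open O by apply: open_gt0; exact: Cinf_emb_den.
have Cp := Cinf_id oO.
have Cq := Cinf_qpow s (Cinf_snd Cp); have Cj := Cinf_qpow j (Cinf_snd Cp).
have Cy := Cinf_rot (Cinf_qconj Cj) (Cinf_fst Cp).
have Cd : Cinf O (fun p => (emb_den j p)^-1).
  apply: Cinf_inv; first by move=> p; rewrite /O/= => /lt0r_neq0.
  by apply: Cinf_sub (Cinf_emb_den j) => //.
have Ca i : Cinf O (fun p => rot (qconj (qpow j p.2)) p.1 0 i / emb_den j p).
  by apply: Cinf_mul => //; exact: Cinf_coord.
have Cr := Cinf_radial n (Ca 0) (Ca 1).
apply: Cinf_mk4; [exact: Ca|exact: Ca| |];
  by apply: Cinf_mul => //; exact: Cinf_coord.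
Qed.

Lemma degree_map_neq0 s n x : x != 0 -> degree_map s n.+1 x != 0.
Proof.
move=> x0; apply: qpow_neq0; rewrite scaler_eq0 negb_or zpow_neq0// andbT.
by rewrite invr_eq0 gt_eqF// sqrtr_gt0 radial_gt0.
Qed.

Lemma emb_denE j s n x : x != 0 -> emb_den j (emb_map j s n.+1 x) =
  sqnorm (qpow j (degree_map s n.+1 x)) ^+ 2 *
  (2 / (1 + (x 0 0 ^+ 2 + x 0 1 ^+ 2))).
Proof.
move=> x0; rewrite /emb_den /emb_map rot_conjK mxE /stereo mkE.
rewrite -{1}[_ ^+ 2]mulr1 -mulrDr; congr (_ * _).
by field; rewrite gt_eqF// addr1_sqr_gt0.
Qed.

Lemma emb_den_gt0 j s n x : x != 0 -> 0 < emb_den j (emb_map j s n.+1 x).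
Proof.
move=> x0; rewrite emb_denE// mulr_gt0//.
  by rewrite exprn_gt0// sqnorm_gt0 qpow_neq0// degree_map_neq0.
by rewrite divr_gt0// addr1_sqr_gt0.
Qed.

Lemma emb_mapK j s n x : s = 1 \/ s = -1 -> x != 0 ->
  emb_inv j s n.+1 (emb_map j s n.+1 x) = x.
Proof.
move=> s1 x0; rewrite /emb_inv emb_denE// /emb_map rot_conjK.
set p := sqnorm _ ^+ 2.
have p0 : p != 0.
  by rewrite expf_neq0// sqnorm_eq0 qpow_neq0// degree_map_neq0.
have := addr1_sqr_gt0 (x 0 0) (x 0 1).
have E a : p * (2 * a / (1 + (x 0 0 ^+ 2 + x 0 1 ^+ 2))) /
    (p * (2 / (1 + (x 0 0 ^+ 2 + x 0 1 ^+ 2)))) = a.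
  by field; rewrite p0 /= gt_eqF// addr1_sqr_gt0.
rewrite !mxE /= !E.
have -> : qpow s (degree_map s n.+1 x) =
    (Num.sqrt (radial n.+1 (x 0 0) (x 0 1)))^-1 *: zpow n.+1 x.
  by rewrite -qpowM; case: s1 => ->; rewrite ?mulrNN mulr1 qpow1.
rewrite !mxE /= [RHS]mk4_eta => _.
have r0 : Num.sqrt (radial n.+1 (x 0 0) (x 0 1)) != 0.
  by rewrite gt_eqF// sqrtr_gt0 radial_gt0.
by congr mk4; field.
Qed.

Lemma embedding_emb_map j s n : s = 1 \/ s = -1 ->
  embedding (S2xS3 R) (emb_map j s n.+1).
Proof.
move=> s1.
have oU : open [set x : 'rV[R]_4 | 0 < sqnorm x].
  by apply: open_gt0; apply/Cinf_sqnorm4/Cinf_id/openT.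
apply: (@embedding_left_inverse _ _ _ _ [set x | 0 < sqnorm x]
  [set p | 0 < emb_den j p] _ (emb_inv j s n.+1)).
- by move=> x Sx /=; rewrite sqnorm_gt0 sphere_neq0.
- by apply: Cinf_sub (Cinf_emb_map j s n).
- exact: Cinf_emb_inv.
- by move=> x /=; rewrite sqnorm_gt0; exact: emb_den_gt0.
- by move=> x /=; rewrite sqnorm_gt0; exact: emb_mapK.
- move=> x Sx; have Sd : sphere R 3 (degree_map s n.+1 x).
    by rewrite degree_mapE//; apply/sphere_qpow/sphere_nrm/zpow_neq0/sphere_neq0.
  split=> //=; apply: sphere_rot; last exact: sphere_stereo.
  exact: sphere_qpow.
Qed.

Lemma homotopic_degree_map s n :
  homotopic (sphere R 3) (sphere R 3) (degree_map s n.+1) (qpow (s * n.+1%:Z)).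
Proof.
apply: (@homotopic_trans _ _ _ _ _ _ (fun x => qpow s (nrm (zpow n.+1 x)))).
  apply: homotopic_eq.
  - by apply: Cinf_contin (Cinf_degree_map s n).
  - move=> x Sx; rewrite degree_mapE//.
    exact/sphere_qpow/sphere_nrm/zpow_neq0/sphere_neq0.
  - by move=> x Sx; rewrite degree_mapE.
rewrite (_ : qpow (s * n.+1%:Z) = fun x => qpow s (qexp n.+1 x)); last first.
  by apply/funext => x; rewrite qpowM.
apply: (homotopic_compl (B := sphere R 3) (g := qpow s)).
- exact/contin_qpow/contin_id.
- by move=> x; exact: sphere_qpow.
- exact: homotopic_zpow.
Qed.

Lemma homotopic_rot {V : normedModType R} (A : set V) (f f' : V -> 'rV[R]_4)
    (g g' : V -> 'rV[R]_3) :
  homotopic A (sphere R 3) f f' -> homotopic A (sphere R 2) g g' ->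
  homotopic A (sphere R 2) (fun v => rot (f v) (g v)) (fun v => rot (f' v) (g' v)).
Proof.
move=> ff gg; apply: (homotopic_compl (B := sphere R 3 `*` sphere R 2)
  (g := fun p => rot p.1 p.2)) (homotopic_pair ff gg).
- by apply: contin_rot; [exact/contin_fst/contin_id|exact/contin_snd/contin_id].
- by move=> [p q] []; exact: sphere_rot.
Qed.

Lemma represented_by_emb_map (k s : int) n : s = 1 \/ s = -1 ->
  represented_by_embedding R (k * n.+1%:Z) (s * n.+1%:Z).
Proof.
(* The twist acts through a map homotopic to the power s (n + 1); since s^2 = 1, the exponent k s
   produces k (n + 1) in the S^2 component. *)
move=> s1; exists (emb_map (k * s) s n.+1); first exact: embedding_emb_map.
apply/htpy_classP; apply: homotopic_sym; apply: homotopic_pair; last first.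
  exact: homotopic_degree_map.
rewrite (_ : (fun x => hopf _) = fun x => rot (qpow (k * s)
    (qpow (s * n.+1%:Z) x)) base2); last first.
  apply/funext => x; rewrite rot_base2 -qpowM; congr (hopf (qpow _ x)).
  by case: s1 => ->; ring.
apply: homotopic_rot.
  apply: (homotopic_compl (B := sphere R 3) (g := qpow (k * s))).
  - exact/contin_qpow/contin_id.
  - by move=> x; exact: sphere_qpow.
  - exact: homotopic_degree_map.
(* [stereo] omits - [base2], so it contracts to the constant [base2]. *)
apply: homotopic_sphere.
- by apply: Cinf_contin Cinf_stereo.
- exact: contin_cst.
- by move=> x _; exact: sphere_stereo.
- by move=> x _; exact: sphere_base2.
- move=> x _ /rowP/(_ 2); rewrite /stereo base2E !mxE/=.
  have := addr1_sqr_gt0 (x 0 0) (x 0 1); set c := _ + _ ^+ 2 => c0 /eqP.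
  by rewrite -subr_eq0 opprK -[1 in X in _ + X](divff (lt0r_neq0 c0)) -mulrDl
    mulf_eq0 invr_eq0 (gt_eqF c0) orbF => /eqP; lra.
Qed.

Definition twist (a s : int) (p : 'rV[R]_3 * 'rV[R]_4) : 'rV[R]_3 * 'rV[R]_4 :=
  (rot (qpow a p.2) p.1, qpow s p.2).

Lemma diffeomorphism_twist a s : s = 1 \/ s = -1 ->
  diffeomorphism (S2xS3 R) (twist a s).
Proof.
move=> s1; have Cp := Cinf_id (openT : open [set: 'rV[R]_3 * 'rV[R]_4]).
have Cs := Cinf_qpow s (Cinf_snd Cp).
have ss x : qpow s (qpow s x) = x.
  by rewrite -qpowM; case: s1 => ->; rewrite ?mulrNN mulr1 qpow1.
split.
- by move=> [y x] [/= Sy Sx]; split; [apply: sphere_rot => //|]; exact: sphere_qpow.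
- apply: (@Cinf_smooth _ _ setT) => //; apply: Cinf_pair => //.
  by apply: Cinf_rot; [exact/Cinf_qpow/Cinf_snd|exact: Cinf_fst].
exists (fun p => (rot (qconj (qpow a (qpow s p.2))) p.1, qpow s p.2)); split.
- move=> [y x] [/= Sy Sx]; split; last exact: sphere_qpow.
  by apply: sphere_rot => //; apply/sphere_qconj/sphere_qpow/sphere_qpow.
- apply: (@Cinf_smooth _ _ setT) => //; apply: Cinf_pair => //.
  by apply: Cinf_rot; [exact/Cinf_qconj/Cinf_qpow|exact: Cinf_fst].
- by move=> [y x] [/= Sy Sx]; rewrite ss rotK//; exact: sphere_qpow.
- move=> [y x] [/= Sy Sx]; rewrite /twist /= ss.
  rewrite -{1}[qpow a _]qconjK rotK//.
  exact/sphere_qconj/sphere_qpow/sphere_qpow.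
Qed.

Lemma htpic_to_diffeo_twist (a s : int) (g : 'rV[R]_4 -> 'rV[R]_3 * 'rV[R]_4) :
  s = 1 \/ s = -1 -> htpy_class R a s g -> htpic_to_diffeo_T1 g.
Proof.
move=> s1 /htpy_classP h; exists (twist a s); first exact: diffeomorphism_twist.
apply: homotopic_sym; congr (homotopic _ _ _ _): h.
by apply/funext => x; rewrite /twist /T1 /= rot_base2.
Qed.

End Embeddings.

(** * Smooth maps from S^2 to S^3 are not onto *)

Section MatrixNorm.
Context {R : realType}.

Lemma rV_norm_coord n (w : 'rV[R]_n) i : `|w 0 i| <= `|w|.
Proof.
rewrite [leRHS]/Num.Def.normr/= mx_normrE.
exact: (@le_bigmax _ _ _ 0 (fun ij : 'I_1 * 'I_n => `|w ij.1 ij.2|) (0, i)).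
Qed.

Lemma rV_norm_le n (w : 'rV[R]_n) c :
  0 <= c -> (forall i, `|w 0 i| <= c) -> `|w| <= c.
Proof.
move=> c0 wc; rewrite [leLHS]/Num.Def.normr/= mx_normrE.
by apply/bigmax_leP; split=> // -[i j] _ /=; rewrite ord1; exact: wc.
Qed.

End MatrixNorm.

(** * Local Lipschitz bounds for smooth maps *)

Section Lipschitz.
Context {R : realType}.

Lemma derive_segment {V : normedModType R} m (F : V -> 'rV[R]_m) (y w : V) t j :
  differentiable F (y + t *: w) ->
  is_derive t 1 (fun s : R => F (y + s *: w) 0 j) ('D_w F (y + t *: w) 0 j).
Proof.
move=> dF; pose A (s : R) := y + s *: w.
have dA : is_diff t A (fun s : R => s *: w).
  rewrite (_ : A = cst y + *:%R^~ w)//; apply: is_diff_eq.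
  by rewrite add0r.
have dFA : differentiable (F \o A) t by exact: differentiable_comp.
have dv : derivable (F \o A) t 1 by exact: diff_derivable.
apply: DeriveDef; first by move/derivable_mxP: dv; exact.
have E : 'D_1 (F \o A) t = 'D_w F (A t).
  by rewrite deriveE// deriveE// diff_comp//= diff_val scale1r.
by rewrite -[RHS]/('D_w F (A t) 0 j) -E derive_mx// mxE.
Qed.

(** Continuity of the partial derivatives bounds them near x by their values at x plus 1. As balls
    are convex, the mean value theorem along a segment then applies to each coordinate. *)
Lemma locally_lipschitz n m (U : set 'rV[R]_n) (F : 'rV[R]_n -> 'rV[R]_m) x :
  open U -> U x -> Ck 1 U F -> exists C r : R,
    [/\ 0 < r, 0 <= C & forall y y' : 'rV[R]_n,
    ball x r y -> ball x r y' -> `|F y' - F y| <= C * `|y' - y|].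
Proof.
move=> oU Ux [dF DF].
pose c (i : 'I_n) := `|'D_(delta_mx 0 i) F x| + 1.
have nU : nbhs x U by exact: open_nbhs_nbhs.
have nc : \forall y \near x, forall i : 'I_n, `|'D_(delta_mx 0 i) F y| <= c i.
  apply: (@filter_forall _ _ (fun (i : 'I_n) y => `|'D_(delta_mx 0 i) F y| <= c i)
    (nbhs x)) => i.
  have cD : 'D_(delta_mx 0 i) F @ nbhs x --> 'D_(delta_mx 0 i) F x.
    exact: DF Ux.
  have cx := cvg_norm cD.
  have lt1 : `|'D_(delta_mx 0 i) F x| < c i by rewrite ltrDl.
  have h : nbhs x [set y | `|'D_(delta_mx 0 i) F y| < c i].
    exact: (cvgr_lt _ (cx _) _ lt1).
  by apply: (@filterS _ (nbhs x) _ _ _ _ h) => y /ltW.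
have nUc : nbhs x (U `&` [set y | forall i, `|'D_(delta_mx 0 i) F y| <= c i]).
  exact: (@filterI _ (nbhs x)).
have /nbhs_ballP[r /= r0 xr] := nUc.
exists (\sum_i c i), r; split=> //.
  by apply: sumr_ge0 => i _; rewrite addr_ge0.
move=> y y' xy xy'; pose w := y' - y.
have seg t : 0 <= t -> t <= 1 -> ball x r (y + t *: w).
  move=> t0 t1; move: xy xy'; rewrite -!ball_normE /ball_/= => xy xy'.
  have -> : x - (y + t *: w) = (1 - t) *: (x - y) + t *: (x - y').
    by apply/rowP => i; rewrite /w !mxE; ring.
  apply: le_lt_trans (ler_normD _ _) _; rewrite !normrZ !ger0_norm//; last by lra.
  have [->|tn] := eqVneq t 0; first by rewrite subr0 mul1r mul0r addr0.
  have tpos : 0 < t by rewrite lt_neqAle eq_sym tn.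
  have h1 : t * `|x - y'| < t * r by rewrite ltr_pM2l.
  have h2 : (1 - t) * `|x - y| <= (1 - t) * r.
    by apply: ler_wpM2l; [lra|exact: ltW].
  by lra.
have dwF z : ball x r z -> `|'D_w F z| <= (\sum_i c i) * `|w|.
  move=> xz; have [Uz cz] := xr z xz.
  rewrite deriveE; last exact: dF.
  rewrite {1}[w]row_sum_delta linear_sum; apply: le_trans (ler_norm_sum _ _ _) _.
  rewrite mulr_suml; apply: ler_sum => i _; rewrite linearZ normrZ mulrC.
  rewrite ler_pM//; last exact: rV_norm_coord.
  by rewrite -deriveE; [exact: cz|exact: dF].
apply: rV_norm_le => [|j].
  by rewrite mulr_ge0// sumr_ge0// => i _; rewrite addr_ge0.
pose g s := F (y + s *: w) 0 j.
have dg (t : R) : 0 <= t -> t <= 1 -> is_derive t 1 g ('D_w F (y + t *: w) 0 j).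
  by move=> t0 t1; apply/derive_segment/dF; have [] := xr _ (seg t t0 t1).
have [||t tI E] := @MVT R g (fun t => 'D_w F (y + t *: w) 0 j) 0 1 ltr01.
- by move=> t; rewrite in_itv/= => /andP[/ltW t0 /ltW t1]; exact: dg.
- apply/continP; split=> t; rewrite /= in_itv/= => /andP[t0 t1].
  apply: cvg_within_filter; apply: differentiable_continuous.
  by apply/derivable1_diffP; have [] := dg t t0 t1.
move: tI; rewrite in_itv/= => /andP[/ltW t0 /ltW t1].
have yw : y + w = y' by rewrite /w addrC subrK.
move: E; rewrite /g subr0 mulr1 scale1r scale0r addr0 yw => E.
rewrite !mxE E; apply: le_trans (rV_norm_coord _ _) _.
exact/dwF/seg.
Qed.

Lemma compact_sphere n : compact (sphere R n).
Proof.
apply: bounded_closed_compact.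
  exists 1; split=> // M M1 x /= Sx; apply: rV_norm_le => [|i]; first by lra.
  have : x 0 i ^+ 2 <= 1.
    rewrite -((sphereE x).1 Sx) /sqnorm (bigD1 i)//= lerDl.
    by apply: sumr_ge0 => j _; exact: sqr_ge0.
  by rewrite -(real_normK (num_real _)) expr_le1// => h; exact: le_trans h (ltW M1).
have cs : continuous (fun x : 'rV[R]_n.+1 => sqnorm x).
  have cs : contin setT (fun x : 'rV[R]_n.+1 => sqnorm x).
    apply: (@contin_sum R _ [set: 'rV[R]_n.+1] n.+1 (fun i x => x 0 i ^+ 2)) => i.
    by contin_arith.
  by apply/continuous_subspace_setT/continP.
have -> : sphere R n = (fun x => sqnorm x) @^-1` [set 1] by [].
by apply: preimage_closed; [move=> x _; exact: cs|exact: closed_eq].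
Qed.

(** One number C is both the slope and the inverse of the scale at which the bound holds, so that
    compactness can merge the local bounds by letting C tend to infinity. *)
Lemma smooth_sphere_lipschitz n m (f : 'rV[R]_n.+1 -> 'rV[R]_m) :
  smooth (sphere R n) f ->
  \forall C \near +oo, forall y, sphere R n y -> forall y', sphere R n y' ->
    `|y' - y| * C < 1 -> `|f y' - f y| <= C * `|y' - y|.
Proof.
move=> sf; have /compact_near_coveringP/near_covering_withinP cov := @compact_sphere n.
apply: (cov R (pinfty_nbhs R) (fun C y => forall y', sphere R n y' ->
  `|y' - y| * C < 1 -> `|f y' - f y| <= C * `|y' - y|)).
move=> x Sx; have [F [U [oU Ux CF FE]]] := sf x Sx.
have [C [r [r0 C0 L]]] := locally_lipschitz oU Ux (CF 1%N).
have nU : nbhs x U by exact: open_nbhs_nbhs.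
have /nbhs_ballP[e /= e0 eU] := nU.
pose d := Num.min r e.
have d0 : 0 < d by rewrite lt_min r0.
(* [C <= K] takes care of the slope, and [2 / d <= K] forces y' within d / 2 of y, hence within d of
   x. *)
exists (ball x (d / 2), [set K | C <= K /\ 2 / d <= K]).
  split=> /=; first by apply: nbhsx_ballx; rewrite divr_gt0.
  by apply: filterI; apply: nbhs_pinfty_ge; exact: num_real.
move=> [y K] [/= xy [CK dK]] Sy y' Sy' yK.
have yy' : `|y' - y| < d / 2.
  have K0 : 0 < K by apply: lt_le_trans dK; rewrite divr_gt0.
  have : `|y' - y| < K^-1 by rewrite -[ltRHS]mul1r ltr_pdivlMr.
  move/lt_le_trans; apply; rewrite -[leRHS]invrK lef_pV2 ?posrE// ?invr_gt0 ?divr_gt0//.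
  by rewrite invf_div.
have xy' : ball x d y'.
  rewrite (splitr d); apply: (@ball_triangle _ _ y) => //.
  by rewrite -ball_normE /ball_/= distrC.
have xyd : ball x d y by apply: le_ball xy; rewrite ler_pdivrMr//; lra.
have [dr de] : d <= r /\ d <= e by rewrite /d !ge_min !lexx orbT.
have Uy := eU _ (le_ball de xyd); have Uy' := eU _ (le_ball de xy').
rewrite -!FE//; apply: le_trans (L _ _ (le_ball dr xyd) (le_ball dr xy')) _.
by rewrite ler_wpM2r.
Qed.

End Lipschitz.

(** * Restriction of a smooth map to a slice *)

Section Slice.
Context {R : realType}.

(** For an inner map with constant differential L the chain rule keeps its form at every order: the
    derivative along v is that of F along L v. This covers the inclusion v |-> (v, w). *)
Lemma Ck_affine {V W W' : normedModType R} k (U : set W) (A : V -> W)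
    (L : V -> W) (F : W -> W') :
  (forall x, differentiable A x) -> (forall x v, 'd A x v = L v) -> open U ->
  Ck k U F -> Ck k (A @^-1` U) (fun x => F (A x)).
Proof.
move=> dA AL oU; have oAU : open (A @^-1` U).
  by apply: open_comp => // x _; exact: differentiable_continuous.
elim: k F => [|k ih] F.
  move=> cF x Ux; apply: continuous_comp; last exact: cF.
  exact: differentiable_continuous.
move=> [dF DF]; split=> [x Ux|v].
  by apply: differentiable_comp => //; exact: dF.
apply: eq_Ck (ih _ (DF (L v))) => // x Ux.
rewrite (deriveE v (differentiable_comp (dA x) (dF (A x) Ux))).
by rewrite (diff_comp (dA x) (dF (A x) Ux)) /= AL deriveE//; exact: dF.
Qed.

Lemma smooth_slice {V W W' : normedModType R} (A : set V) (B : set W) m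
    (f : V * W -> W' * 'rV[R]_m) (w : W) :
  smooth (A `*` B) f -> B w -> smooth A (fun v => (f (v, w)).2).
Proof.
move=> sf Bw x Ax; have [F [U [oU Ux CF FE]]] := sf (x, w) (conj Ax Bw).
pose J (v : V) : V * W := (v, w).
have dJ v : is_diff v J (fun u => (u, 0)).
  have := @is_diff_pair R V V W id id (cst w) (cst 0) v _ _; exact.
have dJ1 v : differentiable J v by exact: ex_diff.
have dJ2 v u : 'd J v u = (u, 0) by rewrite (@diff_val _ _ _ _ _ _ _ (dJ v)).
exists (fun v => (F (J v)).2), (J @^-1` U); split=> //.
- by apply: open_comp => // v _; exact: differentiable_continuous.
- move=> k; apply: (@Ck_linear_comp _ _ _ _ _ _ snd).
  + by apply: open_comp => // v _; exact: differentiable_continuous.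
  + by move=> p; exact: cvg_snd.
  + exact: (Ck_affine dJ1 dJ2 oU (CF k)).
- by move=> v [Av Uv]; rewrite FE.
Qed.

End Slice.

(** * Counting grid points of S^3 against cells of S^2 *)

Section Counting.
Context {R : realType}.

(** Intervals of length 1/M subdividing [-1, 1]; the endpoint t = 1 accounts for the extra index,
    and the default value of [inord] is not reached on [-1, 1]. *)
Definition grid_index (M : nat) (t : R) : 'I_(2 * M).+1 :=
  inord (Num.truncn ((t + 1) * M%:R)).

Lemma grid_index_eq (M : nat) (s t : R) : (0 < M)%N ->
  -1 <= s -> s <= 1 -> -1 <= t -> t <= 1 ->
  grid_index M s = grid_index M t -> `|s - t| <= M%:R^-1.
Proof.
move=> M0 s1 s2 t1 t2 /(congr1 val); have M0' : 0 < M%:R :> R by rewrite ltr0n.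
have pos (u : R) : -1 <= u -> 0 <= (u + 1) * M%:R by move=> u1; rewrite mulr_ge0//; lra.
have lt (u : R) : -1 <= u -> u <= 1 -> (Num.truncn ((u + 1) * M%:R) < (2 * M).+1)%N.
  move=> u1 u2; rewrite truncn_lt_nat ?pos// -natr1 natrM.
  have : (u + 1) * M%:R <= 2 * M%:R by rewrite ler_pM2r//; lra.
  by lra.
rewrite /= !inordK ?lt// => E.
have /andP[a1 a2] := truncn_itv (pos _ s1); have /andP[b1 b2] := truncn_itv (pos _ t1).
rewrite -[leRHS]mul1r ler_pdivlMr// -[X in _ * X](gtr0_norm M0') -normrM.
rewrite ler_norml mulrBl; move: a1 a2 b1 b2; rewrite E -natr1 !mulrDl !mul1r; lra.
Qed.

(** Some coordinate of a point of S^2 has square at least 1/4. Its sign and the other two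
    coordinates determine it in a Lipschitz way, so a number of cells quadratic in M suffices. *)
Definition sphere_cell (M : nat) (y : 'rV[R]_3) :
    'I_3 * bool * 'I_(2 * M).+1 * 'I_(2 * M).+1 :=
  let g := grid_index M in
  if 1 / 4 <= y 0 0 ^+ 2 then (0, 0 <= y 0 0, g (y 0 1), g (y 0 2))
  else if 1 / 4 <= y 0 1 ^+ 2 then (1, 0 <= y 0 1, g (y 0 0), g (y 0 2))
  else (2, 0 <= y 0 2, g (y 0 0), g (y 0 1)).

(** Factor c^2 - c'^2 = (a'^2 - a^2) + (b'^2 - b^2): the right side is at most 4 e, and |c + c'| >=
    1 because c and c' have the same sign and absolute value at least 1/2. *)
Lemma third_coordinate (a b c a' b' c' e : R) :
  a ^+ 2 + b ^+ 2 + c ^+ 2 = 1 -> a' ^+ 2 + b' ^+ 2 + c' ^+ 2 = 1 ->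
  1 / 4 <= c ^+ 2 -> 1 / 4 <= c' ^+ 2 -> (0 <= c) = (0 <= c') ->
  `|a - a'| <= e -> `|b - b'| <= e -> `|c - c'| <= 4 * e.
Proof.
move=> S1 S2 c1 c2 cc aa bb.
have ge (u : R) : 1 / 4 <= u ^+ 2 -> 1 / 2 <= `|u|.
  rewrite -(real_normK (num_real u)); have := normr_ge0 u.
  by move: `|u| => v v0 h; nra.
have le (u v w : R) : u ^+ 2 + v ^+ 2 + w ^+ 2 = 1 -> `|u| <= 1.
  move=> S; have : u ^+ 2 <= 1 by have := sqr_ge0 v; have := sqr_ge0 w; lra.
  by rewrite -(real_normK (num_real u)) expr_le1.
have sum1 : 1 <= `|c + c'|.
  have := ge _ c1; have := ge _ c2; case: (lerP 0 c) cc => c0 /esym cc.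
    by rewrite !ger0_norm ?addr_ge0//; lra.
  move/negbT: cc; rewrite -ltNge => c0'.
  by rewrite !ltr0_norm//; lra.
have eq : (c - c') * (c + c') = (a' - a) * (a + a') + (b' - b) * (b + b').
  transitivity (c ^+ 2 - c' ^+ 2); first by ring.
  transitivity (a' ^+ 2 - a ^+ 2 + (b' ^+ 2 - b ^+ 2)); last by ring.
  by lra.
have la : `|(a' - a) * (a + a')| <= e * 2.
  rewrite normrM distrC ler_pM//; apply: le_trans (ler_normD _ _) _.
  by have := le _ _ _ S1; have := le _ _ _ S2; lra.
have lb : `|(b' - b) * (b + b')| <= e * 2.
  rewrite normrM distrC ler_pM//; apply: le_trans (ler_normD _ _) _.
  have {}S1 : b ^+ 2 + a ^+ 2 + c ^+ 2 = 1 by lra.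
  have {}S2 : b' ^+ 2 + a' ^+ 2 + c' ^+ 2 = 1 by lra.
  by have := le _ _ _ S1; have := le _ _ _ S2; lra.
apply: le_trans (_ : `|c - c'| * `|c + c'| <= _).
  by rewrite ler_peMr.
rewrite -normrM eq; apply: le_trans (ler_normD _ _) _; lra.
Qed.

Lemma sphere_cell_eq (M : nat) (y y' : 'rV[R]_3) : (0 < M)%N ->
  sphere R 2 y -> sphere R 2 y' -> sphere_cell M y = sphere_cell M y' ->
  `|y - y'| <= 4 * M%:R^-1.
Proof.
move=> M0 Sy Sy'; have M0' : 0 < M%:R^-1 :> R by rewrite invr_gt0 ltr0n.
have [S1 S2] : y 0 0 ^+ 2 + y 0 1 ^+ 2 + y 0 2 ^+ 2 = 1 /\
    y' 0 0 ^+ 2 + y' 0 1 ^+ 2 + y' 0 2 ^+ 2 = 1.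
  by rewrite -!sqnorm3; split; exact/sphereE.
have co (z : 'rV[R]_3) i : sphere R 2 z -> -1 <= z 0 i /\ z 0 i <= 1.
  rewrite sphereE sqnorm3 => S; have : z 0 i ^+ 2 <= 1.
    have := sqr_ge0 (z 0 0); have := sqr_ge0 (z 0 1); have := sqr_ge0 (z 0 2).
    by move: i; apply: ord3_ind; lra.
  by split; nra.
have gi i : grid_index M (y 0 i) = grid_index M (y' 0 i) ->
    `|y 0 i - y' 0 i| <= M%:R^-1.
  have [a1 a2] := co y i Sy; have [b1 b2] := co y' i Sy'.
  exact: grid_index_eq.
move=> E; suff : [/\ `|y 0 0 - y' 0 0| <= 4 * M%:R^-1, `|y 0 1 - y' 0 1| <= 4 * M%:R^-1
    & `|y 0 2 - y' 0 2| <= 4 * M%:R^-1].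
  move=> [h0 h1 h2]; apply: rV_norm_le; first by rewrite mulr_ge0// ltW.
  by apply: ord3_ind; rewrite !mxE.
move: E; rewrite /sphere_cell.
case: (lerP (1 / 4) (y 0 0 ^+ 2)) => c0; case: (lerP (1 / 4) (y' 0 0 ^+ 2)) => c0'.
- move=> [cc /gi g1 /gi g2]; split; try lra.
  by apply: third_coordinate cc g1 g2 => //; lra.
- by case: ifP.
- by case: ifP.
case: (lerP (1 / 4) (y 0 1 ^+ 2)) => c1; case: (lerP (1 / 4) (y' 0 1 ^+ 2)) => c1' //.
- move=> [cc /gi g1 /gi g2]; split; try lra.
  by apply: third_coordinate cc g1 g2 => //; lra.
- move=> [cc /gi g1 /gi g2]; split; try lra.
  by apply: third_coordinate cc g1 g2 => //; lra.
Qed.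

(** A grid on the graph of a function over a cube: a, b, c < 1/2 keep the radicand positive, and the
    first three coordinates already separate the points. *)
Definition grid_point n (p : 'I_n * 'I_n * 'I_n) : 'rV[R]_4 :=
  let d := 2 * n%:R in
  let a := p.1.1%:R / d in let b := p.1.2%:R / d in let c := p.2%:R / d in
  mk4 a b c (Num.sqrt (1 - (a ^+ 2 + b ^+ 2 + c ^+ 2))).

Lemma sphere_grid_point n p : sphere R 3 (@grid_point n p).
Proof.
case: p => [[i j] k]; have n0 : 0 < n%:R :> R.
  by rewrite ltr0n (leq_ltn_trans _ (ltn_ord i)).
have le (u : 'I_n) : (u%:R / (2 * n%:R)) ^+ 2 <= 1 / 4 :> R.
  have : u%:R / (2 * n%:R) <= 1 / 2 :> R.
    rewrite ler_pdivrMr ?mulr_gt0// mulrA div1r mulVf// mul1r ler_nat.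
    exact/ltnW/ltn_ord.
  have : 0 <= u%:R / (2 * n%:R) :> R by rewrite divr_ge0// mulr_ge0// ltW.
  by nra.
rewrite sphereE sqnorm4 /grid_point !mkE /= sqr_sqrtr; first by ring.
by have := le i; have := le j; have := le k; lra.
Qed.

Lemma grid_point_inj n (p p' : 'I_n * 'I_n * 'I_n) :
  `|grid_point p - grid_point p'| < (2 * n%:R)^-1 -> p = p'.
Proof.
case: p p' => [[i j] k] [[i' j'] k'] h; have n0 : 0 < n%:R :> R.
  by rewrite ltr0n (leq_ltn_trans _ (ltn_ord i)).
have d0 : 0 < 2 * n%:R :> R by rewrite mulr_gt0.
have eq (u u' : 'I_n) : `|u%:R / (2 * n%:R) - u'%:R / (2 * n%:R)| <
    (2 * n%:R)^-1 :> R -> u = u'.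
  rewrite -mulrBl normrM [X in _ * X]gtr0_norm ?invr_gt0// => lt1.
  have {lt1} : `|u%:R - u'%:R| < 1 :> R.
    by rewrite -(ltr_pM2r (x := (2 * n%:R)^-1)) ?invr_gt0// mul1r.
  rewrite ltr_norml => /andP[l1 l2]; apply: val_inj => /=; apply/eqP.
  rewrite eqn_leq; apply/andP; split; rewrite -ltnS -(ltr_nat R) -natr1; lra.
have co c := le_lt_trans (rV_norm_coord _ c) h.
congr (_, _, _); apply: eq.
- by have := co 0; rewrite !mxE.
- by have := co 1; rewrite !mxE.
- by have := co 2; rewrite !mxE.
Qed.

(* A Lipschitz map sends a fine decomposition of S^2 into O(n^2) cells to sets
   too small to contain two of the n^3 points of a grid of mesh 1/(2n). *)
Lemma smooth_sphere_not_onto (f : 'rV[R]_3 -> 'rV[R]_4) :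
  smooth (sphere R 2) f ->
  exists2 z, sphere R 3 z & forall y, sphere R 2 y -> f y <> z.
Proof.
move=> sf; apply: contrapT => onto.
have {}onto z : sphere R 3 z -> exists y, sphere R 2 y /\ f y = z.
  move=> Sz; apply: contrapT => ny; apply: onto; exists z => // y Sy fy.
  by apply: ny; exists y.
have [C0 [_ LC]] := smooth_sphere_lipschitz sf.
pose K := (Num.truncn `|C0|).+1.
have KC : C0 < K%:R :> R.
  apply: le_lt_trans (ler_norm _) _.
  by have /andP[] := truncn_itv (normr_ge0 C0).
have {LC} L := LC _ KC.
have K0 : (0 < K)%N by [].
(* There are at most 6 (33 K n)^2 = 6534 K^2 n^2 cells, fewer than n^3 for this n. The existential
   keeps n opaque, so that no large unary numeral is computed. *)
have [n nE] : exists n, n = (6535 * (K * K))%N by exists (6535 * (K * K))%N.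
clearbody K; have n0 : (0 < n)%N by rewrite nE !muln_gt0 K0.
(* Points of one cell are at most 4 / M apart, so their images are at most 4 K / M = 1 / (4 n)
   apart, below the mesh 1 / (2 n). *)
pose M := (16 * K * n)%N.
have M0 : (0 < M)%N by rewrite !muln_gt0 K0 n0.
have [y yP] := choice (fun p : 'I_n * 'I_n * 'I_n => onto _ (sphere_grid_point p)).
have cinj : injective (fun p => sphere_cell M (y p)).
  move=> p p' E; have [Sy fy] := yP p; have [Sy' fy'] := yP p'.
  apply: grid_point_inj; rewrite -fy -fy'.
  have D := sphere_cell_eq M0 Sy Sy' E.
  have KR : 0 < K%:R :> R by rewrite ltr0n.
  have nR : 0 < n%:R :> R by rewrite ltr0n.
  have ME : 4 * M%:R^-1 * K%:R = (4 * n%:R)^-1 :> R.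
    by rewrite /M !natrM; field; rewrite !gt_eqF.
  have DK : `|y p - y p'| * K%:R <= (4 * n%:R)^-1.
    by rewrite -ME ler_pM2r.
  have n4 : (4 * n%:R)^-1 < (2 * n%:R)^-1 :> R.
    by rewrite ltf_pV2 ?posrE ?mulr_gt0// ltr_pM2r//; lra.
  apply: le_lt_trans n4; apply: le_trans (L _ Sy' _ Sy _) _.
    apply: le_lt_trans DK _; rewrite invf_lt1 ?mulr_gt0//.
    have : 1 <= n%:R :> R by rewrite ler1n.
    by lra.
  by rewrite mulrC.
have := leq_card _ cinj; rewrite !card_prod !card_ord card_bool.
rewrite leqNgt => /negP; apply.
have MK : ((2 * M).+1 <= 33 * K * n)%N.
  by rewrite /M; have : (0 < K * n)%N; [rewrite muln_gt0 K0|lia].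
apply: (@leq_ltn_trans (3 * 2 * (33 * K * n) * (33 * K * n))%N).
  by rewrite !leq_mul.
have -> : (3 * 2 * (33 * K * n) * (33 * K * n) = 6534 * (K * K) * (n * n))%N.
  by ring.
rewrite -[X in (_ < X)%N]mulnA.
rewrite ltn_pmul2r; last by rewrite muln_gt0 n0.
by rewrite nE ltn_pmul2r// muln_gt0 K0.
Qed.

End Counting.

(** * Degree *)

Section Labels.

(* The sign of (a, b, c, d) as a permutation of (0, 1, 2, 3), and 0 if it is
   not one. *)
Definition sgn4 (a b c d : nat) : int :=
  if [&& a < 4, b < 4, c < 4, d < 4 & uniq [:: a; b; c; d]]%N then
    (-1) ^+ ((b < a) + (c < a) + (d < a) + (c < b) + (d < b) + (d < c))%N
  else 0.

(** The alternating sum of [sgn4] over the five faces of a labelled 4-simplex. *)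
Definition dsgn4 (a b c d e : nat) : int :=
  sgn4 b c d e - sgn4 a c d e + sgn4 a b d e - sgn4 a b c e + sgn4 a b c d.

(** If a label below 4 is missing, every term is 0. If 4 is missing, two of the five labels
    coincide, and only the two faces that omit one of them can count, with opposite signs. The proof
    runs through all cases. *)
Lemma dsgn4_eq0 v a b c d e : (v < 5)%N ->
  (forall u, u \in [:: a; b; c; d; e] -> (u < 5)%N && (u != v)) ->
  dsgn4 a b c d e = 0.
Proof.
move=> v5 h.
have chk : all (fun v => all (fun a => all (fun b => all (fun c => all (fun d =>
    all (fun e => (v \in [:: a; b; c; d; e]) || (dsgn4 a b c d e == 0))
    (iota 0 5)) (iota 0 5)) (iota 0 5)) (iota 0 5)) (iota 0 5)) (iota 0 5).
  by vm_compute.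
have lt5 u : u \in [:: a; b; c; d; e] -> u \in iota 0 5.
  by move=> /h /andP[u5 _]; rewrite mem_iota.
have nv : v \notin [:: a; b; c; d; e].
  by apply/negP => /h /andP[_]; rewrite eqxx.
have vi : v \in iota 0 5 by rewrite mem_iota.
have la : a \in iota 0 5 by apply: lt5; rewrite !inE eqxx.
have lb : b \in iota 0 5 by apply: lt5; rewrite !inE eqxx ?orbT.
have lc : c \in iota 0 5 by apply: lt5; rewrite !inE eqxx ?orbT.
have ld : d \in iota 0 5 by apply: lt5; rewrite !inE eqxx ?orbT.
have le : e \in iota 0 5 by apply: lt5; rewrite !inE eqxx ?orbT.
move: chk => /allP/(_ v vi)/allP/(_ a la)/allP/(_ b lb)/allP/(_ c lc).
by move=> /allP/(_ d ld)/allP/(_ e le); rewrite (negbTE nv) => /eqP.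
Qed.

Lemma sgn4_eq0 v a b c d : (v < 4)%N ->
  (forall u, u \in [:: a; b; c; d] -> (u < 5)%N && (u != v)) ->
  sgn4 a b c d = 0.
Proof.
move=> v4 h.
have chk : all (fun v => all (fun a => all (fun b => all (fun c => all (fun d =>
    (v \in [:: a; b; c; d]) || (sgn4 a b c d == 0))
    (iota 0 5)) (iota 0 5)) (iota 0 5)) (iota 0 5)) (iota 0 4).
  by vm_compute.
have lt5 u : u \in [:: a; b; c; d] -> u \in iota 0 5.
  by move=> /h /andP[u5 _]; rewrite mem_iota.
have nv : v \notin [:: a; b; c; d].
  by apply/negP => /h /andP[_]; rewrite eqxx.
have vi : v \in iota 0 4 by rewrite mem_iota.
have la : a \in iota 0 5 by apply: lt5; rewrite !inE eqxx.
have lb : b \in iota 0 5 by apply: lt5; rewrite !inE eqxx ?orbT.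
have lc : c \in iota 0 5 by apply: lt5; rewrite !inE eqxx ?orbT.
have ld : d \in iota 0 5 by apply: lt5; rewrite !inE eqxx ?orbT.
move: chk => /allP/(_ v vi)/allP/(_ a la)/allP/(_ b lb)/allP/(_ c lc).
by move=> /allP/(_ d ld); rewrite (negbTE nv) => /eqP.
Qed.

Lemma sgn4_rep01 a b c : sgn4 a a b c = 0.
Proof. by rewrite /sgn4 /= !inE eqxx /= !andbF. Qed.

Lemma sgn4_rep23 a b c : sgn4 a b c c = 0.
Proof. by rewrite /sgn4 /= !inE eqxx /= ?andbF ?orbT /= ?andbF. Qed.

(* The signed number of simplices with labels 0, 1, 2, 3 in the triangulation of
   a unit cube by the six increasing paths from (i, j, k) to
   (i + 1, j + 1, k + 1). *)
Definition kuhn (f : nat -> nat -> nat -> nat) (i j k : nat) : int :=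
  sgn4 (f i j k) (f i.+1 j k) (f i.+1 j.+1 k) (f i.+1 j.+1 k.+1)
  - sgn4 (f i j k) (f i.+1 j k) (f i.+1 j k.+1) (f i.+1 j.+1 k.+1)
  - sgn4 (f i j k) (f i j.+1 k) (f i.+1 j.+1 k) (f i.+1 j.+1 k.+1)
  + sgn4 (f i j k) (f i j.+1 k) (f i j.+1 k.+1) (f i.+1 j.+1 k.+1)
  + sgn4 (f i j k) (f i j k.+1) (f i.+1 j k.+1) (f i.+1 j.+1 k.+1)
  - sgn4 (f i j k) (f i j k.+1) (f i j.+1 k.+1) (f i.+1 j.+1 k.+1).

Lemma eq_kuhn f g i j k i' j' k' :
  (forall a b c, (a < 2)%N -> (b < 2)%N -> (c < 2)%N ->
    f (i + a)%N (j + b)%N (k + c)%N = g (i' + a)%N (j' + b)%N (k' + c)%N) ->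
  kuhn f i j k = kuhn g i' j' k'.
Proof.
move=> fg; rewrite /kuhn.
have e000 := fg 0 0 0 isT isT isT; have e001 := fg 0 0 1 isT isT isT.
have e010 := fg 0 1 0 isT isT isT; have e011 := fg 0 1 1 isT isT isT.
have e100 := fg 1 0 0 isT isT isT; have e101 := fg 1 0 1 isT isT isT.
have e110 := fg 1 1 0 isT isT isT; have e111 := fg 1 1 1 isT isT isT.
by rewrite !addn0 !addn1 in e000 e001 e010 e011 e100 e101 e110 e111;
  rewrite e000 e001 e010 e011 e100 e101 e110 e111.
Qed.

(** An increasing path changes i only once, so its first two or its last two labels agree. *)
Lemma kuhn_cst (g : nat -> nat) i j k : kuhn (fun i _ _ => g i) i j k = 0.
Proof. by rewrite /kuhn !sgn4_rep23 !sgn4_rep01; ring. Qed.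

Lemma kuhn_missing v f i j k : (v < 4)%N ->
  (forall a b c, (a < 2)%N -> (b < 2)%N -> (c < 2)%N ->
    (f (i + a) (j + b) (k + c) < 5)%N && (f (i + a)%N (j + b)%N (k + c)%N != v)) ->
  kuhn f i j k = 0.
Proof.
move=> v4 h.
have e000 := h 0 0 0 isT isT isT; have e001 := h 0 0 1 isT isT isT.
have e010 := h 0 1 0 isT isT isT; have e011 := h 0 1 1 isT isT isT.
have e100 := h 1 0 0 isT isT isT; have e101 := h 1 0 1 isT isT isT.
have e110 := h 1 1 0 isT isT isT; have e111 := h 1 1 1 isT isT isT.
rewrite !addn0 !addn1 in e000 e001 e010 e011 e100 e101 e110 e111.
by rewrite /kuhn !(@sgn4_eq0 v)//;
  by move=> u; rewrite !inE => /or4P[] /eqP->.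
Qed.

(* The four terms are the pairs of opposite faces of a 4-cube; the interior
   faces of its Kuhn triangulation cancel. *)
Lemma kuhn_boundary v (x : nat -> nat -> nat -> nat -> nat) t i j k : (v < 5)%N ->
  (forall a b c d, (a < 2)%N -> (b < 2)%N -> (c < 2)%N -> (d < 2)%N ->
    (x (t + a) (i + b) (j + c) (k + d) < 5)%N &&
    (x (t + a)%N (i + b)%N (j + c)%N (k + d)%N != v)) ->
  (kuhn (x t.+1) i j k - kuhn (x t) i j k)
  - (kuhn (fun t j k => x t i.+1 j k) t j k - kuhn (fun t j k => x t i j k) t j k)
  + (kuhn (fun t i k => x t i j.+1 k) t i k - kuhn (fun t i k => x t i j k) t i k)
  - (kuhn (fun t i j => x t i j k.+1) t i j - kuhn (fun t i j => x t i j k) t i j)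
  = 0.
Proof.
(* One term for each of the 24 increasing paths across the 4-cube, with the sign of the order in
   which the directions are taken. *)
move=> v5 h; transitivity (
    dsgn4 (x t i j k) (x t.+1 i j k) (x t.+1 i.+1 j k)
      (x t.+1 i.+1 j.+1 k) (x t.+1 i.+1 j.+1 k.+1)
    - dsgn4 (x t i j k) (x t.+1 i j k) (x t.+1 i.+1 j k)
      (x t.+1 i.+1 j k.+1) (x t.+1 i.+1 j.+1 k.+1)
    - dsgn4 (x t i j k) (x t.+1 i j k) (x t.+1 i j.+1 k)
      (x t.+1 i.+1 j.+1 k) (x t.+1 i.+1 j.+1 k.+1)
    + dsgn4 (x t i j k) (x t.+1 i j k) (x t.+1 i j.+1 k)
      (x t.+1 i j.+1 k.+1) (x t.+1 i.+1 j.+1 k.+1)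
    + dsgn4 (x t i j k) (x t.+1 i j k) (x t.+1 i j k.+1)
      (x t.+1 i.+1 j k.+1) (x t.+1 i.+1 j.+1 k.+1)
    - dsgn4 (x t i j k) (x t.+1 i j k) (x t.+1 i j k.+1)
      (x t.+1 i j.+1 k.+1) (x t.+1 i.+1 j.+1 k.+1)
    - dsgn4 (x t i j k) (x t i.+1 j k) (x t.+1 i.+1 j k)
      (x t.+1 i.+1 j.+1 k) (x t.+1 i.+1 j.+1 k.+1)
    + dsgn4 (x t i j k) (x t i.+1 j k) (x t.+1 i.+1 j k)
      (x t.+1 i.+1 j k.+1) (x t.+1 i.+1 j.+1 k.+1)
    + dsgn4 (x t i j k) (x t i.+1 j k) (x t i.+1 j.+1 k)
      (x t.+1 i.+1 j.+1 k) (x t.+1 i.+1 j.+1 k.+1)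
    - dsgn4 (x t i j k) (x t i.+1 j k) (x t i.+1 j.+1 k)
      (x t i.+1 j.+1 k.+1) (x t.+1 i.+1 j.+1 k.+1)
    - dsgn4 (x t i j k) (x t i.+1 j k) (x t i.+1 j k.+1)
      (x t.+1 i.+1 j k.+1) (x t.+1 i.+1 j.+1 k.+1)
    + dsgn4 (x t i j k) (x t i.+1 j k) (x t i.+1 j k.+1)
      (x t i.+1 j.+1 k.+1) (x t.+1 i.+1 j.+1 k.+1)
    + dsgn4 (x t i j k) (x t i j.+1 k) (x t.+1 i j.+1 k)
      (x t.+1 i.+1 j.+1 k) (x t.+1 i.+1 j.+1 k.+1)
    - dsgn4 (x t i j k) (x t i j.+1 k) (x t.+1 i j.+1 k)
      (x t.+1 i j.+1 k.+1) (x t.+1 i.+1 j.+1 k.+1)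
    - dsgn4 (x t i j k) (x t i j.+1 k) (x t i.+1 j.+1 k)
      (x t.+1 i.+1 j.+1 k) (x t.+1 i.+1 j.+1 k.+1)
    + dsgn4 (x t i j k) (x t i j.+1 k) (x t i.+1 j.+1 k)
      (x t i.+1 j.+1 k.+1) (x t.+1 i.+1 j.+1 k.+1)
    + dsgn4 (x t i j k) (x t i j.+1 k) (x t i j.+1 k.+1)
      (x t.+1 i j.+1 k.+1) (x t.+1 i.+1 j.+1 k.+1)
    - dsgn4 (x t i j k) (x t i j.+1 k) (x t i j.+1 k.+1)
      (x t i.+1 j.+1 k.+1) (x t.+1 i.+1 j.+1 k.+1)
    - dsgn4 (x t i j k) (x t i j k.+1) (x t.+1 i j k.+1)
      (x t.+1 i.+1 j k.+1) (x t.+1 i.+1 j.+1 k.+1)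
    + dsgn4 (x t i j k) (x t i j k.+1) (x t.+1 i j k.+1)
      (x t.+1 i j.+1 k.+1) (x t.+1 i.+1 j.+1 k.+1)
    + dsgn4 (x t i j k) (x t i j k.+1) (x t i.+1 j k.+1)
      (x t.+1 i.+1 j k.+1) (x t.+1 i.+1 j.+1 k.+1)
    - dsgn4 (x t i j k) (x t i j k.+1) (x t i.+1 j k.+1)
      (x t i.+1 j.+1 k.+1) (x t.+1 i.+1 j.+1 k.+1)
    - dsgn4 (x t i j k) (x t i j k.+1) (x t i j.+1 k.+1)
      (x t.+1 i j.+1 k.+1) (x t.+1 i.+1 j.+1 k.+1)
    + dsgn4 (x t i j k) (x t i j k.+1) (x t i j.+1 k.+1)
      (x t i.+1 j.+1 k.+1) (x t.+1 i.+1 j.+1 k.+1)).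
  by rewrite /kuhn /dsgn4; ring.
have D a b c d e : (a < 5)%N && (a != v) -> (b < 5)%N && (b != v) ->
    (c < 5)%N && (c != v) -> (d < 5)%N && (d != v) -> (e < 5)%N && (e != v) ->
    dsgn4 a b c d e = 0.
  move=> ha hb hc hd he; apply: dsgn4_eq0 v5 _ => u; rewrite !inE.
  by do 4?[case/orP => [/eqP->//|]] => /eqP->.
have e0000 := h 0 0 0 0 isT isT isT isT. have e0001 := h 0 0 0 1 isT isT isT isT.
have e0010 := h 0 0 1 0 isT isT isT isT. have e0011 := h 0 0 1 1 isT isT isT isT.
have e0100 := h 0 1 0 0 isT isT isT isT. have e0101 := h 0 1 0 1 isT isT isT isT.
have e0110 := h 0 1 1 0 isT isT isT isT. have e0111 := h 0 1 1 1 isT isT isT isT.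
have e1000 := h 1 0 0 0 isT isT isT isT. have e1001 := h 1 0 0 1 isT isT isT isT.
have e1010 := h 1 0 1 0 isT isT isT isT. have e1011 := h 1 0 1 1 isT isT isT isT.
have e1100 := h 1 1 0 0 isT isT isT isT. have e1101 := h 1 1 0 1 isT isT isT isT.
have e1110 := h 1 1 1 0 isT isT isT isT. have e1111 := h 1 1 1 1 isT isT isT isT.
rewrite !addn0 !addn1 in e0000 e0001 e0010 e0011 e0100 e0101 e0110 e0111.
rewrite !addn0 !addn1 in e1000 e1001 e1010 e1011 e1100 e1101 e1110 e1111.
by rewrite !D//; ring.
Qed.

Definition total (f : nat -> nat -> nat -> nat) (l m n : nat) : int :=
  \sum_(0 <= i < l) \sum_(0 <= j < m) \sum_(0 <= k < n) kuhn f i j k.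

Lemma sum_nat_eq0 n (F : nat -> int) :
  (forall i, (i < n)%N -> F i = 0) -> \sum_(0 <= i < n) F i = 0.
Proof. by move=> h; rewrite big_nat big1// => i /andP[_ /h]. Qed.

(** A discrete Stokes formula: [kuhn_boundary] summed over all 4-cubes telescopes in each of the
    four directions. On the side faces the labels depend on t alone, so these contribute 0 by
    [kuhn_cst], and the faces t = 0 and t = n remain. *)
Lemma total_homotopy n (x : nat -> nat -> nat -> nat -> nat) (g : nat -> nat) :
  (forall t i j k, (t < n)%N -> (i < n)%N -> (j < n)%N -> (k < n)%N ->
    exists2 v, (v < 5)%N & forall a b c d,
      (a < 2)%N -> (b < 2)%N -> (c < 2)%N -> (d < 2)%N ->
      (x (t + a) (i + b) (j + c) (k + d) < 5)%N &&
      (x (t + a)%N (i + b)%N (j + c)%N (k + d)%N != v)) ->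
  (forall t j k, (j <= n)%N -> (k <= n)%N -> x t 0%N j k = g t /\ x t n j k = g t) ->
  (forall t i k, (i <= n)%N -> (k <= n)%N -> x t i 0%N k = g t /\ x t i n k = g t) ->
  (forall t i j, (i <= n)%N -> (j <= n)%N -> x t i j 0%N = g t /\ x t i j n = g t) ->
  total (x 0%N) n n n = total (x n) n n n.
Proof.
move=> miss bi bj bk.
have Z (f : nat -> nat -> nat -> nat) t j k : (j < n)%N -> (k < n)%N ->
    (forall t j k, (j <= n)%N -> (k <= n)%N -> f t j k = g t) -> kuhn f t j k = 0.
  move=> jn kn fg; rewrite -(kuhn_cst g t j k); apply: eq_kuhn => a b c a2 b2 c2.
  by apply: fg; lia.
pose sum3 (F : nat -> nat -> nat -> int) :=
  \sum_(0 <= a < n) \sum_(0 <= b < n) \sum_(0 <= c < n) F a b c.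
have E : \sum_(0 <= t < n) \sum_(0 <= i < n) \sum_(0 <= j < n) \sum_(0 <= k < n)
  ((kuhn (x t.+1) i j k - kuhn (x t) i j k)
  - (kuhn (fun t j k => x t i.+1 j k) t j k - kuhn (fun t j k => x t i j k) t j k)
  + (kuhn (fun t i k => x t i j.+1 k) t i k - kuhn (fun t i k => x t i j k) t i k)
  - (kuhn (fun t i j => x t i j k.+1) t i j - kuhn (fun t i j => x t i j k) t i j))
  = 0.
  apply: sum_nat_eq0 => t tn; apply: sum_nat_eq0 => i iln.
  apply: sum_nat_eq0 => j jn; apply: sum_nat_eq0 => k kn.
  by have [v v5 hv] := miss t i j k tn iln jn kn; exact: kuhn_boundary v5 hv.
apply/esym/eqP; rewrite -subr_eq0 -[X in _ == X]E; apply/eqP.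
rewrite -(telescope_sumr (fun t => total (x t) n n n)) //.
have Si : \sum_(0 <= t < n) \sum_(0 <= i < n) \sum_(0 <= j < n) \sum_(0 <= k < n)
  (kuhn (fun t j k => x t i.+1 j k) t j k - kuhn (fun t j k => x t i j k) t j k) = 0.
  apply: sum_nat_eq0 => t _; rewrite exchange_big; apply: sum_nat_eq0 => j jn.
  rewrite exchange_big; apply: sum_nat_eq0 => k kn.
  rewrite (telescope_sumr (fun i => kuhn (fun t j k => x t i j k) t j k)) //.
  by rewrite !Z ?subrr// => t' j' k' j'n k'n; have [] := bi t' j' k' j'n k'n.
have Sj : \sum_(0 <= t < n) \sum_(0 <= i < n) \sum_(0 <= j < n) \sum_(0 <= k < n)
  (kuhn (fun t i k => x t i j.+1 k) t i k - kuhn (fun t i k => x t i j k) t i k) = 0.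
  apply: sum_nat_eq0 => t _; apply: sum_nat_eq0 => i iln.
  rewrite exchange_big; apply: sum_nat_eq0 => k kn.
  rewrite (telescope_sumr (fun j => kuhn (fun t i k => x t i j k) t i k)) //.
  by rewrite !Z ?subrr// => t' j' k' j'n k'n; have [] := bj t' j' k' j'n k'n.
have Sk : \sum_(0 <= t < n) \sum_(0 <= i < n) \sum_(0 <= j < n) \sum_(0 <= k < n)
  (kuhn (fun t i j => x t i j k.+1) t i j - kuhn (fun t i j => x t i j k) t i j) = 0.
  apply: sum_nat_eq0 => t _; apply: sum_nat_eq0 => i iln.
  apply: sum_nat_eq0 => j jn.
  rewrite (telescope_sumr (fun k => kuhn (fun t i j => x t i j k) t i j)) //.
  by rewrite !Z ?subrr// => t' j' k' j'n k'n; have [] := bk t' j' k' j'n k'n.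
have sub4 (F G H K : nat -> nat -> nat -> nat -> int) :
  \sum_(0 <= t < n) \sum_(0 <= i < n) \sum_(0 <= j < n) \sum_(0 <= k < n)
    (F t i j k - G t i j k + H t i j k - K t i j k) =
  \sum_(0 <= t < n) \sum_(0 <= i < n) \sum_(0 <= j < n) \sum_(0 <= k < n) F t i j k
  - \sum_(0 <= t < n) \sum_(0 <= i < n) \sum_(0 <= j < n) \sum_(0 <= k < n) G t i j k
  + \sum_(0 <= t < n) \sum_(0 <= i < n) \sum_(0 <= j < n) \sum_(0 <= k < n) H t i j k
  - \sum_(0 <= t < n) \sum_(0 <= i < n) \sum_(0 <= j < n) \sum_(0 <= k < n) K t i j k.
  rewrite -!(sumrB, big_split) /=; apply: eq_bigr => t _.
  rewrite -!(sumrB, big_split) /=; apply: eq_bigr => i _.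
  rewrite -!(sumrB, big_split) /=; apply: eq_bigr => j _.
  by rewrite -!(sumrB, big_split).
rewrite sub4 Si Sj Sk subr0 addr0 subr0; apply: eq_bigr => t _.
rewrite /total -sumrB; apply: eq_bigr => i _; rewrite -sumrB; apply: eq_bigr => j _.
by rewrite -sumrB.
Qed.

End Labels.

(** * The degree of a map from the cube to S^3 *)

Section CubeDegree.
Context {R : realType}.
Implicit Types s : 'rV[R]_3.

(** Label 4 is a closed hemisphere. Labels 0 to 3 divide the opposite open hemisphere into regions
    that meet at its centre (0, 0, 0, -1), so a simplex carrying all four of them detects a preimage
    of that centre. *)
Definition color (z : 'rV[R]_4) : nat :=
  if 0 <= z 0 3 then 4 else if z 0 0 < 0 then 0
  else if z 0 1 < 0 then 1 else if z 0 2 < 0 then 2 else 3.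

Lemma color_lt5 z : (color z < 5)%N.
Proof. by rewrite /color; do 4!case: ifP => // _. Qed.

Lemma colorP z : [/\ color z = 4%N -> 0 <= z 0 3,
  color z = 0%N -> z 0 3 < 0 /\ z 0 0 < 0,
  color z = 1%N -> 0 <= z 0 0 /\ z 0 1 < 0,
  color z = 2%N -> 0 <= z 0 1 /\ z 0 2 < 0 &
  color z = 3%N -> 0 <= z 0 2].
Proof.
rewrite /color; case: ifPn => [z3|]; first by split.
rewrite -ltNge => z3; case: ifPn => [z0|]; first by split.
rewrite -leNgt => z0; case: ifPn => [z1|]; first by split.
rewrite -leNgt => z1; case: ifPn => [z2|]; first by split.
by rewrite -leNgt => z2; split.
Qed.

(* Five labels within a small set would force all four coordinates to be small. *)
Lemma color_missing (A : set 'rV[R]_4) :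
  (forall y, A y -> sphere R 3 y) ->
  (forall y z, A y -> A z -> `|y - z| < 1 / 2) ->
  exists2 v, (v < 5)%N & forall y, A y -> color y != v.
Proof.
move=> AS Ad; apply: contrapT => no.
have all_col v : (v < 5)%N -> exists2 y, A y & color y = v.
  move=> v5; apply: contrapT => nv; apply: no; exists v => // y Ay.
  by apply/eqP => yv; apply: nv; exists y.
have [y0 A0 c0] := all_col 0%N isT; have [y1 A1 c1] := all_col 1%N isT.
have [y2 A2 c2] := all_col 2%N isT; have [y3 A3 c3] := all_col 3%N isT.
have [y4 A4 c4] := all_col 4%N isT.
have co y z i : A y -> A z -> - (1 / 2) < y 0 i - z 0 i < 1 / 2.
  move=> Ay Az; have := le_lt_trans (rV_norm_coord (y - z) i) (Ad y z Ay Az).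
  by rewrite !mxE ltr_norml.
have [/(_ c4) k4 _ _ _ _] := colorP y4.
have [_ /(_ c0)[k03 k00] _ _ _] := colorP y0.
have [_ _ /(_ c1)[k10 k11] _ _] := colorP y1.
have [_ _ _ /(_ c2)[k21 k22] _] := colorP y2.
have [_ _ _ _ /(_ c3) k32] := colorP y3.
have /sphere4E S := AS y1 A1.
have sq (u : R) : - (1 / 2) < u -> u < 1 / 2 -> u ^+ 2 < 1 / 4 by move=> *; nra.
have s0 : y1 0 0 ^+ 2 < 1 / 4.
  by have /andP[] := co y1 y0 0 A1 A0; move=> *; apply: sq; lra.
have s1 : y1 0 1 ^+ 2 < 1 / 4.
  by have /andP[] := co y1 y2 1 A1 A2; move=> *; apply: sq; lra.
have s2 : y1 0 2 ^+ 2 < 1 / 4.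
  have /andP[? ?] := co y1 y2 2 A1 A2; have /andP[? ?] := co y1 y3 2 A1 A3.
  by apply: sq; lra.
have s3 : y1 0 3 ^+ 2 < 1 / 4.
  have /andP[? ?] := co y1 y0 3 A1 A0; have /andP[? ?] := co y1 y4 3 A1 A4.
  by apply: sq; lra.
by move: S s0 s1 s2 s3; clear; lra.
Qed.

Definition cube : set 'rV[R]_3 := [set s | forall i, 0 <= s 0 i <= 1].

Definition cube_bd s : Prop := exists i, s 0 i = 0 \/ s 0 i = 1.

Definition grid3 (n i j k : nat) : 'rV[R]_3 :=
  mk3 (i%:R / n%:R) (j%:R / n%:R) (k%:R / n%:R).

Definition cdeg n (w : 'rV[R]_3 -> 'rV[R]_4) : int :=
  total (fun i j k => color (w (grid3 n i j k))) n n n.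

Lemma compact_cube : compact (`[(0 : R), 1]%classic `*` cube).
Proof.
apply: compact_setX; first exact: segment_compact.
have := @rV_compact R 3 (fun=> `[(0 : R), 1]%classic) (fun=> @segment_compact R 0 1).
by congr compact.
Qed.

Lemma uniform_continuity {V W : normedModType R} (K : set V) (H : V -> W) e :
  compact K -> contin K H -> 0 < e -> exists2 n0, (0 < n0)%N &
  forall n, (n0 <= n)%N -> forall p p', K p -> K p' -> `|p' - p| <= n%:R^-1 ->
    `|H p' - H p| < e.
Proof.
move=> /compact_near_coveringP/near_covering_withinP cov cH e0.
have [|n0 [_ Hn0]] := cov R (pinfty_nbhs R) (fun C p => forall p', K p' ->
  `|p' - p| * C <= 1 -> `|H p' - H p| < e) _.
  move=> x Kx; have e2 : 0 < e / 2 by rewrite divr_gt0.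
  have /contin_nbhsP/(_ x Kx (ball (H x) (e / 2)) (nbhsx_ballx _ _ e2)) := cH.
  move=> /nbhs_ballP[r /= r0 xr].
  exists (ball x (r / 2), [set C | 2 / r < C]).
    split=> /=; first by apply: nbhsx_ballx; rewrite divr_gt0.
    by apply: nbhs_pinfty_gt; exact: num_real.
  move=> [y C] [/= xy rC] Ky y' Ky' yC.
  have xyr : ball x r y by apply: le_ball xy; rewrite ler_pdivrMr//; lra.
  have yy' : `|y' - y| < r / 2.
    have C0 : 0 < C by apply: lt_trans rC; rewrite divr_gt0.
    have : `|y' - y| <= C^-1 by rewrite -[leRHS]mul1r ler_pdivlMr.
    move/le_lt_trans; apply.
    by rewrite -[ltRHS]invrK ltf_pV2 ?posrE ?invr_gt0 ?divr_gt0// invf_div.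
  have xyr' : ball x r y'.
    rewrite (splitr r); apply: (@ball_triangle _ _ y) => //.
    by rewrite -ball_normE /ball_/= distrC.
  have h1 := xr _ xyr Ky; have h2 := xr _ xyr' Ky'.
  rewrite (splitr e); have := @ball_triangle _ _ (H x) (H y') (H y) _ _
    (ball_sym h2) h1.
  by rewrite -ball_normE.
exists (Num.truncn `|n0|).+1 => // n n0n p p' Kp Kp' pp'.
have n_gt : n0 < n%:R.
  apply: le_lt_trans (ler_norm _) _; apply: (@lt_le_trans _ _ (Num.truncn `|n0|).+1%:R).
    by have /andP[] := truncn_itv (normr_ge0 n0).
  by rewrite ler_nat.
have npos : 0 < n%:R :> R by rewrite ltr0n (leq_trans _ n0n).
apply: (Hn0 _ n_gt p Kp p' Kp').
by rewrite -ler_pdivlMr// mul1r.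
Qed.

(** The boundary may move with t as long as it stays collapsed to one point; this accommodates free
    homotopies of S^3, which move the image of the pole. *)
Lemma cdeg_homotopy (H : R * 'rV[R]_3 -> 'rV[R]_4) (g : R -> 'rV[R]_4) :
  contin (`[(0 : R), 1]%classic `*` cube) H ->
  (forall t s, 0 <= t -> t <= 1 -> cube s -> sphere R 3 (H (t, s))) ->
  (forall t s, 0 <= t -> t <= 1 -> cube s -> cube_bd s -> H (t, s) = g t) ->
  exists n0, forall n, (n0 <= n)%N ->
    cdeg n (fun s => H (0, s)) = cdeg n (fun s => H (1, s)).
Proof.
move=> cH SH bH.
have [|n0 n00 U] := uniform_continuity (e := 1 / 4) compact_cube cH.
  by rewrite divr_gt0.
exists n0 => n n0n; have n_gt0 : (0 < n)%N by exact: leq_trans n0n.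
have npos : 0 < n%:R :> R by rewrite ltr0n.
have unit (i : nat) : (i <= n)%N -> 0 <= (i%:R / n%:R : R) <= 1.
  move=> iln; rewrite ler_pdivrMr// mul1r ler_nat iln andbT.
  by rewrite divr_ge0.
have gK i j k : (i <= n)%N -> (j <= n)%N -> (k <= n)%N -> cube (grid3 n i j k).
  by move=> iln jn kn; apply: ord3_ind; rewrite mkE unit.
(* Truncating t at n makes the boundary conditions of [total_homotopy] true for all natural numbers
   t. *)
pose x t i j k := color (H ((minn t n)%:R / n%:R, grid3 n i j k)).
have tunit t : 0 <= ((minn t n)%:R / n%:R : R) <= 1 by exact/unit/geq_minr.
have bd t s : cube s -> cube_bd s -> color (H ((minn t n)%:R / n%:R, s)) =
    color (g ((minn t n)%:R / n%:R)).
  by move=> Ks bs; have /andP[? ?] := tunit t; rewrite bH.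
have n1 : n%:R / n%:R = 1 :> R by rewrite divff// gt_eqF.
have -> : cdeg n (fun s => H (0, s)) = total (x 0%N) n n n.
  by rewrite /x min0n mul0r.
have -> : cdeg n (fun s => H (1, s)) = total (x n) n n n.
  by rewrite /x minnn n1.
apply: (@total_homotopy n x (fun t => color (g ((minn t n)%:R / n%:R)))).
- move=> t i j k tn iln jn kn.
  pose A : set 'rV[R]_4 := [set y | exists a b c d, [/\ (a < 2)%N, (b < 2)%N,
    (c < 2)%N & (d < 2)%N] /\
    y = H ((minn (t + a) n)%:R / n%:R, grid3 n (i + b) (j + c) (k + d))].
  pose P a b c d := ((minn (t + a) n)%:R / n%:R : R,
    grid3 n (i + b)%N (j + c)%N (k + d)%N).
  have PK a b c d : (a < 2)%N -> (b < 2)%N -> (c < 2)%N -> (d < 2)%N ->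
      (`[(0 : R), 1]%classic `*` cube) (P a b c d).
    move=> a2 b2 c2 d2; split; first by rewrite /= in_itv/= tunit.
    by apply: gK; lia.
  have close (u v e : nat) : (u < 2)%N -> (v < 2)%N ->
      `|(e + u)%:R / n%:R - (e + v)%:R / n%:R| <= n%:R^-1 :> R.
    move=> u2 v2; rewrite -mulrBl normrM [X in _ * X]gtr0_norm ?invr_gt0//.
    apply: ler_piMl; [by rewrite invr_ge0 ltW|rewrite !natrD].
    have u1 : u%:R <= 1 :> R by rewrite lern1 -ltnS.
    have v1 : v%:R <= 1 :> R by rewrite lern1 -ltnS.
    have u0 : 0 <= u%:R :> R by [].
    have v0 : 0 <= v%:R :> R by [].
    by rewrite ler_norml; lra.
  have PP a b c d a' b' c' d' : (a < 2)%N -> (b < 2)%N -> (c < 2)%N -> (d < 2)%N ->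
      (a' < 2)%N -> (b' < 2)%N -> (c' < 2)%N -> (d' < 2)%N ->
      `|P a b c d - P a' b' c' d'| <= n%:R^-1.
    move=> a2 b2 c2 d2 a2' b2' c2' d2'.
    have mE u : (u < 2)%N -> minn (t + u) n = (t + u)%N by lia.
    rewrite prod_normE ge_max /= !mE// close//=.
    apply: rV_norm_le; first by rewrite invr_ge0 ltW.
    by apply: ord3_ind; rewrite !mxE/= close.
  have [y [a [b [c [d [[a2 b2 c2 d2] ->]]]]]||v v5 hv] := @color_missing A.
  + have [/= tI Ks] := PK a b c d a2 b2 c2 d2.
    by move: tI; rewrite in_itv/= => /andP[? ?]; exact: SH.
  + move=> y z [a [b [c [d [[a2 b2 c2 d2] ->]]]]].
    move=> [a' [b' [c' [d' [[a2' b2' c2' d2'] ->]]]]].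
    apply: lt_trans (_ : 1 / 4 < _); last by lra.
    apply: (U n n0n (P a' b' c' d') (P a b c d)); try exact: PK.
    exact: PP.
  exists v => // a b c d a2 b2 c2 d2; rewrite color_lt5 /=.
  by apply: hv; exists a, b, c, d.
- move=> t j k jn kn; split; apply: bd; try (by apply: gK).
    by exists 0; left; rewrite mkE mul0r.
  by exists 0; right; rewrite mkE n1.
- move=> t i k iln kn; split; apply: bd; try (by apply: gK).
    by exists 1; left; rewrite mkE mul0r.
  by exists 1; right; rewrite mkE n1.
- move=> t i j iln jn; split; apply: bd; try (by apply: gK).
    by exists 2; left; rewrite mkE mul0r.
  by exists 2; right; rewrite mkE n1.
Qed.

End CubeDegree.

(** * A map of degree 1 from the cube to S^3 *)

Section Collapse.
Context {R : realType}.
Implicit Types s : 'rV[R]_3.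

Definition bump s : R :=
  (1 - (2 * s 0 0 - 1) ^+ 2) * (1 - (2 * s 0 1 - 1) ^+ 2) *
  (1 - (2 * s 0 2 - 1) ^+ 2).

Definition radius2 s : R :=
  (2 * s 0 0 - 1) ^+ 2 + (2 * s 0 1 - 1) ^+ 2 + (2 * s 0 2 - 1) ^+ 2.

(* Inverse stereographic projection of (2 s - 1) / bump s, with denominators
   cleared; it collapses the boundary of the cube to a point. *)
Definition collapse s : 'rV[R]_4 :=
  let d := radius2 s + bump s ^+ 2 in
  mk4 (2 * bump s * (2 * s 0 0 - 1) / d) (2 * bump s * (2 * s 0 1 - 1) / d)
    (2 * bump s * (2 * s 0 2 - 1) / d) ((radius2 s - bump s ^+ 2) / d).

Definition pole : 'rV[R]_4 := mk4 0 0 0 1.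

Lemma sphere_pole : sphere R 3 pole.
Proof. by rewrite sphere4E !mkE; ring. Qed.

(** [radius2] vanishes only at the centre of the cube, where [bump] is 1. *)
Lemma collapse_den_gt0 s : 0 < radius2 s + bump s ^+ 2.
Proof.
have := sqr_ge0 (bump s); rewrite /radius2.
have := sqr_ge0 (2 * s 0 0 - 1); have := sqr_ge0 (2 * s 0 1 - 1).
have := sqr_ge0 (2 * s 0 2 - 1).
set a := (2 * s 0 0 - 1) ^+ 2; set b := (2 * s 0 1 - 1) ^+ 2.
set c := (2 * s 0 2 - 1) ^+ 2 => c0 b0 a0 m0.
rewrite lt_neqAle addr_ge0//; last by lra.
rewrite andbT; apply/eqP => E.
have [a00 b00 c00] : [/\ a = 0, b = 0 & c = 0] by split; lra.
by move: E; rewrite /bump -/a -/b -/c a00 b00 c00 !subr0 !mulr1 expr1n; lra.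
Qed.

Lemma sphere_collapse s : sphere R 3 (collapse s).
Proof.
rewrite sphere4E /collapse !mkE; have d0 := collapse_den_gt0 s.
have r2 : radius2 s = (2 * s 0 0 - 1) ^+ 2 + (2 * s 0 1 - 1) ^+ 2 +
  (2 * s 0 2 - 1) ^+ 2 by [].
move: (bump s) d0 => m; move: (radius2 s) r2 => r.
move: (2 * s 0 0 - 1) (2 * s 0 1 - 1) (2 * s 0 2 - 1) => a b c r2 d0.
transitivity ((4 * m ^+ 2 * (a ^+ 2 + b ^+ 2 + c ^+ 2) + (r - m ^+ 2) ^+ 2) /
    (r + m ^+ 2) ^+ 2).
  by field; rewrite gt_eqF.
rewrite -r2; have -> : 4 * m ^+ 2 * r + (r - m ^+ 2) ^+ 2 = (r + m ^+ 2) ^+ 2.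
  by ring.
by rewrite divff// expf_neq0// gt_eqF.
Qed.

Lemma collapse_bd s : cube_bd s -> collapse s = pole.
Proof.
move=> [i si]; have b0 : bump s = 0.
  by rewrite /bump; move: i si; apply: ord3_ind => -[] ->; ring.
have d0 := collapse_den_gt0 s; rewrite b0 expr0n addr0 in d0.
by rewrite /collapse b0 expr0n /= addr0 subr0 !mulr0 !mul0r divff// gt_eqF.
Qed.

Lemma contin_collapse (A : set 'rV[R]_3) : contin A collapse.
Proof.
have cc i : contin A (fun s => 2 * s 0 i - 1) by contin_arith.
have cb : contin A bump by apply: continM; [apply: continM|]; contin_arith.
have cr : contin A radius2 by contin_arith.
have cd : contin A (fun s => (radius2 s + bump s ^+ 2)^-1).
  apply: continV; last by contin_arith.
  by move=> s _; rewrite gt_eqF// collapse_den_gt0.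
by contin_arith.
Qed.

Definition corner_label (a b c : bool) : nat :=
  if a then 0 else if b then 1 else if c then 2 else 3.

(** Off label 4 the factor [bump] is positive, so the first three coordinates have the signs of i -
    M, j - M and k - M. The even mesh makes the centre of the cube a grid point. *)
Lemma color_collapse M i j k : (0 < M)%N -> (i <= 2 * M)%N -> (j <= 2 * M)%N ->
  (k <= 2 * M)%N -> color (collapse (grid3 (2 * M) i j k)) <> 4%N ->
  color (collapse (grid3 (2 * M) i j k)) = corner_label (i < M)%N (j < M)%N (k < M)%N.
Proof.
move=> M0 iM jM kM; set s := grid3 _ _ _ _.
have d0 := collapse_den_gt0 s.
have M0' : 0 < M%:R :> R by rewrite ltr0n.
have cE (u : nat) : 2 * (u%:R / (2 * M)%:R) - 1 = (u%:R - M%:R) / M%:R :> R.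
  by rewrite natrM; field; rewrite gt_eqF.
have c1 (u : nat) : (u <= 2 * M)%N -> ((u%:R - M%:R) / M%:R) ^+ 2 <= 1 :> R.
  rewrite -(ler_nat R) natrM => u2; have u0 : 0 <= u%:R :> R by [].
  rewrite expr_div_n ler_pdivrMr ?exprn_gt0// mul1r -subr_ge0.
  have -> : M%:R ^+ 2 - (u%:R - M%:R) ^+ 2 = u%:R * (2 * M%:R - u%:R) :> R by ring.
  by rewrite mulr_ge0// subr_ge0.
have b0 : 0 <= bump s.
  by rewrite /bump !mkE !cE; do 2?apply: mulr_ge0; rewrite subr_ge0 c1.
rewrite /color /collapse !mkE.
have [r0|r0] := lerP 0 ((radius2 s - bump s ^+ 2) / _); first by [].
have bpos : 0 < bump s.
  rewrite lt_neqAle b0 andbT; apply/eqP => E; move: r0.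
  rewrite -E expr0n subr0 addr0 ltNge => /negP; apply.
  have r2 : 0 <= radius2 s by rewrite /radius2 !addr_ge0// sqr_ge0.
  by rewrite divr_ge0.
have sgn (u : nat) : (2 * bump s * ((u%:R - M%:R) / M%:R) /
    (radius2 s + bump s ^+ 2) < 0) = (u < M)%N.
  have b2 : 0 < 2 * bump s by rewrite mulr_gt0.
  have di : 0 < (radius2 s + bump s ^+ 2)^-1 by rewrite invr_gt0.
  have Mi : 0 < M%:R^-1 :> R by rewrite invr_gt0.
  by rewrite (pmulr_llt0 _ di) (pmulr_rlt0 _ b2) (pmulr_llt0 _ Mi) subr_lt0 ltr_nat.
by move=> _; rewrite !cE !sgn.
Qed.

(** Each (2 s_i - 1)^2 is at most 1/16 for M >= 4, so [radius2] <= 3/16, while [bump] >= (15/16)^3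
    >= 3/4 has square at least 9/16. *)
Lemma color_collapse_center M i j k : (4 <= M)%N ->
  (i == M.-1) || (i == M) -> (j == M.-1) || (j == M) -> (k == M.-1) || (k == M) ->
  color (collapse (grid3 (2 * M) i j k)) <> 4%N.
Proof.
move=> M4 iM jM kM; have M0 : (0 < M)%N by exact: leq_trans M4.
have M0' : 4 <= M%:R :> R by rewrite (ler_nat R 4).
have cE (u : nat) : (u == M.-1) || (u == M) ->
    (2 * (u%:R / (2 * M)%:R) - 1) ^+ 2 <= 1 / 16 :> R.
  move=> uM; have -> : 2 * (u%:R / (2 * M)%:R) - 1 = (u%:R - M%:R) / M%:R :> R.
    by rewrite natrM; field; rewrite gt_eqF//; lra.
  have uM1 : (u%:R - M%:R) ^+ 2 <= 1 :> R.
    case/orP: uM => /eqP ->; last by rewrite subrr expr0n.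
    by rewrite -[in X in _ - X](prednK M0) -natr1 opprD addrA subrr sub0r sqrrN expr1n.
  rewrite expr_div_n ler_pdivrMr ?exprn_gt0//; last by lra.
  by nra.
have ge0 (u : nat) : 0 <= (2 * (u%:R / (2 * M)%:R) - 1) ^+ 2 :> R by exact: sqr_ge0.
set s := grid3 _ _ _ _; have d0 := collapse_den_gt0 s.
suff : radius2 s - bump s ^+ 2 < 0.
  move=> neg; rewrite /color /collapse !mkE.
  by rewrite pmulr_lge0 ?invr_gt0// leNgt neg /=; do 3!case: ifP => // _.
rewrite /radius2 /bump !mkE.
move: (cE i iM) (ge0 i) (cE j jM) (ge0 j) (cE k kM) (ge0 k).
set a := (_ - 1) ^+ 2; set b := (2 * (j%:R / _) - 1) ^+ 2.
set c := (2 * (k%:R / _) - 1) ^+ 2 => a1 a0 b1 b0 c1 c0.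
have p1 : 225 / 256 <= (1 - a) * (1 - b).
  have : (15 / 16) * (15 / 16) <= (1 - a) * (1 - b) by apply: ler_pM; lra.
  by lra.
have p2 : 3 / 4 <= (1 - a) * (1 - b) * (1 - c).
  have : (225 / 256) * (15 / 16) <= (1 - a) * (1 - b) * (1 - c).
    by apply: ler_pM => //; lra.
  by lra.
have p3 : (3 / 4) * (3 / 4) <= ((1 - a) * (1 - b) * (1 - c)) ^+ 2.
  by rewrite expr2; apply: ler_pM => //; lra.
by lra.
Qed.

(** Only the small cube from (M-1, M-1, M-1) to (M, M, M) meets all four regions 0 to 3; any other
    one lies on one side of a plane that separates two of them and so misses a label. *)
Lemma cdeg_collapse M : (4 <= M)%N -> cdeg (2 * M) collapse = 1.
Proof.
move=> M4; have M0 : (0 < M)%N by exact: leq_trans M4.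
rewrite /cdeg /total; set f := fun i j k => color _.
have f5 i j k : (f i j k < 5)%N by exact: color_lt5.
have fE i j k : (i <= 2 * M)%N -> (j <= 2 * M)%N -> (k <= 2 * M)%N ->
    f i j k = 4%N \/ f i j k = corner_label (i < M)%N (j < M)%N (k < M)%N.
  move=> iM jM kM; have [->|/eqP ne] := eqVneq (f i j k) 4%N; first by left.
  by right; exact: color_collapse.
have zero i j k : (i < 2 * M)%N -> (j < 2 * M)%N -> (k < 2 * M)%N ->
    (i != M.-1) || (j != M.-1) || (k != M.-1) -> kuhn f i j k = 0.
  move=> iM jM kM ne.
  have miss v : (v < 4)%N -> (forall a b c, (a < 2)%N -> (b < 2)%N -> (c < 2)%N ->
      corner_label (i + a < M)%N (j + b < M)%N (k + c < M)%N != v) ->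
      kuhn f i j k = 0.
    move=> v4 h; apply: (kuhn_missing v4) => a b c a2 b2 c2; rewrite f5 /=.
    have [||| -> | ->] := fE (i + a)%N (j + b)%N (k + c)%N; try lia.
    by rewrite h.
  have [iM'|iM'|iE] := ltngtP i M.-1.
  - apply: (miss 1%N) => // a b c a2 b2 c2; rewrite /corner_label.
    by rewrite (_ : (i + a < M)%N); last lia.
  - apply: (miss 0%N) => // a b c a2 b2 c2; rewrite /corner_label.
    rewrite (_ : (i + a < M)%N = false); last lia.
    by case: ifP => // _; case: ifP.
  have [jM'|jM'|jE] := ltngtP j M.-1.
  - apply: (miss 2%N) => // a b c a2 b2 c2; rewrite /corner_label.
    rewrite (_ : (j + b < M)%N); last lia.
    by case: ifP.
  - apply: (miss 1%N) => // a b c a2 b2 c2; rewrite /corner_label.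
    rewrite (_ : (j + b < M)%N = false); last lia.
    by case: ifP => // _; case: ifP.
  have [kM'|kM'|kE] := ltngtP k M.-1.
  - apply: (miss 3%N) => // a b c a2 b2 c2; rewrite /corner_label.
    rewrite (_ : (k + c < M)%N); last lia.
    by case: ifP => // _; case: ifP.
  - apply: (miss 2%N) => // a b c a2 b2 c2; rewrite /corner_label.
    rewrite (_ : (k + c < M)%N = false); last lia.
    by case: ifP => // _; case: ifP.
  by move: ne; rewrite iE jE kE eqxx.
have center : kuhn f M.-1 M.-1 M.-1 = 1.
  have fc (a b c : bool) : f (M.-1 + a)%N (M.-1 + b)%N (M.-1 + c)%N =
      corner_label (~~ a) (~~ b) (~~ c).
    have [||| f4 | ->] := fE (M.-1 + a)%N (M.-1 + b)%N (M.-1 + c)%N;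
      try by case: a b c => [] [] []; lia.
      exfalso; move: f4; apply: color_collapse_center => //.
      - by case: a; rewrite ?addn0 ?addn1 ?prednK ?eqxx ?orbT.
      - by case: b; rewrite ?addn0 ?addn1 ?prednK ?eqxx ?orbT.
      - by case: c; rewrite ?addn0 ?addn1 ?prednK ?eqxx ?orbT.
    by congr corner_label; [case: a|case: b|case: c]; lia.
  (* With explicit labels the count is a computation: only the path in the order i, j, k carries
     four distinct labels, namely 0, 1, 2, 3. *)
  rewrite (@eq_kuhn _ (fun a b c => corner_label (a == 0)%N (b == 0)%N (c == 0)%N)
    _ _ _ 0 0 0)//.
  move=> [|[|//]] [|[|//]] [|[|//]] _ _ _;
  [exact: (fc false false false)|exact: (fc false false true)|
   exact: (fc false true false)|exact: (fc false true true)|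
   exact: (fc true false false)|exact: (fc true false true)|
   exact: (fc true true false)|exact: (fc true true true)].
have M1 : (M.-1 < 2 * M)%N by lia.
have one (F : nat -> int) : (forall i, (i < 2 * M)%N -> i != M.-1 -> F i = 0) ->
    \sum_(0 <= i < 2 * M) F i = F M.-1.
  move=> h; rewrite big_mkord (bigD1 (Ordinal M1))//= big1 ?addr0// => i ne.
  by apply: h => //; exact: ne.
rewrite one => [|i iM ne].
  rewrite one => [|j jM ne].
    rewrite one => [|k kM ne]; first exact: center.
    by apply: zero => //; rewrite ne !orbT.
  by apply: sum_nat_eq0 => k kM; apply: zero => //; rewrite ne orbT.
apply: sum_nat_eq0 => j jM; apply: sum_nat_eq0 => k kM.
by apply: zero => //; rewrite ne.
Qed.

End Collapse.

(** * The degree of a power *)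

Section Stack.
Context {R : realType}.
Implicit Types s : 'rV[R]_3.

(** Truncation to [0, 1], written with tests 0 <= h to suit [contin_glue]. *)
Definition clamp (u : R) : R :=
  if 0 <= u then (if 0 <= 1 - u then u else 1) else 0.

Lemma clamp_itv u : 0 <= clamp u <= 1.
Proof.
rewrite /clamp; case: ifP => [u0|_]; last by rewrite lexx ler01.
by case: ifP => [u1|_]; [rewrite u0 -subr_ge0|rewrite ler01 lexx].
Qed.

Lemma clamp_le0 u : u <= 0 -> clamp u = 0.
Proof.
rewrite /clamp; case: ifP => // u0 u0'; have -> : u = 0 by lra.
by rewrite subr0 ler01.
Qed.

Lemma clamp_ge1 u : 1 <= u -> clamp u = 1.
Proof.
move=> u1; rewrite /clamp ifT; last by lra.
by case: ifP => // h; lra.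
Qed.

Lemma clamp_id u : 0 <= u -> u <= 1 -> clamp u = u.
Proof. by move=> u0 u1; rewrite /clamp u0 subr_ge0 u1. Qed.

Lemma contin_clamp {T : topologicalType} (A : set T) (f : T -> R) :
  contin A f -> contin A (fun x => clamp (f x)).
Proof.
move=> cf; apply: (contin_comp (B := setT)) cf _ => //.
apply: contin_glue; [exact: contin_id| |exact: contin_cst|].
  apply: contin_glue; [|exact: contin_id|exact: contin_cst|].
    by apply: continD; [exact: contin_cst|exact/continN/contin_id].
  by move=> u _ u1; lra.
by move=> u _ ->; rewrite subr0 ler01.
Qed.

Definition qprod (F : nat -> 'rV[R]_4) (b : nat) : 'rV[R]_4 :=
  \big[qmul/base3]_(0 <= r < b) F r.

Lemma qprodS F b : qprod F b.+1 = qmul (qprod F b) (F b).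
Proof.
rewrite /qprod.
have qA : associative (@qmul R) by move=> x y z; exact: qmulA.
pose L : Monoid.law (@base3 R) := HB.pack (@qmul R)
  (Monoid.isLaw.Build _ base3 (@qmul R) qA (@q1mul R) (@qmul1 R)).
exact: (@big_nat_recr _ base3 L).
Qed.

Lemma qprod0 F : qprod F 0 = base3.
Proof. by rewrite /qprod big_geq. Qed.

Lemma eq_qprod F G b : (forall r, (r < b)%N -> F r = G r) -> qprod F b = qprod G b.
Proof. by move=> FG; apply: eq_big_nat => r /andP[_ rb]; exact: FG. Qed.

Lemma qprod_cst x b : qprod (fun=> x) b = qexp b x.
Proof.
by elim: b => [|b ih]; rewrite ?qprod0// qprodS ih qexpSr.
Qed.

Lemma qprod_base3 b : qprod (fun=> base3) b = base3.
Proof. by rewrite qprod_cst qexp1n. Qed.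

Lemma qprod_single F b r : (r < b)%N ->
  (forall r', (r' < b)%N -> r' != r -> F r' = base3) -> qprod F b = F r.
Proof.
elim: b r => // b ih r rb F1; rewrite qprodS.
have [rE|rnb] := eqVneq r b; first rewrite rE in F1 *.
  rewrite (@eq_qprod _ (fun=> base3)) ?qprod_base3 ?q1mul// => r' r'b.
  by apply: F1; [exact: ltnW|rewrite (ltn_eqF r'b)].
rewrite (ih r) => [||r' r'b r'r]; last 2 first.
- by rewrite ltn_neqAle rnb -ltnS.
- by apply: F1 => //; exact: ltnW.
by rewrite (F1 b) ?qmul1// eq_sym.
Qed.

Lemma sphere_qprod F b :
  (forall r, sphere R 3 (F r)) -> sphere R 3 (qprod F b).
Proof.
move=> SF; elim: b => [|b ih]; rewrite ?qprod0 ?qprodS; first exact: sphere_base3.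
exact: sphere_qmul.
Qed.

Lemma contin_qprod {T : topologicalType} (A : set T) (F : nat -> T -> 'rV[R]_4) b :
  (forall r, contin A (F r)) -> contin A (fun x => qprod (F^~ x) b).
Proof.
move=> cF; elim: b => [|b ih].
  by apply: contin_eq (contin_cst A base3) => x _; rewrite qprod0.
by apply: contin_eq (contin_qmul ih (cF b)) => x _; rewrite qprodS.
Qed.

(* [stack w b 1] runs [w] on each of the [b] slabs of the cube, and
   [stack w b 0] is the power of [w]. *)
Definition stack (w : 'rV[R]_3 -> 'rV[R]_4) (b : nat) (p : R * 'rV[R]_3) :=
  qprod (fun r => w (mk3 ((1 - p.1) * p.2 0 0 + p.1 * clamp (b%:R * p.2 0 0 - r%:R))
    (p.2 0 1) (p.2 0 2))) b.

Lemma stack0 w b s : stack w b (0, s) = qexp b (w s).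
Proof.
rewrite /stack -qprod_cst; apply: eq_qprod => r _ /=.
by rewrite subr0 mul1r mul0r addr0 -mk3_eta.
Qed.

Section StackHomotopy.
Context (w : 'rV[R]_3 -> 'rV[R]_4) (b : nat) (cw : contin cube w)
  (Sw : forall s, cube s -> sphere R 3 (w s))
  (w1 : forall s, cube s -> cube_bd s -> w s = base3).

Let cube_stack r t s : 0 <= t -> t <= 1 -> cube s ->
  cube (mk3 ((1 - t) * s 0 0 + t * clamp (b%:R * s 0 0 - r%:R)) (s 0 1) (s 0 2)).
Proof.
move=> t0 t1 Ks; apply: ord3_ind; rewrite mkE //.
have /andP[s0 s1] := Ks 0; have /andP[c0 c1] := clamp_itv (b%:R * s 0 0 - r%:R).
by apply/andP; split; nra.
Qed.

Lemma contin_stack : contin (`[(0 : R), 1]%classic `*` cube) (stack w b).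
Proof.
apply: (@contin_qprod _ _ (fun r (p : R * 'rV[R]_3) => w (mk3 ((1 - p.1) * p.2 0 0 +
  p.1 * clamp (b%:R * p.2 0 0 - r%:R)) (p.2 0 1) (p.2 0 2)))) => r.
set A := _ `*` _.
have c1 : contin A (fun p : R * 'rV[R]_3 => p.1) by exact/contin_fst/contin_id.
have c2 : contin A (fun p : R * 'rV[R]_3 => p.2) by exact/contin_snd/contin_id.
have c20 : contin A (fun p : R * 'rV[R]_3 => p.2 0 0) by exact: contin_coord.
apply: (contin_comp (B := cube)) cw.
  move=> [t s] [/= tI Ks]; move: tI; rewrite in_itv/= => /andP[t0 t1].
  exact: cube_stack.
apply: contin_mk3; try exact: contin_coord.
apply: continD; apply: continM => //.
  by apply: continD; [exact: contin_cst|exact: continN].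
apply: contin_clamp; apply: continD; last exact: contin_cst.
by apply: continM => //; exact: contin_cst.
Qed.

Lemma sphere_stack t s : 0 <= t -> t <= 1 -> cube s -> sphere R 3 (stack w b (t, s)).
Proof. by move=> t0 t1 Ks; apply: sphere_qprod => r; apply: Sw; exact: cube_stack. Qed.

Lemma stack_bd t s : 0 <= t -> t <= 1 -> cube s -> cube_bd s ->
  stack w b (t, s) = base3.
Proof.
move=> t0 t1 Ks bs; rewrite -(qprod_base3 b); apply: eq_qprod => r rb /=.
apply: w1; first exact: cube_stack.
case: bs => i; move: i; apply: ord3_ind => s01.
- exists 0; rewrite mkE; case: s01 => ->; [left|right].
    by rewrite clamp_le0; [ring|rewrite mulr0 sub0r oppr_le0].
  rewrite clamp_ge1; first by ring.
  have : r.+1%:R <= b%:R :> R by rewrite ler_nat.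
  by rewrite -natr1; lra.
- by exists 1; rewrite mkE.
- by exists 2; rewrite mkE.
Qed.

Lemma cdeg_stack : exists n0, forall n, (n0 <= n)%N ->
  cdeg n (fun s => qexp b (w s)) = cdeg n (fun s => stack w b (1, s)).
Proof.
have [n0 h] := cdeg_homotopy (g := fun=> base3) contin_stack sphere_stack stack_bd.
exists n0 => n /h <-; congr cdeg; apply/funext => s.
by rewrite stack0.
Qed.

(** On the r-th slab every other factor has its first coordinate clamped to 0 or 1, hence is
    evaluated on a face of the cube, where w is [base3]. *)
Lemma stack_slab n r i j k : (0 < n)%N -> (r < b)%N -> (i <= n)%N ->
  (j <= b * n)%N -> (k <= b * n)%N ->
  stack w b (1, grid3 (b * n) (r * n + i) j k) =
  w (mk3 (i%:R / n%:R) (j%:R / (b * n)%:R) (k%:R / (b * n)%:R)).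
Proof.
move=> n0 rb iln jn kn; have b0 : (0 < b)%N by exact: leq_ltn_trans rb.
have nR : 0 < n%:R :> R by rewrite ltr0n.
have bR : 0 < b%:R :> R by rewrite ltr0n.
have bnR : 0 < (b * n)%:R :> R by rewrite ltr0n muln_gt0 b0.
have uE (r' : nat) : b%:R * ((r * n + i)%:R / (b * n)%:R) - r'%:R =
    r%:R - r'%:R + i%:R / n%:R :> R.
  by rewrite natrD !natrM; field; rewrite !gt_eqF.
have unit (u m : nat) : (0 < m)%N -> (u <= m)%N -> 0 <= (u%:R / m%:R : R) <= 1.
  move=> m0 um; rewrite ler_pdivrMr ?ltr0n// mul1r ler_nat um andbT.
  by rewrite divr_ge0.
have bn0 : (0 < b * n)%N by rewrite muln_gt0 b0.
have /andP[i0 i1] := unit i n n0 iln.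
rewrite /stack (qprod_single rb) /=.
  by rewrite !mkE uE !subrr mul0r !add0r mul1r clamp_id.
move=> r' r'b ne; rewrite !mkE uE subrr mul0r mul1r add0r; apply: w1.
  apply: ord3_ind; rewrite mkE; first exact: clamp_itv.
    exact: unit.
  exact: unit.
exists 0; rewrite mkE; case: (ltngtP r' r) ne => // r'r _; [right|left].
  apply: clamp_ge1; have : r'.+1%:R <= r%:R :> R by rewrite ler_nat.
  by rewrite -natr1; lra.
apply: clamp_le0; have : r.+1%:R <= r'%:R :> R by rewrite ler_nat.
by rewrite -natr1; lra.
Qed.

(** With b n subdivisions the walls between slabs lie on the grid, and all b slabs carry the same
    labels [L], so each contributes the same count. *)
Lemma cdeg_stack_dvd n : (0 < n)%N -> exists m : int,
  cdeg (b * n) (fun s => stack w b (1, s)) = b%:Z * m.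
Proof.
move=> n0; pose L i j k := color (w (mk3 (i%:R / n%:R) (j%:R / (b * n)%:R)
  (k%:R / (b * n)%:R))).
exists (total L n (b * n) (b * n)); rewrite /cdeg /total.
set f := fun i j k => color _; pose S (g : nat -> nat -> nat -> nat) i :=
  \sum_(0 <= j < b * n) \sum_(0 <= k < b * n) kuhn g i j k.
have SE r i : (r < b)%N -> (i < n)%N -> S f (r * n + i)%N = S L i.
  move=> rb iln; apply: eq_big_nat => j /andP[_ jn].
  apply: eq_big_nat => k /andP[_ kn]; apply: eq_kuhn => a c d a2 c2 d2.
  by rewrite /f /L -addnA stack_slab//; lia.
have blocks m : (m <= b)%N ->
    \sum_(0 <= i < m * n) S f i = m%:Z * \sum_(0 <= i < n) S L i.
  elim: m => [|m ih] mb; first by rewrite mul0n big_geq// mul0r.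
  rewrite mulSn addnC (@big_cat_nat _ _ _ (m * n))//=; last exact: leq_addr.
  rewrite ih; last exact: ltnW.
  have -> : \sum_(m * n <= i < m * n + n) S f i = \sum_(0 <= i < n) S L i.
    rewrite -{1}[(m * n)%N]add0n big_addn addKn; apply: eq_big_nat => i /andP[_ iln].
    by rewrite addnC SE.
  by rewrite -addn1 PoszD mulrDl mul1r.
exact: blocks.
Qed.

End StackHomotopy.

(* The identity has degree 1, a [b]-th power has degree divisible by [b]. *)
Lemma id_not_qexp (v : 'rV[R]_4 -> 'rV[R]_4) b : (1 < b)%N ->
  contin (sphere R 3) v -> set_fun (sphere R 3) (sphere R 3) v ->
  ~ homotopic (sphere R 3) (sphere R 3) id (fun x => qexp b (v x)).
Proof.
move=> b1 cv Sv hv; have b0 : (0 < b)%N by exact: ltnW.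
(* Left translation moves the image of the pole to the unit, as stacking requires on the boundary;
   it is homotopic to the identity because S^3 is connected. *)
pose v' x := qmul (qconj (v pole)) (v x).
have vv' : homotopic (sphere R 3) (sphere R 3) v v'.
  have := homotopic_qmul (homotopic_sphere_cst (sphere R 3) sphere_base3
    (sphere_qconj (Sv _ sphere_pole))) (homotopic_refl cv Sv).
  by under eq_fun do rewrite q1mul.
have v'p : v' pole = base3 by rewrite /v' qmulVq//; exact/Sv/sphere_pole.
pose w s := v' (collapse s).
have [H [/continP cH HS H0 H1]] := homotopic_trans hv (homotopic_qexp b vv').
have HS' t s : 0 <= t -> t <= 1 -> sphere R 3 (H (t, collapse s)).
  move=> t0 t1; apply: HS; split=> /=; last exact: sphere_collapse.
  by rewrite in_itv/= t0.
have [|||n1 h1] := @cdeg_homotopy R (fun p => H (p.1, collapse p.2))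
    (fun t => H (t, pole)).
- apply: contin_comp cH; first by move=> [t s] [/= tI Ks]; split => //=;
    exact: sphere_collapse.
  apply: contin_pair; first exact/contin_fst/contin_id.
  apply: (contin_comp (B := setT)); [by []|exact/contin_snd/contin_id|].
  exact: contin_collapse.
- by move=> t s t0 t1 _; exact: HS'.
- by move=> t s t0 t1 _ bs /=; rewrite collapse_bd.
have cw : contin cube w.
  apply: (contin_comp (B := sphere R 3)); last exact: homotopic_contin_r vv'.
    by move=> s _; exact: sphere_collapse.
  exact: contin_collapse.
have Sw s : cube s -> sphere R 3 (w s).
  by move=> _; apply: (homotopic_fun_r vv'); exact: sphere_collapse.
have w1 s : cube s -> cube_bd s -> w s = base3.
  by move=> _ bs; rewrite /w collapse_bd.
have [n2 h2] := cdeg_stack b cw Sw w1.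
(* A mesh fine enough for both homotopies, with n a multiple of b for the slabs and twice a number
   that is at least 4 for [cdeg_collapse]. *)
pose N := (n1 + n2 + 4)%N; pose n := (b * (2 * N))%N.
have nN : (N <= n)%N by rewrite /n; nia.
have e1 := h1 n (leq_trans (leq_trans (leq_addr _ _) (leq_addr 4 _)) nN).
have e2 := h2 n (leq_trans (leq_trans (leq_addl n1 _) (leq_addr 4 _)) nN).
have N0 : (0 < 2 * N)%N by rewrite /N; lia.
have [m e3] := cdeg_stack_dvd b w1 N0.
have bN : (4 <= b * N)%N by rewrite /N; nia.
have := @cdeg_collapse R _ bN.
have -> : (2 * (b * N))%N = n by rewrite /n; lia.
have -> : cdeg n (@collapse R) = cdeg n (fun s => H (0, collapse s)).
  by congr (cdeg n _); apply/funext => s; rewrite H0//; exact: sphere_collapse.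
rewrite e1.
have -> : cdeg n (fun s => H (1, collapse s)) = cdeg n (fun s => qexp b (w s)).
  by congr (cdeg n _); apply/funext => s; rewrite H1//; exact: sphere_collapse.
rewrite e2 e3 => /(congr1 absz)/eqP; rewrite abszM /= muln_eq1 => /andP[/eqP bE _].
by rewrite bE in b1.
Qed.

End Stack.

(** * Classes not represented by f o T1 *)

Section Diffeomorphisms.
Context {R : realType}.

Lemma smooth_contin {V W : normedModType R} (A : set V) (f : V -> W) :
  smooth A f -> contin A f.
Proof.
move=> sf; apply/contin_nbhsP => x Ax S.
have [F [U [oU Ux CF FE]]] := sf x Ax.
rewrite -FE// => nS; have cF := CF 0%N x Ux.
apply: filterS2 (open_nbhs_nbhs (conj oU Ux)) (cF _ nS) => y Uy /= SF Ay.
by rewrite -FE.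
Qed.

Lemma homotopic_snd {U V W : normedModType R} (A : set U) (B : set V) (C : set W)
    (f g : U -> V * W) :
  homotopic A (B `*` C) f g -> homotopic A C (fun x => (f x).2) (fun x => (g x).2).
Proof.
apply: (homotopic_compl (g := snd)); first exact/contin_snd/contin_id.
by move=> [y x] [].
Qed.

(* Writing k for the second component of f and (u, v) for f^-1 o T1, the
   identity k(u, v) of S^3 is split along the pinch map into the product of
   k(u, pt), which factors through S^2, and k(pt, v), which is a power of v. *)
Lemma not_htpic_to_diffeo (a c : int) (b : nat) g :
  (1 < b)%N -> c = b%:Z \/ c = - b%:Z -> htpy_class R a c g ->
  ~ htpic_to_diffeo_T1 g.
Proof.
move=> b1 cb /htpy_classP clg [f [fM sf [h [hM sh hK fK]]] gf].
have cf := smooth_contin sf; have ch := smooth_contin sh.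
pose k p := (f p).2; pose u x := (h (T1 x)).1; pose v x := (h (T1 x)).2.
have S1 := @sphere_base3 R; have S2 := @sphere_base2 R.
have T1M x : sphere R 3 x -> S2xS3 R (T1 x) by [].
have cT1 : contin (sphere R 3) T1.
  by apply: contin_pair; [exact: contin_cst|exact: contin_id].
have chT : contin (sphere R 3) (fun x => h (T1 x)).
  by apply: (contin_comp (B := S2xS3 R)).
have cu : contin (sphere R 3) u by exact: contin_fst.
have cv : contin (sphere R 3) v by exact: contin_snd.
have Su x : sphere R 3 x -> sphere R 2 (u x) by move=> Sx; have [] := hM _ (T1M x Sx).
have Sv x : sphere R 3 x -> sphere R 3 (v x) by move=> Sx; have [] := hM _ (T1M x Sx).
have ck : contin (S2xS3 R) k by exact: contin_snd.
have Sk p : S2xS3 R p -> sphere R 3 (k p) by move=> Mp; have [] := fM p Mp.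
have homk (A : set 'rV[R]_4) p p' : homotopic A (S2xS3 R) p p' ->
    homotopic A (sphere R 3) (fun x => k (p x)) (fun x => k (p' x)).
  exact: homotopic_compl.
have kT : homotopic (sphere R 3) (sphere R 3) (fun x => k (T1 x)) (qpow c).
  exact: homotopic_sym (homotopic_snd (homotopic_trans clg gf)).
have ru := homotopic_refl cu Su; have rv := homotopic_refl cv Sv.
have hu : homotopic (sphere R 3) (sphere R 2) u (fun x => u (pinchl x)).
  exact: (homotopic_comp (homotopic_sym homotopic_pinchl) ru).
have hv : homotopic (sphere R 3) (sphere R 3) (fun x => v (pinchr x)) v.
  exact: (homotopic_comp homotopic_pinchr rv).
pose c0 := k (u base3, v base3).
have Sc0 : sphere R 3 c0 by apply: Sk; split; [exact: Su|exact: Sv].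
(* At each x one of the two outer factors equals c0, and the middle factor cancels it. *)
have step1 : homotopic (sphere R 3) (sphere R 3) id
    (fun x => qmul (qmul (k (u (pinchl x), v base3)) (qconj c0))
      (k (u base3, v (pinchr x)))).
  apply: (@homotopic_trans _ _ _ _ _ _ (fun x => k (u x, v x))).
    apply: homotopic_eq => //; first exact: contin_id.
    by move=> x Sx; rewrite /k /u /v -surjective_pairing fK//; exact: T1M.
  have := homk _ _ _ (homotopic_pair hu (homotopic_sym hv)).
  congr (homotopic _ _ _ _); apply/funext => x; rewrite /pinchl /pinchr.
  case: ifP => _; last by rewrite qmulqV// q1mul.
  by rewrite -qmulA qmulVq// qmul1.
(* The point where smoothness of f is used, beyond its continuity. *)
have [z Sz kz] := smooth_sphere_not_onto (smooth_slice sf (Sv _ S1)).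
have cup : contin (sphere R 3) (fun x => u (pinchl x)) by exact: homotopic_contin_r hu.
have Sup x : sphere R 3 x -> sphere R 2 (u (pinchl x)).
  by move=> Sx; exact/Su/sphere_pinchl.
have null : homotopic (sphere R 3) (sphere R 3)
    (fun x => k (u (pinchl x), v base3)) (fun=> c0).
  apply: homotopic_trans (homotopic_sphere_cst _ (sphereN Sz) Sc0).
  apply: homotopic_sphere.
  - apply: (contin_comp (B := S2xS3 R)) ck.
      by move=> x Sx; split; [exact: Sup|exact: Sv].
    by apply: contin_pair => //; exact: contin_cst.
  - exact: contin_cst.
  - by move=> x Sx; apply: Sk; split; [exact: Sup|exact: Sv].
  - by move=> x _; exact: sphereN.
  - by move=> x Sx; rewrite opprK; apply: kz; exact: Sup.
have step2 : homotopic (sphere R 3) (sphere R 3) id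
    (fun x => k (u base3, v (pinchr x))).
  apply: homotopic_trans step1 _.
  have rc : homotopic (sphere R 3) (sphere R 3) (fun=> qconj c0) (fun=> qconj c0).
    apply: homotopic_refl; first exact: contin_cst.
    by move=> x _; exact: sphere_qconj.
  have rk : homotopic (sphere R 3) (sphere R 3) (fun x => k (u base3, v (pinchr x)))
      (fun x => k (u base3, v (pinchr x))).
    apply: homotopic_refl.
      apply: (contin_comp (B := S2xS3 R)) ck.
        by move=> x Sx; split; [exact: Su|exact/Sv/sphere_pinchr].
      apply: contin_pair; first exact: contin_cst.
      exact: homotopic_contin hv.
    by move=> x Sx; apply: Sk; split; [exact: Su|exact/Sv/sphere_pinchr].
  have := homotopic_qmul (homotopic_qmul null rc) rk.
  by under [X in homotopic _ _ _ X]eq_fun do rewrite qmulqV// q1mul.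
have step3 : homotopic (sphere R 3) (sphere R 3) id (fun x => qpow c (v x)).
  (* Moving the S^2 argument to [base2] turns the map into k o T1 o v, and k o T1 is homotopic to
     the power c by [kT]. *)
  apply: homotopic_trans step2 _.
  apply: homotopic_trans (homk _ _ _ (homotopic_pair
    (homotopic_sphere_cst _ (Su _ S1) S2) hv)) _.
  exact: (homotopic_comp rv kT).
case: cb step3 => -> step3; first exact: id_not_qexp step3.
have E : (fun x => qpow (- b%:Z) (v x)) = fun x => qexp b (qconj (v x)).
  by apply/funext => x; rewrite qpow_negz.
rewrite E in step3; apply: id_not_qexp step3 => //; first exact: contin_qconj.
by move=> x Sx; apply: sphere_qconj; exact: Sv.
Qed.

End Diffeomorphisms.

Theorem theorem1p10 (R : realType) :
  (forall a b : int, b = 1 \/ b = -1 ->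
     represented_by_embedding R a b /\
     (forall g, embedding (S2xS3 R) g -> htpy_class R a b g ->
        htpic_to_diffeo_T1 g))
  /\
  (forall b : nat, b = 2%N \/ (3 <= b)%N /\ odd b ->
     exists a : nat, (a < b)%N /\
       forall k c : int, c = b%:Z \/ c = - b%:Z ->
         represented_by_embedding R (a%:Z + k * b%:Z) c /\
         (forall g, embedding (S2xS3 R) g ->
            htpy_class R (a%:Z + k * b%:Z) c g -> ~ htpic_to_diffeo_T1 g)).
Proof.
split=> [a b b1|b hb].
  split; last by move=> g _; exact: htpic_to_diffeo_twist.
  by have := represented_by_emb_map a 0 b1; rewrite !mulr1.
have b1 : (1 < b)%N by case: hb => [->//|[b3 _]]; exact: ltnW.
exists 0%N; split=> [|k c cb]; first exact: ltnW.
split; last by move=> g _; exact: not_htpic_to_diffeo cb.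
rewrite add0r -(prednK (ltnW b1)); set n := b.-1.
have cE : exists2 s : int, s = 1 \/ s = -1 & c = s * n.+1%:Z.
  rewrite /n prednK ?(ltnW b1)//.
  by case: cb => ->; [exists 1; [left|rewrite mul1r]|exists (-1);
    [right|rewrite mulN1r]].
by have [s s1 ->] := cE; exact: represented_by_emb_map.
Qed.
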